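(* Let $B$ be a finite-dimensional Hopf algebra over a field $k$, and let $H$ be a braided Hopf algebra in the Yetter–Drinfeld category $({}^B_B\mathcal{YD},C)$ with $C_{H,H}=C_{H,H}^{-1}$. Let $U$ be a braided Hopf subalgebra of the finite dual $H^\circ$ and $V$ a braided Hopf subalgebra of $H$, both with invertible antipodes. Assume that $U$ is dense in $H^*$ and that the $RL$-condition holds on $U$ and $V$ under $\langle\,,\rangle=\langle\,,\rangle_{ev}\,C_{V,U}:V\otimes U\to k$. Let $(R,\psi)$ be a right $V$-comodule algebra in ${}^B_B\mathcal{YD}$, regarded as a left $U$-module algebra via $$\alpha=(R\otimes\langle\,,\rangle)(R\otimes C_{U,V})(C_{U,R}\otimes V)(U\otimes\psi),$$ and let $V$ act on $R\# U$ by acting trivially on $R$ and via $\rightharpoonup$ on $U$, i.e. via $(R\otimes\rightharpoonup)(C_{V,R}\otimes U)$. Then $$(R\# U)\# V\;\cong\; R\otimes (U\# V)\qquad\text{as }k\text{-algebras}.$$ Moreover, if $B$ is commutative and cocommutative, then this isomorphism is an isomorphism of algebras in ${}^B_B\mathcal{YD}$.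
   Context: ${}^B_B\mathcal{YD}$ is the category of left-left Yetter–Drinfeld modules over $B$ (left $B$-modules and left $B$-comodules $v\mapsto\sum v_{(-1)}\otimes v_{(0)}$ with $\sum(b\cdot v)_{(-1)}\otimes(b\cdot v)_{(0)}=\sum b_1v_{(-1)}S(b_3)\otimes b_2\cdot v_{(0)}$), with braiding $C_{X,Y}(x\otimes y)=\sum x_{(-1)}\cdot y\otimes x_{(0)}$. A braided Hopf algebra in it is a Hopf algebra object; module algebras and comodule algebras are understood in ${}^B_B\mathcal{YD}$. For an object $W$ and a morphism $f$, $W\otimes f=\mathrm{id}_W\otimes f$, $f\otimes W=f\otimes\mathrm{id}_W$. Dual: for $X\in{}^B_B\mathcal{YD}$, $X^*=\mathrm{Hom}_k(X,k)$ is in ${}^B_B\mathcal{YD}$ with $(b\cdot f)(x)=f(S(b)\cdot x)$ and coaction determined by $\sum f_{(-1)}f_{(0)}(x)=\sum f(x_{(0)})S^{-1}(x_{(-1)})$; evaluation is then a morphism $X^*\otimes X\to k$. $U$ dense in $H^*$ means: if $x\in H$ and $f(x)=0$ for all $f\in U$, then $x=0$. Finite dual: $H^\circ=\{f\in H^*\mid \ker f$ contains an ideal of $H$ of finite codimension which is a $B$-submodule and $B$-subcomodule of $H\}$, which is a braided Hopf algebra in ${}^B_B\mathcal{YD}$ with structure determined through $\langle\,,\rangle_{ev}$ by $(\langle\,,\rangle_{ev}\otimes\langle\,,\rangle_{ev})(H^\circ\otimes C\otimes H)(\Delta_{H^\circ}\otimes H\otimes H)=\langle\,,\rangle_{ev}(H^\circ\otimes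 m_H)$, $\epsilon_{H^\circ}=\langle\,,\rangle_{ev}(H^\circ\otimes\eta_H)$, $\langle\,,\rangle_{ev}(m_{H^\circ}\otimes H)=(\langle\,,\rangle_{ev}\otimes\langle\,,\rangle_{ev})(H^\circ\otimes C\otimes H)(H^\circ\otimes H^\circ\otimes\Delta_H)$, $\langle\,,\rangle_{ev}(\eta_{H^\circ}\otimes H)=\epsilon_H$, $\langle\,,\rangle_{ev}(S_{H^\circ}\otimes H)=\langle\,,\rangle_{ev}(H^\circ\otimes S_H)$, where $C=C_{H^\circ,H}$. Smash product: for a left $K$-module algebra $(A,\alpha)$ over a braided Hopf algebra $K$, $A\# K$ is $A\otimes K$ with unit $\eta_A\otimes\eta_K$ and multiplication $(m_A\otimes m_K)(A\otimes\alpha\otimes K\otimes K)(A\otimes K\otimes C_{K,A}\otimes K)(A\otimes\Delta_K\otimes A\otimes K)$. $R\otimes(U\# V)$ is the braided tensor product algebra, with multiplication $(m_R\otimes m_{U\# V})(R\otimes C_{U\# V,R}\otimes (U\# V))$. Action: $U$ is a left $V$-module algebra via $\rightharpoonup\,=(U\otimes\langle\,,\rangle)(C_{V,U}\otimes U)(V\otimes\Delta_U)$; this defines $U\# V$, and $(R\# U)\# V$ is formed with the action of $V$ on $R\# U$ in the claim. $RL$-condition on $U$ and $V$ under $\langle\,,\rangle:V\otimes U\to k$: define $k$-linear maps $\lambda:U\otimes V\to\mathrm{End}_kU$ and $\rho:V\otimes U\to\mathrm{End}_kU$ by $\lambda(h\# f)(x)=(m\otimes\langle\,,\rangle)(U\otimes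 C_{V,U}\otimes U)(U\otimes V\otimes\Delta)(h\otimes f\otimes x)=\sum\langle f,x_{2(0)}\rangle\,h\,(S^{-1}(x_{2(-1)})\cdot x_1)$ and $\rho(f\# h)(x)=\sum\langle f,h_{(-1)1}\cdot x_1\rangle\,(h_{(-1)2}\cdot x_2)\,h_{(0)}$, for $h,x\in U$, $f\in V$. The condition is $\rho(V\# 1)\subseteq\lambda(U\# V)$. *)

(* Defs.v *)
From HB Require Import structures.
From mathcomp Require Import all_boot all_algebra all_field.
From mathcomp Require Import boolp.

Set Implicit Arguments.
Unset Strict Implicit.
Unset Printing Implicit Defensive.

Import GRing.Theory.
Local Open Scope ring_scope.
Local Open Scope quotient_scope.

(* [tensor V W] consists of the finite formal sums of pairs (v, w), encoded as
   sequences of pairs, modulo having the same image under all bilinear maps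
   V * W -> X.  This is the free vector space on V * W modulo the relations of
   bilinearity. *)

Notation bilinear f := (bilinear_for *:%R *:%R f).

Section TensorProduct.
Variables (k : fieldType) (V W : lmodType k).

Definition formal_eval (X : lmodType k) (F : V -> W -> X) (s : seq (V * W)) : X :=
  \sum_(p <- s) F p.1 p.2.

Definition formal_equiv (s t : seq (V * W)) : Prop :=
  forall (X : lmodType k) (F : V -> W -> X),
    bilinear F -> formal_eval F s = formal_eval F t.

Definition formal_equivb (s t : seq (V * W)) : bool := `[< formal_equiv s t >].

Lemma formal_equivb_class : equiv_class_of formal_equivb.
Proof.
split=> [s|s t|s t u]; first exact/asboolP.
- by apply/asboolP/asboolP => h X F hF; rewrite h.
- move=> /asboolP h1 /asboolP h2; apply/asboolP => X F hF.
  by rewrite h1 // h2.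
Qed.

Definition formal_equiv_rel : equiv_rel (seq (V * W)) :=
  EquivRelPack formal_equivb_class.

Definition tensor : Type := {eq_quot formal_equiv_rel}.

HB.instance Definition _ := Choice.on tensor.
HB.instance Definition _ := EqQuotient.on tensor.

Definition tensor_of (s : seq (V * W)) : tensor := \pi_tensor s.

Lemma tensor_ofP s t : tensor_of s = tensor_of t <-> formal_equiv s t.
Proof.
split=> [/eqP|h]; last by apply/eqP; rewrite eqmodE; apply/asboolP.
by rewrite eqmodE => /asboolP.
Qed.

Lemma formal_equiv_repr s : formal_equiv (repr (tensor_of s)) s.
Proof. by apply/tensor_ofP; rewrite /tensor_of reprK. Qed.

Definition ptens (v : V) (w : W) : tensor := tensor_of [:: (v, w)].

(* Sweedler sum: if t = v1 (x) w1 + ... + vn (x) wn and F is bilinear,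
   then [tsum F t] = F v1 w1 + ... + F vn wn. *)
Definition tsum (X : nmodType) (F : V -> W -> X) (t : tensor) : X :=
  \sum_(p <- repr t) F p.1 p.2.

Lemma tsum_of (X : lmodType k) (F : V -> W -> X) s :
  bilinear F -> tsum F (tensor_of s) = formal_eval F s.
Proof. exact: formal_equiv_repr. Qed.

Definition tens_add (s t : tensor) := tensor_of (repr s ++ repr t).
Definition tens_scale (a : k) (s : tensor) :=
  tensor_of [seq (a *: p.1, p.2) | p <- repr s].
Definition tens_zero := tensor_of [::].
Definition tens_opp := tens_scale (-1).

Lemma tsum0 (X : lmodType k) (F : V -> W -> X) :
  bilinear F -> tsum F tens_zero = 0.
Proof. by move=> hF; rewrite tsum_of // /formal_eval big_nil. Qed.

Lemma tsumD (X : lmodType k) (F : V -> W -> X) s t :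
  bilinear F -> tsum F (tens_add s t) = tsum F s + tsum F t.
Proof. by move=> hF; rewrite tsum_of // /formal_eval big_cat. Qed.

Lemma tsumZ (X : lmodType k) (F : V -> W -> X) a s :
  bilinear F -> tsum F (tens_scale a s) = a *: tsum F s.
Proof.
move=> hF; rewrite tsum_of // /formal_eval big_map scaler_sumr.
apply: eq_bigr => p _ /=.
exact: (scalable_linear (hF.1 p.2)).
Qed.

Lemma tensor_eq s t :
  (forall (X : lmodType k) (F : V -> W -> X), bilinear F -> tsum F s = tsum F t) ->
  s = t.
Proof. by move=> h; rewrite -[s]reprK -[t]reprK; apply/tensor_ofP => X F /h. Qed.

Fact tens_addA : associative tens_add.
Proof. by move=> s t u; apply: tensor_eq => X F hF; rewrite !tsumD // addrA. Qed.
Fact tens_addC : commutative tens_add.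
Proof. by move=> s t; apply: tensor_eq => X F hF; rewrite !tsumD // addrC. Qed.
Fact tens_add0 : left_id tens_zero tens_add.
Proof.
by move=> s; apply: tensor_eq => X F hF; rewrite tsumD // tsum0 // add0r.
Qed.
Fact tens_addN : left_inverse tens_zero tens_opp tens_add.
Proof.
move=> s; apply: tensor_eq => X F hF.
by rewrite tsumD // tsumZ // tsum0 // scaleN1r addNr.
Qed.
HB.instance Definition _ :=
  GRing.isZmodule.Build tensor tens_addA tens_addC tens_add0 tens_addN.

Fact tens_scaleA a b s : tens_scale a (tens_scale b s) = tens_scale (a * b) s.
Proof. by apply: tensor_eq => X F hF; rewrite !tsumZ // scalerA. Qed.
Fact tens_scale1 : left_id 1 tens_scale.
Proof. by move=> s; apply: tensor_eq => X F hF; rewrite tsumZ // scale1r. Qed.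
Fact tens_scaleDr : right_distributive tens_scale +%R.
Proof.
by move=> a s t; apply: tensor_eq => X F hF; rewrite !(tsumZ, tsumD) // scalerDr.
Qed.
Fact tens_scaleDl s : {morph tens_scale^~ s : a b / a + b}.
Proof.
by move=> a b; apply: tensor_eq => X F hF; rewrite !(tsumZ, tsumD) // scalerDl.
Qed.
HB.instance Definition _ := GRing.Zmodule_isLmodule.Build k tensor
  tens_scaleA tens_scale1 tens_scaleDr tens_scaleDl.

Lemma tsum_pure (X : lmodType k) (F : V -> W -> X) v w :
  bilinear F -> tsum F (ptens v w) = F v w.
Proof. by move=> hF; rewrite tsum_of // /formal_eval big_seq1. Qed.

Lemma tsum_linear (X : lmodType k) (F : V -> W -> X) :
  bilinear F -> linear (tsum F).
Proof. by move=> hF a s t; rewrite tsumD // tsumZ. Qed.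

Lemma ptens_bilinear : bilinear ptens.
Proof.
split=> u a x y; apply: tensor_eq => X F hF; rewrite tsumD // tsumZ //.
  by rewrite !tsum_pure // (hF.1 u a x y).
by rewrite !tsum_pure // (hF.2 u a x y).
Qed.

Lemma tensor_of_sum s : tensor_of s = \sum_(p <- s) ptens p.1 p.2.
Proof.
elim: s => [|p s IHs]; first by rewrite big_nil.
rewrite big_cons -IHs; apply: tensor_eq => X F hF.
by rewrite tsumD // !tsum_of // /formal_eval big_cons big_seq1.
Qed.

Lemma tsum_ptens t : tsum ptens t = t.
Proof. by rewrite /tsum -tensor_of_sum /tensor_of reprK. Qed.

End TensorProduct.

Arguments ptens {k V W}.
Arguments tsum {k V W X}.

Notation "v ⊗ w" := (ptens v w) (at level 40, left associativity) : ring_scope.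

Notation "'\tsum_' ( x , y <- t ) E" := (tsum (fun x y => E) t)
  (at level 36, E at level 36, x binder, y binder,
   format "'[' '\tsum_' ( x ,  y  <-  t ) '/  '  E ']'") : ring_scope.

Record hopfAlg (k : fieldType) := HopfAlg {
  hopf_car :> falgType k;
  hcop : {linear hopf_car -> tensor hopf_car hopf_car};
  hcou : {scalar hopf_car};
  hant : {linear hopf_car -> hopf_car};
  hcop1 : hcop 1 = 1 ⊗ 1;
  hcopM : forall a b, hcop (a * b) =
    \tsum_(a1, a2 <- hcop a) \tsum_(b1, b2 <- hcop b) ((a1 * b1) ⊗ (a2 * b2));
  hcou1 : hcou 1 = 1;
  hcouM : forall a b, hcou (a * b) = hcou a * hcou b;
  hcopA : forall a,
    \tsum_(a1, a2 <- hcop a) \tsum_(a11, a12 <- hcop a1) (a11 ⊗ (a12 ⊗ a2)) =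
    \tsum_(a1, a2 <- hcop a) \tsum_(a21, a22 <- hcop a2) (a1 ⊗ (a21 ⊗ a22));
  hcoul : forall a, \tsum_(a1, a2 <- hcop a) (hcou a1 *: a2) = a;
  hcour : forall a, \tsum_(a1, a2 <- hcop a) (hcou a2 *: a1) = a;
  hantl : forall a, \tsum_(a1, a2 <- hcop a) (hant a1 * a2) = hcou a *: 1;
  hantr : forall a, \tsum_(a1, a2 <- hcop a) (a1 * hant a2) = hcou a *: 1
}.

(* [inv_lfun] is a two-sided inverse only for a bijective map; the antipode of
   a finite-dimensional Hopf algebra is bijective. *)
Definition hantV (k : fieldType) (B : hopfAlg k) : B -> B :=
  (linfun (hant B))^-1%VF.

Definition hcommutative (k : fieldType) (B : hopfAlg k) : Prop :=
  forall a b : B, a * b = b * a.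

Definition hcocommutative (k : fieldType) (B : hopfAlg k) : Prop :=
  forall a : B, \tsum_(a1, a2 <- hcop B a) (a2 ⊗ a1) = hcop B a.

(* The records [ydObj], [ydAlg] and [ydHopf] carry only the operations of
   objects, algebras and Hopf algebras in the category of left-left
   Yetter-Drinfeld modules over B; the axioms are the predicates [is_yd],
   [is_ydalg] and [is_ydhopf]. *)

Section YetterDrinfeld.
Variables (k : fieldType) (B : hopfAlg k).

Record ydObj := YDObj {
  yd_car :> lmodType k;
  yd_act : B -> yd_car -> yd_car;
  yd_coact : yd_car -> tensor B yd_car
}.

Record ydAlg := YDAlg {
  alg_obj :> ydObj;
  yd_one : alg_obj;
  yd_mul : alg_obj -> alg_obj -> alg_obj
}.

Record ydHopf := YDHopf {
  hopf_alg :> ydAlg;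
  yd_cop : hopf_alg -> tensor hopf_alg hopf_alg;
  yd_cou : hopf_alg -> k;
  yd_ant : hopf_alg -> hopf_alg
}.

End YetterDrinfeld.

Arguments yd_act {k B X} : rename.
Arguments yd_coact {k B X} : rename.
Arguments yd_one {k B} A : rename.
Arguments yd_mul {k B A} : rename.
Arguments yd_cop {k B H} : rename.
Arguments yd_cou {k B H} : rename.
Arguments yd_ant {k B H} : rename.

Notation "b ·> x" := (yd_act b x) (at level 40, left associativity) : ring_scope.
Notation "x ∗ y" := (yd_mul x y) (at level 40, left associativity) : ring_scope.

Section Category.
Variables (k : fieldType) (B : hopfAlg k).

Record is_yd (X : ydObj B) : Prop := IsYD {
  yd_act_bilinear : bilinear (@yd_act _ _ X);
  yd_act1 : forall x : X, 1 ·> x = x;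
  yd_actM : forall (a b : B) (x : X), (a * b) ·> x = a ·> (b ·> x);
  yd_coact_linear : linear (@yd_coact _ _ X);
  yd_coactA : forall x : X,
    \tsum_(b, y <- yd_coact x) \tsum_(b1, b2 <- hcop B b) (b1 ⊗ (b2 ⊗ y)) =
    \tsum_(b, y <- yd_coact x) \tsum_(c, z <- yd_coact y) (b ⊗ (c ⊗ z));
  yd_coact_cou : forall x : X,
    \tsum_(b, y <- yd_coact x) (hcou B b *: y) = x;
  yd_compat : forall (b : B) (x : X),
    yd_coact (b ·> x) =
    \tsum_(b', b3 <- hcop B b) \tsum_(b1, b2 <- hcop B b')
      \tsum_(c, y <- yd_coact x) ((b1 * c * hant B b3) ⊗ (b2 ·> y))
}.

Record is_ydmorph (X Y : ydObj B) (f : X -> Y) : Prop := IsYDMorph {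
  ydmorph_linear : linear f;
  ydmorph_act : forall (b : B) (x : X), f (b ·> x) = b ·> f x;
  ydmorph_coact : forall x : X,
    yd_coact (f x) = \tsum_(b, y <- yd_coact x) (b ⊗ f y)
}.

Definition ydtens (X Y : ydObj B) : ydObj B :=
  @YDObj k B (tensor X Y)
    (fun b t => \tsum_(b1, b2 <- hcop B b) \tsum_(x, y <- t)
                  ((b1 ·> x) ⊗ (b2 ·> y)))
    (fun t => \tsum_(x, y <- t)
                \tsum_(b, x0 <- yd_coact x) \tsum_(c, y0 <- yd_coact y)
                  ((b * c) ⊗ (x0 ⊗ y0))).

Definition braid (X Y : ydObj B) (t : tensor X Y) : tensor Y X :=
  \tsum_(x, y <- t) \tsum_(b, x0 <- yd_coact x) ((b ·> y) ⊗ x0).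

Definition ydunit : ydAlg B :=
  @YDAlg k B
    (@YDObj k B (k^o : lmodType k) (fun b c => hcou B b * c)
       (fun c => 1 ⊗ c))
    (1 : k) (fun c d : k => c * d).

Record is_kalg (A : ydAlg B) : Prop := IsKAlg {
  kalg_bilinear : bilinear (@yd_mul _ _ A);
  kalg_mulA : forall x y z : A, x ∗ (y ∗ z) = (x ∗ y) ∗ z;
  kalg_mul1l : forall x : A, yd_one A ∗ x = x;
  kalg_mul1r : forall x : A, x ∗ yd_one A = x
}.

Record is_algmorph (A A' : ydAlg B) (f : A -> A') : Prop := IsAlgMorph {
  algmorph_linear : linear f;
  algmorph1 : f (yd_one A) = yd_one A';
  algmorphM : forall x y : A, f (x ∗ y) = f x ∗ f y
}.

Record is_ydalg (A : ydAlg B) : Prop := IsYDAlg {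
  ydalg_yd : is_yd A;
  ydalg_kalg : is_kalg A;
  ydalg_mul : @is_ydmorph (ydtens A A) A (fun t => \tsum_(x, y <- t) (x ∗ y));
  ydalg_one : @is_ydmorph ydunit A (fun c => c *: yd_one A)
}.

(* (m_A (x) m_A') (A (x) C_{A',A} (x) A') *)
Definition btens (A A' : ydAlg B) : ydAlg B :=
  @YDAlg k B (ydtens A A') (yd_one A ⊗ yd_one A')
    (fun s t =>
       \tsum_(a, a' <- s) \tsum_(c, c' <- t)
         \tsum_(c1, a'1 <- braid (a' ⊗ c)) ((a ∗ c1) ⊗ (a'1 ∗ c'))).

Record is_ydhopf (H : ydHopf B) : Prop := IsYDHopf {
  ydhopf_alg : is_ydalg H;
  ydhopf_cop : @is_ydmorph H (ydtens H H) yd_cop;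
  ydhopf_cou : @is_ydmorph H ydunit yd_cou;
  ydhopf_ant : @is_ydmorph H H yd_ant;
  ydhopf_copM : @is_algmorph H (btens H H) yd_cop;
  ydhopf_couM : @is_algmorph H ydunit yd_cou;
  ydhopf_copA : forall x : H,
    \tsum_(x1, x2 <- yd_cop x) \tsum_(x11, x12 <- yd_cop x1) (x11 ⊗ (x12 ⊗ x2)) =
    \tsum_(x1, x2 <- yd_cop x) \tsum_(x21, x22 <- yd_cop x2) (x1 ⊗ (x21 ⊗ x22));
  ydhopf_coul : forall x : H, \tsum_(x1, x2 <- yd_cop x) (yd_cou x1 *: x2) = x;
  ydhopf_cour : forall x : H, \tsum_(x1, x2 <- yd_cop x) (yd_cou x2 *: x1) = x;
  ydhopf_antl : forall x : H,
    \tsum_(x1, x2 <- yd_cop x) (yd_ant x1 ∗ x2) = yd_cou x *: yd_one H;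
  ydhopf_antr : forall x : H,
    \tsum_(x1, x2 <- yd_cop x) (x1 ∗ yd_ant x2) = yd_cou x *: yd_one H
}.

(* A braided Hopf subalgebra of H is given by its inclusion K -> H. *)
Record is_hopf_inclusion (K H : ydHopf B) (i : K -> H) : Prop := IsHopfInclusion {
  hincl_inj : injective i;
  hincl_yd : @is_ydmorph K H i;
  hincl_alg : @is_algmorph K H i;
  hincl_cop : forall x : K, yd_cop (i x) = \tsum_(x1, x2 <- yd_cop x) (i x1 ⊗ i x2);
  hincl_cou : forall x : K, yd_cou (i x) = yd_cou x;
  hincl_ant : forall x : K, yd_ant (i x) = i (yd_ant x)
}.

Definition fin_codim (X : lmodType k) (I : X -> Prop) : Prop :=
  exists (n : nat) (e : 'I_n -> X), forall x : X,
    exists c : 'I_n -> k, I (x - \sum_(i < n) c i *: e i).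

Record is_yd_ideal (H : ydAlg B) (I : H -> Prop) : Prop := IsYDIdeal {
  ydideal0 : I 0;
  ydidealP : forall (a : k) (x y : H), I x -> I y -> I (a *: x + y);
  ydideal_l : forall x y : H, I y -> I (x ∗ y);
  ydideal_r : forall x y : H, I x -> I (x ∗ y);
  ydideal_act : forall (b : B) (x : H), I x -> I (b ·> x);
  ydideal_coact : forall x : H, I x ->
    exists2 s : seq (B * H), (forall p, p \in s -> I p.2) &
      yd_coact x = \sum_(p <- s) p.1 ⊗ p.2
}.

Definition in_findual (H : ydAlg B) (f : H -> k) : Prop :=
  scalar f /\
  exists I : H -> Prop,
    [/\ is_yd_ideal I, fin_codim I & forall x, I x -> f x = 0].

(* D, together with ev : D (x) H -> k, is the finite dual of H: f |-> ev f is
   injective with image the subset [in_findual] of H^*, and the structure of D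
   is the one determined through ev. *)
Record is_findual (H D : ydHopf B) (ev : D -> H -> k) : Prop := IsFinDual {
  findual_hopf : is_ydhopf D;
  findual_linear : forall x : H, scalar (ev^~ x);
  findual_inj : forall f g : D, ev f =1 ev g -> f = g;
  findual_in : forall f : D, in_findual (ev f);
  findual_onto : forall f : H -> k, in_findual f -> exists g : D, ev g =1 f;
  findual_act : forall (b : B) (f : D) (x : H), ev (b ·> f) x = ev f (hant B b ·> x);
  findual_coact : forall (f : D) (x : H),
    \tsum_(b, f0 <- yd_coact f) (ev f0 x *: b) =
    \tsum_(b, x0 <- yd_coact x) (ev f x0 *: hantV b);
  findual_cop : forall (f : D) (x y : H),
    \tsum_(f1, f2 <- yd_cop f) \tsum_(x', f2' <- braid (f2 ⊗ x))
      (ev f1 x' * ev f2' y) = ev f (x ∗ y);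
  findual_cou : forall f : D, yd_cou f = ev f (yd_one H);
  findual_mul : forall (f g : D) (x : H),
    ev (f ∗ g) x =
    \tsum_(x1, x2 <- yd_cop x) \tsum_(x1', g' <- braid (g ⊗ x1))
      (ev f x1' * ev g' x2);
  findual_one : forall x : H, ev (yd_one D) x = yd_cou x;
  findual_ant : forall (f : D) (x : H), ev (yd_ant f) x = ev f (yd_ant x)
}.

(* (m_A (x) m_K)(A (x) al (x) K (x) K)(A (x) K (x) C_{K,A} (x) K)
     (A (x) Delta_K (x) A (x) K) *)
Definition smash (A : ydAlg B) (K : ydHopf B) (al : K -> A -> A) : ydAlg B :=
  @YDAlg k B (ydtens A K) (yd_one A ⊗ yd_one K)
    (fun s t =>
       \tsum_(a, h <- s) \tsum_(c, g <- t)
         \tsum_(h1, h2 <- yd_cop h) \tsum_(c', h2' <- braid (h2 ⊗ c))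
           ((a ∗ al h1 c') ⊗ (h2' ∗ g))).

Record is_comodalg (R : ydAlg B) (K : ydHopf B) (psi : R -> tensor R K) : Prop :=
  IsComodAlg {
  comodalg_yd : @is_ydmorph R (ydtens R K) psi;
  comodalg_coA : forall r : R,
    \tsum_(r0, v <- psi r) \tsum_(v1, v2 <- yd_cop v) (r0 ⊗ (v1 ⊗ v2)) =
    \tsum_(r0, v <- psi r) \tsum_(r00, w <- psi r0) (r00 ⊗ (w ⊗ v));
  comodalg_cou : forall r : R, \tsum_(r0, v <- psi r) (yd_cou v *: r0) = r;
  comodalg_alg : @is_algmorph R (btens R K) psi
}.

Section Pairing.
Variables (U V : ydHopf B).

(* ev o C_{V,U}, for ev : U (x) V -> k *)
Definition flip_pair (ev : U -> V -> k) (v : V) (u : U) : k :=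
  \tsum_(u', v' <- braid (v ⊗ u)) ev u' v'.

Variable pr : V -> U -> k.

(* (U (x) <,>)(C_{V,U} (x) U)(V (x) Delta_U) *)
Definition harpoon (v : V) (u : U) : U :=
  \tsum_(u1, u2 <- yd_cop u) \tsum_(u1', v' <- braid (v ⊗ u1))
    (pr v' u2 *: u1').

(* (R (x) <,>)(R (x) C_{U,V})(C_{U,R} (x) V)(U (x) psi) *)
Definition comod_act (R : ydAlg B) (psi : R -> tensor R V) (u : U) (r : R) : R :=
  \tsum_(r0, v <- psi r) \tsum_(r0', u' <- braid (u ⊗ r0))
    \tsum_(v', u'' <- braid (u' ⊗ v)) (pr v' u'' *: r0').

(* (R (x) harpoon)(C_{V,R} (x) U) *)
Definition snd_act (R : ydAlg B) (v : V) (t : tensor R U) : tensor R U :=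
  \tsum_(r, u <- t) \tsum_(r', v' <- braid (v ⊗ r)) (r' ⊗ harpoon v' u).

(* (m (x) <,>)(U (x) C_{V,U} (x) U)(U (x) V (x) Delta) *)
Definition RL_lambda (t : tensor U V) (x : U) : U :=
  \tsum_(h, f <- t) \tsum_(x1, x2 <- yd_cop x) \tsum_(x1', f' <- braid (f ⊗ x1))
    (pr f' x2 *: (h ∗ x1')).

(* f (x) h |-> (x |-> <f, h_(-1)1 . x_1> (h_(-1)2 . x_2) h_(0)) *)
Definition RL_rho (t : tensor V U) (x : U) : U :=
  \tsum_(f, h <- t) \tsum_(b, h0 <- yd_coact h) \tsum_(b1, b2 <- hcop B b)
    \tsum_(x1, x2 <- yd_cop x) (pr f (b1 ·> x1) *: ((b2 ·> x2) ∗ h0)).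

Definition RL_condition : Prop :=
  forall f : V, exists t : tensor U V, RL_rho (f ⊗ yd_one U) =1 RL_lambda t.

End Pairing.

Record is_kalg_iso (A A' : ydAlg B) (f : A -> A') : Prop := IsKAlgIso {
  kalg_iso_src : is_kalg A;
  kalg_iso_tgt : is_kalg A';
  kalg_iso_morph : is_algmorph f;
  kalg_iso_bij : bijective f
}.

Record is_ydalg_iso (A A' : ydAlg B) (f : A -> A') : Prop := IsYDAlgIso {
  ydalg_iso_src : is_ydalg A;
  ydalg_iso_tgt : is_ydalg A';
  ydalg_iso_kalg : is_kalg_iso f;
  ydalg_iso_yd : is_ydmorph f
}.

End Category.

(* Main.v *)
(* Put Z = U # V and let lambda : Z -> End U be the map of the RL-condition; it is an
   injective algebra morphism.  Hence the condition gives a map w : V -> Z with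
   lambda (w f) = rho (f # 1), which is a morphism in the Yetter-Drinfeld category and
   satisfies w f * w g = sum w (g' * f'), where g' (x) f' = C (f (x) g).  The map
     R (x) Z -> (R # U) # V,   r (x) z |-> sum r_0 (x) w (r_1) z
   is bijective, with inverse r (x) z |-> sum r_0 (x) w (S^-1 r_1) z.  Writing the product
   of (R # U) # V as (r (x) z) (s (x) z') = sum r t (x) y z', where z (x) s |-> sum t (x) y
   involves the action of U on R, multiplicativity reduces to
     sum t (x) y w (s_1) = sum s'_0 (x) w (s'_1) z',
   where t (x) y comes from z (x) s_0 on the left, and s' (x) z' = C (z (x) s) on the
   right; this follows from applying lambda.  The axioms of (R # U) # V are transported
   from R (x) Z.  The symmetry of C_{H,H} passes to U and V because evaluation is a
   morphism that separates points. *)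

(* Two difficulties shape the proof. Identities are needed deep inside nested Sweedler sums, so most
   are stated under an arbitrary multilinear map [F]; taking [F] universal recovers the identity of
   tensors. And unfolding actions and coactions of composite objects grows quickly, so the arguments
   are strand diagrams: a pairing is a morphism to the unit object, hence a strand that crosses both
   of its legs slides off, and a map past which every strand slides is already a morphism.

   Lambda is injective because the inverse antipode of [U] recovers <f, x> h from lambda (h # f).
   The same injectivity gives associativity of U # V, whose product becomes composition in End U.
   The map rho pairs with the first leg of x, so composition reverses products up to a crossing;
   this is why w reverses products, and why S^-1 rather than S inverts the twist. The dual coaction
   and the inverse braiding involve S^-1 of [B], whose existence is derived from a linear relation
   among the powers of S. *)
From mathcomp Require Import all_boot all_algebra all_field.
From mathcomp Require Import boolp.
Require Import Defs.
Set Implicit Arguments.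
Unset Strict Implicit.
Unset Printing Implicit Defensive.
Import GRing.Theory.
Local Open Scope ring_scope.

(** * Linearity and Sweedler sums *)

(* Counterparts of [linear] and [bilinear] in which both conditions are conditions on
   one variable, so that the tactic [lin] below can follow the syntax of a function. *)
Definition klin (k : fieldType) (X Y : lmodType k) (f : X -> Y) : Prop :=
  forall a x y, f (a *: x + y) = a *: f x + f y.

Definition kbilin (k : fieldType) (X Y Z : lmodType k) (F : X -> Y -> Z) : Prop :=
  (forall y, klin (fun x => F x y)) /\ (forall x, klin (fun y => F x y)).

Definition ktrilin (k : fieldType) (X Y W Z : lmodType k) (F : X -> Y -> W -> Z) : Prop :=
  [/\ forall y w, klin (fun x => F x y w), forall x w, klin (fun y => F x y w)
    & forall x y, klin (fun w => F x y w)].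

Lemma ktrilin_l (k : fieldType) (X Y W Z : lmodType k) (F : X -> Y -> W -> Z) :
  ktrilin F -> forall y w, klin (fun x => F x y w).
Proof. by case. Qed.

Lemma ktrilin_m (k : fieldType) (X Y W Z : lmodType k) (F : X -> Y -> W -> Z) :
  ktrilin F -> forall x w, klin (fun y => F x y w).
Proof. by case. Qed.

Lemma ktrilin_r (k : fieldType) (X Y W Z : lmodType k) (F : X -> Y -> W -> Z) :
  ktrilin F -> forall x y, klin (fun w => F x y w).
Proof. by case. Qed.

Section Linearity.
Variable k : fieldType.
Implicit Types X Y W Z : lmodType k.

Lemma kbilinP X Y Z (F : X -> Y -> Z) : kbilin F <-> bilinear F.
Proof. by split=> -[h1 h2]; split=> u; [exact: h1 | exact: h2 | exact: h1 | exact: h2]. Qed.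

Lemma lin_id X : klin (fun x : X => x). Proof. by []. Qed.

Lemma lin_comp X Y Z (f : Y -> Z) (g : X -> Y) :
  klin f -> klin g -> klin (fun x => f (g x)).
Proof. by move=> hf hg a x y; rewrite hg hf. Qed.

(** With [t] fixed, [tsum] is a finite sum over [repr t], so linearity passes termwise even when
    [F x] is not bilinear. The lemmas [eq_tsum] and [tsumC] rest on the same fact. *)
Lemma lin_tsum_body X Y W Z (F : X -> Y -> W -> Z) (t : tensor Y W) :
  (forall y w, klin (fun x => F x y w)) -> klin (fun x => tsum (F x) t).
Proof.
move=> hF a x x'; rewrite /tsum scaler_sumr -big_split.
by apply: eq_bigr => p _; rewrite hF.
Qed.

Lemma lin_ptensl X Y (y : Y) : klin (fun x : X => x ⊗ y).
Proof. exact: (ptens_bilinear X Y).1. Qed.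

Lemma lin_ptensr X Y (x : X) : klin (fun y : Y => x ⊗ y).
Proof. exact: (ptens_bilinear X Y).2. Qed.

Lemma lin_ptensl_comp (T : lmodType k) X Y (g : T -> X) (y : Y) : klin g -> klin (fun x => g x ⊗ y).
Proof. by move=> hg a u v; rewrite hg lin_ptensl. Qed.

Lemma lin_ptensr_comp (T : lmodType k) X Y (g : T -> Y) (x : X) : klin g -> klin (fun y => x ⊗ g y).
Proof. by move=> hg a u v; rewrite hg lin_ptensr. Qed.

Lemma lin_scalel X Y (g : Y -> k^o) (x : X) :
  klin g -> klin (fun y => (g y : k) *: x).
Proof. by move=> hg a b c; rewrite hg scalerDl scalerA. Qed.

Lemma lin_scaler X Y (g : Y -> X) (c : k) : klin g -> klin (fun y => c *: g y).
Proof. by move=> hg a x y; rewrite hg scalerDr !scalerA mulrC. Qed.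

Lemma lin_mulkl Y (g : Y -> k^o) (c : k) :
  klin g -> klin (fun y => (g y : k) * c : k^o).
Proof. by move=> hg a x y; rewrite hg mulrDl -mulrA. Qed.

Lemma lin_mulkr Y (g : Y -> k^o) (c : k) :
  klin g -> klin (fun y => c * (g y : k) : k^o).
Proof. by move=> hg a x y; rewrite hg mulrDr mulrCA. Qed.

Lemma lin_sum X Y (f : X -> Y) (I : Type) (r : seq I) (F : I -> X) :
  klin f -> f (\sum_(i <- r) F i) = \sum_(i <- r) f (F i).
Proof.
move=> hf; have f0 : f 0 = 0 by have := hf (-1) 0 0; rewrite scaler0 addr0 scaleN1r addNr.
have fD x y : f (x + y) = f x + f y by have := hf 1 x y; rewrite !scale1r.
by apply: (big_morph f).
Qed.

Lemma linZ X Y (f : X -> Y) : klin f -> forall a x, f (a *: x) = a *: f x.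
Proof.
move=> hf a x; have f0 : f 0 = 0 by have := hf (-1) 0 0; rewrite scaler0 addr0 scaleN1r addNr.
by have := hf a x 0; rewrite !addr0 f0 addr0.
Qed.

Lemma lin0 X Y (f : X -> Y) : klin f -> f 0 = 0.
Proof. by move=> hf; rewrite -(scale0r 0) (linZ hf) scale0r. Qed.

Lemma lin_add X Y (f g : X -> Y) : klin f -> klin g -> klin (fun x => f x + g x).
Proof. by move=> hf hg a x y; rewrite hf hg scalerDr addrACA. Qed.

Lemma lin_opp X Y (f : X -> Y) : klin f -> klin (fun x => - f x).
Proof. by move=> hf a x y; rewrite hf opprD scalerN. Qed.

Lemma eq_tsum X Y (Z : nmodType) (F G : X -> Y -> Z) t :
  (forall x y, F x y = G x y) -> tsum F t = tsum G t.
Proof. by move=> h; apply: eq_bigr => p _. Qed.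

Lemma lin_tsum X Y W Z (f : W -> Z) (F : X -> Y -> W) t : klin f ->
  f (tsum F t) = tsum (fun x y => f (F x y)) t.
Proof. exact: lin_sum. Qed.

Lemma tsumC X Y X' Y' (Z : nmodType) (F : X -> Y -> X' -> Y' -> Z) t t' :
  tsum (fun x y => tsum (fun x' y' => F x y x' y') t') t =
  tsum (fun x' y' => tsum (fun x y => F x y x' y') t) t'.
Proof. exact: exchange_big. Qed.

Lemma tsum_scale X Y Z (a : k) (F : X -> Y -> Z) t :
  a *: tsum F t = tsum (fun x y => a *: F x y) t.
Proof. by apply: (lin_tsum (f := fun x : Z => a *: x)); apply: lin_scaler. Qed.

Lemma tensor_ext X Y Z (f g : tensor X Y -> Z) : klin f -> klin g ->
  (forall x y, f (x ⊗ y) = g (x ⊗ y)) -> f =1 g.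
Proof.
move=> hf hg h t; rewrite -(tsum_ptens t) !lin_tsum //.
exact: eq_tsum.
Qed.

Lemma tsum_lin X Y Z (F : X -> Y -> Z) : kbilin F -> klin (tsum F).
Proof. by move=> /kbilinP; exact: tsum_linear. Qed.

Lemma tsumE X Y Z (F : X -> Y -> Z) x y : kbilin F -> tsum F (x ⊗ y) = F x y.
Proof. by move=> /kbilinP; exact: tsum_pure. Qed.

Lemma tsum_tsum X Y X' Y' Z (F : X -> Y -> Z) (G : X' -> Y' -> tensor X Y) t :
  kbilin F -> tsum F (tsum G t) = tsum (fun x y => tsum F (G x y)) t.
Proof. by move=> hF; apply/lin_tsum/tsum_lin. Qed.

End Linearity.

Section YD.
Variables (k : fieldType) (B : hopfAlg k).
Implicit Types X Y : ydObj B.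

Section Composite.
Variable T : lmodType k.

Lemma lin_mulBl (g : T -> B) (b : B) : klin g -> klin (fun x => g x * b).
Proof. by move=> hg c x y; rewrite hg mulrDl scalerAl. Qed.

Lemma lin_mulBr (g : T -> B) (a : B) : klin g -> klin (fun x => a * g x).
Proof. by move=> hg c x y; rewrite hg mulrDr scalerAr. Qed.

Lemma lin_hcop (g : T -> B) : klin g -> klin (fun x => hcop B (g x)).
Proof. by move=> hg c x y; rewrite hg linearP. Qed.

Lemma lin_hant (g : T -> B) : klin g -> klin (fun x => hant B (g x)).
Proof. by move=> hg c x y; rewrite hg linearP. Qed.

Lemma lin_hcou (g : T -> B) : klin g -> klin (fun x => hcou B (g x) : k^o).
Proof. by move=> hg c x y; rewrite hg linearP. Qed.

Lemma lin_hantV (g : T -> B) : klin g -> klin (fun x => hantV (g x)).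
Proof. by move=> hg c x y; rewrite hg /hantV linearP. Qed.

Lemma lin_actl X (g : T -> B) (x : X) : is_yd X -> klin g -> klin (fun b => g b ·> x).
Proof. by move=> hX hg c u v; rewrite hg; exact: ((yd_act_bilinear hX).1 x). Qed.

Lemma lin_actr X (g : T -> X) (b : B) : is_yd X -> klin g -> klin (fun x => b ·> g x).
Proof. by move=> hX hg c u v; rewrite hg; exact: ((yd_act_bilinear hX).2 b). Qed.

Lemma lin_coact X (g : T -> X) : is_yd X -> klin g -> klin (fun x => yd_coact (g x)).
Proof. by move=> hX hg c u v; rewrite hg; exact: (yd_coact_linear hX). Qed.

Lemma lin_mull (A : ydAlg B) (g : T -> A) (y : A) :
  is_kalg A -> klin g -> klin (fun x => g x ∗ y).
Proof. by move=> hA hg c u v; rewrite hg; exact: ((kalg_bilinear hA).1 y). Qed.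

Lemma lin_mulr (A : ydAlg B) (g : T -> A) (x : A) :
  is_kalg A -> klin g -> klin (fun y => x ∗ g y).
Proof. by move=> hA hg c u v; rewrite hg; exact: ((kalg_bilinear hA).2 x). Qed.

Lemma lin_cop (K : ydHopf B) (g : T -> K) :
  is_ydhopf K -> klin g -> klin (fun x => yd_cop (g x)).
Proof. by move=> hK hg c u v; rewrite hg; exact: (ydmorph_linear (ydhopf_cop hK)). Qed.

Lemma lin_ant (K : ydHopf B) (g : T -> K) :
  is_ydhopf K -> klin g -> klin (fun x => yd_ant (g x)).
Proof. by move=> hK hg c u v; rewrite hg; exact: (ydmorph_linear (ydhopf_ant hK)). Qed.

Lemma lin_cou (K : ydHopf B) (g : T -> K) :
  is_ydhopf K -> klin g -> klin (fun x => yd_cou (g x) : k^o).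
Proof. by move=> hK hg c u v; rewrite hg; exact: (ydmorph_linear (ydhopf_cou hK)). Qed.

Lemma lin_braid X Y (g : T -> tensor X Y) :
  is_yd X -> is_yd Y -> klin g -> klin (fun x => braid (g x)).
Proof.
move=> hX hY hg c u v; rewrite hg; apply: tsum_lin; split=> [y|x] a z t /=.
  rewrite (yd_coact_linear hX); apply: tsum_lin; split=> [x0|b] d b1 b2.
    by rewrite (yd_act_bilinear hY).1 lin_ptensl.
  by rewrite lin_ptensr.
apply: (lin_tsum_body (F := fun y b x0 => (b ·> y) ⊗ x0)) => b x0 d b1 b2.
by rewrite (yd_act_bilinear hY).2 lin_ptensl.
Qed.

End Composite.

Lemma ydhopf_kalg (K : ydHopf B) : is_ydhopf K -> is_kalg K.
Proof. by move=> h; exact: ydalg_kalg (ydhopf_alg h). Qed.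

End YD.

Create HintDb yd.
#[global] Hint Resolve ydalg_yd ydhopf_alg ydalg_kalg ydhopf_kalg : yd.

Ltac yd_side := solve [eauto 6 with yd nocore].

Ltac lin_side := lazymatch goal with |- klin _ => idtac | _ => yd_side end.

Ltac lin_scal :=
  lazymatch goal with
  | |- klin (fun x => GRing.scale (@?a x) (@?y x)) =>
    lazymatch a with
    | (fun _ => ?c) => apply: lin_scaler
    | _ => apply: lin_scalel
    end
  end.

Ltac lin_hyp :=
    match goal with
    | H : kbilin ?F |- klin (fun x => ?F ?c (@?g x)) =>
      apply: (lin_comp (proj2 H c))
    | H : kbilin ?F |- klin (fun x => ?F (@?g x) ?c) =>
      apply: (lin_comp (proj1 H c))
    | H : klin ?F |- klin (fun x => ?F (@?g x)) =>
      apply: (lin_comp H)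
    | H : is_ydmorph ?F |- klin (fun x => ?F (@?g x)) =>
      apply: (lin_comp (ydmorph_linear H))
    | H : ktrilin ?F |- klin (fun x => ?F ?b ?c (@?g x)) =>
      apply: (lin_comp (ktrilin_r H b c))
    | H : ktrilin ?F |- klin (fun x => ?F ?b (@?g x) ?c) =>
      apply: (lin_comp (ktrilin_m H b c))
    | H : ktrilin ?F |- klin (fun x => ?F (@?g x) ?b ?c) =>
      apply: (lin_comp (ktrilin_l H b c))
    end.

Ltac lin_actr_tac :=
  first [apply: lin_actr; lin_side | apply: (@lin_actr _ _ _ (ydtens _ _)); lin_side | lin_hyp].

(** A product, tensor or Sweedler sum is linear in a variable that occurs on one side only, so the
    branches for them first test which side is constant. *)
Ltac lin_step :=
  cbv beta;
  lazymatch goal with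
  | |- klin (fun x => x) => apply: lin_id
  | |- klin (fun x => tsum (@?F x) (@?t x)) =>
    lazymatch t with
    | (fun _ => ?c) => apply: lin_tsum_body; intros
    | _ => lazymatch F with
           | (fun _ => ?G) => apply: (lin_comp (tsum_lin _))
           end
    end
  | |- klin (fun x => ptens (@?f x) (@?g x)) =>
    lazymatch f with
    | (fun _ => ?c) => apply: lin_ptensr_comp
    | _ => lazymatch g with (fun _ => ?c) => apply: lin_ptensl_comp end
    end
  | |- klin (fun x => GRing.scale _ _) => lin_scal
  | |- klin (fun x => GRing.add _ _) => apply: lin_add
  | |- klin (fun x => GRing.opp _) => apply: lin_opp
  | |- klin (fun x => yd_mul (@?f x) (@?g x)) =>
    lazymatch f with
    | (fun _ => ?c) => first [apply: lin_mulr; lin_side | lin_hyp]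
    | _ => lazymatch g with
           | (fun _ => ?c) => first [apply: lin_mull; lin_side | lin_hyp] end
    end
  | |- klin (fun x => yd_act (@?f x) (@?g x)) =>
    lazymatch f with
    | (fun _ => ?c) => lin_actr_tac
    | _ => lazymatch g with
           | (fun _ => ?c) => first [apply: lin_actl; lin_side | lin_hyp] end
    end
  | |- klin (fun x => yd_coact _) =>
    first [apply: lin_coact; lin_side | lin_hyp]
  | |- klin (fun x => yd_cop _) =>
    apply: lin_cop; lin_side
  | |- klin (fun x => yd_ant _) =>
    apply: lin_ant; lin_side
  | |- klin (fun x => yd_cou _) =>
    apply: lin_cou; lin_side
  | |- klin (fun x => braid _) => apply: lin_braid; lin_side
  | |- klin (fun x => hantV _) => apply: lin_hantV
  | |- klin (fun x => _ (hcop _) _) => apply: lin_hcop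
  | |- klin (fun x => _ (hant _) _) => apply: lin_hant
  | |- klin (fun x => _ (hcou _) _) => apply: lin_hcou
  | |- klin (fun x => GRing.mul (@?f x) (@?g x)) =>
    lazymatch f with
    | (fun _ => ?c) => first [ apply: lin_mulBr
                             | apply: lin_mulkr ]
    | _ => lazymatch g with
           | (fun _ => ?c) => first [ apply: lin_mulBl
                                    | apply: lin_mulkl ] end
    end
  | |- klin (fun x => @?f x) =>
    lin_hyp
  | |- @klin ?k ?X ?Y ?f => change (@klin k X Y (fun x => f x))
  | |- kbilin _ => split; intro
  | |- forall _, klin _ => intro
  | |- ktrilin _ => split; intros ? ?
  end.

Ltac lin := solve [repeat lin_step].
#[global] Hint Extern 0 (klin _) => lin : core.
#[global] Hint Extern 0 (kbilin _) => lin : core.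
#[global] Hint Extern 0 (ktrilin _) => lin : core.
#[global] Hint Extern 0 (is_yd _) => yd_side : core.
#[global] Hint Extern 0 (is_kalg _) => yd_side : core.

(* [inN tac] runs [tac] on the body of the Nth nested Sweedler sum of the left-hand
   side; [swapN] exchanges the nested sums N and N + 1, counted from 0. *)
Ltac at_depth n tac :=
  lazymatch n with
  | O => tac
  | S ?m => under eq_tsum => ? ? do at_depth m tac
  end.
Tactic Notation "in1" tactic3(tac) := at_depth 1%N ltac:(tac).
Tactic Notation "in2" tactic3(tac) := at_depth 2%N ltac:(tac).
Tactic Notation "in3" tactic3(tac) := at_depth 3%N ltac:(tac).
Tactic Notation "in4" tactic3(tac) := at_depth 4%N ltac:(tac).
Tactic Notation "in5" tactic3(tac) := at_depth 5%N ltac:(tac).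
Tactic Notation "in6" tactic3(tac) := at_depth 6%N ltac:(tac).
Tactic Notation "in7" tactic3(tac) := at_depth 7%N ltac:(tac).
Tactic Notation "in9" tactic3(tac) := at_depth 9%N ltac:(tac).
Tactic Notation "swap0" := at_depth 0%N ltac:(rewrite tsumC).
Tactic Notation "swap1" := at_depth 1%N ltac:(rewrite tsumC).
Tactic Notation "swap2" := at_depth 2%N ltac:(rewrite tsumC).
Tactic Notation "swap3" := at_depth 3%N ltac:(rewrite tsumC).
Tactic Notation "swap4" := at_depth 4%N ltac:(rewrite tsumC).
Tactic Notation "swap5" := at_depth 5%N ltac:(rewrite tsumC).
Tactic Notation "swap6" := at_depth 6%N ltac:(rewrite tsumC).
Tactic Notation "swap7" := at_depth 7%N ltac:(rewrite tsumC).
Tactic Notation "swap8" := at_depth 8%N ltac:(rewrite tsumC).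
Tactic Notation "swap9" := at_depth 9%N ltac:(rewrite tsumC).
Tactic Notation "rhs" tactic3(tac) := symmetry; tac; symmetry.

Ltac by_pure :=
  lazymatch goal with
  | |- forall t, @?f t = @?g t =>
    apply: (tensor_ext (f := f) (g := g)); [lin | lin | cbv beta]
  end.
#[global] Hint Extern 0 (is_ydalg _) => yd_side : core.
#[global] Hint Extern 0 (is_ydhopf _) => yd_side : core.

(** * Yetter-Drinfeld modules and the braiding *)

Section Coassociativity.
Variable k : fieldType.
Implicit Types X Y W Z : lmodType k.

(** The linear extension of a trilinear map to the triple tensor product, where coassociativity is
    stated. It turns coassociativity into a rule under any trilinear [F], the form that rewrites
    inside nested sums. *)
Definition ext3 X Y W Z (F : X -> Y -> W -> Z) (t : tensor X (tensor Y W)) : Z :=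
  tsum (fun x s => tsum (F x) s) t.

Lemma lin_ext3 X Y W Z (F : X -> Y -> W -> Z) : ktrilin F -> klin (ext3 F).
Proof. by move=> hF; apply: tsum_lin. Qed.

Lemma ext3E X Y W Z (F : X -> Y -> W -> Z) x y w :
  ktrilin F -> ext3 F (x ⊗ (y ⊗ w)) = F x y w.
Proof. by move=> hF; rewrite /ext3 !tsumE. Qed.

Lemma ext3_tsum X Y W Z (F : X -> Y -> W -> Z) (S1 S2 T1 T2 : lmodType k)
    (s : tensor S1 S2) (t : S1 -> S2 -> tensor T1 T2)
    (x : S1 -> S2 -> T1 -> T2 -> X) (y : S1 -> S2 -> T1 -> T2 -> Y)
    (w : S1 -> S2 -> T1 -> T2 -> W) :
  ktrilin F ->
  ext3 F (\tsum_(a, b <- s) \tsum_(c, d <- t a b) (x a b c d ⊗ (y a b c d ⊗ w a b c d))) =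
  \tsum_(a, b <- s) \tsum_(c, d <- t a b) F (x a b c d) (y a b c d) (w a b c d).
Proof.
move=> hF; have h := lin_ext3 hF.
rewrite lin_tsum //; apply: eq_tsum => a b; rewrite lin_tsum //.
by apply: eq_tsum => c d; rewrite ext3E.
Qed.

End Coassociativity.

Section SweedlerAxioms.
Variables (k : fieldType) (B : hopfAlg k).
Implicit Types (X : ydObj B) (Z : lmodType k).

Lemma hcopA3 Z (F : B -> B -> B -> Z) (a : B) : ktrilin F ->
  \tsum_(a1, a2 <- hcop B a) \tsum_(a11, a12 <- hcop B a1) F a11 a12 a2 =
  \tsum_(a1, a2 <- hcop B a) \tsum_(a21, a22 <- hcop B a2) F a1 a21 a22.
Proof. by move=> hF; have := congr1 (ext3 F) (hcopA a); rewrite !ext3_tsum. Qed.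

Lemma coactA3 X Z (F : B -> B -> X -> Z) (x : X) : is_yd X -> ktrilin F ->
  \tsum_(b, y <- yd_coact x) \tsum_(b1, b2 <- hcop B b) F b1 b2 y =
  \tsum_(b, y <- yd_coact x) \tsum_(c, z <- yd_coact y) F b c z.
Proof.
by move=> hX hF; have := congr1 (ext3 F) (yd_coactA hX x); rewrite !ext3_tsum.
Qed.

Lemma copA3 (K : ydHopf B) Z (F : K -> K -> K -> Z) (x : K) : is_ydhopf K -> ktrilin F ->
  \tsum_(x1, x2 <- yd_cop x) \tsum_(x11, x12 <- yd_cop x1) F x11 x12 x2 =
  \tsum_(x1, x2 <- yd_cop x) \tsum_(x21, x22 <- yd_cop x2) F x1 x21 x22.
Proof.
by move=> hK hF; have := congr1 (ext3 F) (ydhopf_copA hK x); rewrite !ext3_tsum.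
Qed.

Lemma comod_coA3 (R : ydAlg B) (K : ydHopf B) (psi : R -> tensor R K) Z
    (F : R -> K -> K -> Z) (r : R) : is_comodalg psi -> ktrilin F ->
  \tsum_(r0, v <- psi r) \tsum_(v1, v2 <- yd_cop v) F r0 v1 v2 =
  \tsum_(r0, v <- psi r) \tsum_(r00, w <- psi r0) F r00 w v.
Proof.
by move=> hp hF; have := congr1 (ext3 F) (comodalg_coA hp r); rewrite !ext3_tsum.
Qed.

Lemma hcoul_lin Z (K : B -> Z) (a : B) : klin K ->
  \tsum_(a1, a2 <- hcop B a) (hcou B a1 *: K a2) = K a.
Proof.
move=> hK; rewrite -[in RHS](hcoul a) lin_tsum //.
by apply: eq_tsum => a1 a2; rewrite linZ.
Qed.

Lemma hcour_lin Z (K : B -> Z) (a : B) : klin K ->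
  \tsum_(a1, a2 <- hcop B a) (hcou B a2 *: K a1) = K a.
Proof.
move=> hK; rewrite -[in RHS](hcour a) lin_tsum //.
by apply: eq_tsum => a1 a2; rewrite linZ.
Qed.

Lemma hantl_lin Z (K : B -> Z) (a : B) : klin K ->
  \tsum_(a1, a2 <- hcop B a) K (hant B a1 * a2) = hcou B a *: K 1.
Proof. by move=> hK; rewrite -linZ // -hantl lin_tsum. Qed.

Lemma hantr_lin Z (K : B -> Z) (a : B) : klin K ->
  \tsum_(a1, a2 <- hcop B a) K (a1 * hant B a2) = hcou B a *: K 1.
Proof. by move=> hK; rewrite -linZ // -hantr lin_tsum. Qed.

Lemma coact_cou_lin X Z (K : X -> Z) (x : X) : is_yd X -> klin K ->
  \tsum_(b, y <- yd_coact x) (hcou B b *: K y) = K x.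
Proof.
move=> hX hK; rewrite -[in RHS](yd_coact_cou hX x) lin_tsum //.
by apply: eq_tsum => b y; rewrite linZ.
Qed.

Lemma coul_lin (K : ydHopf B) Z (f : K -> Z) (x : K) : is_ydhopf K -> klin f ->
  \tsum_(x1, x2 <- yd_cop x) (yd_cou x1 *: f x2) = f x.
Proof.
move=> hK hf; rewrite -[in RHS](ydhopf_coul hK x) lin_tsum //.
by apply: eq_tsum => a1 a2; rewrite linZ.
Qed.

Lemma cour_lin (K : ydHopf B) Z (f : K -> Z) (x : K) : is_ydhopf K -> klin f ->
  \tsum_(x1, x2 <- yd_cop x) (yd_cou x2 *: f x1) = f x.
Proof.
move=> hK hf; rewrite -[in RHS](ydhopf_cour hK x) lin_tsum //.
by apply: eq_tsum => a1 a2; rewrite linZ.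
Qed.

Lemma antl_lin (K : ydHopf B) Z (f : K -> Z) (x : K) : is_ydhopf K -> klin f ->
  \tsum_(x1, x2 <- yd_cop x) f (yd_ant x1 ∗ x2) = yd_cou x *: f (yd_one K).
Proof. by move=> hK hf; rewrite -linZ // -(ydhopf_antl hK) lin_tsum. Qed.

Lemma antr_lin (K : ydHopf B) Z (f : K -> Z) (x : K) : is_ydhopf K -> klin f ->
  \tsum_(x1, x2 <- yd_cop x) f (x1 ∗ yd_ant x2) = yd_cou x *: f (yd_one K).
Proof. by move=> hK hf; rewrite -linZ // -(ydhopf_antr hK) lin_tsum. Qed.

End SweedlerAxioms.

Section Braid.
Variables (k : fieldType) (B : hopfAlg k).
Implicit Types (X Y W : ydObj B) (Z : lmodType k).

Lemma braid_pure X Y (x : X) (y : Y) : is_yd X -> is_yd Y ->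
  braid (x ⊗ y) = \tsum_(b, x0 <- yd_coact x) ((b ·> y) ⊗ x0).
Proof. by move=> hX hY; rewrite /braid tsumE. Qed.

Lemma braidE X Y Z (F : Y -> X -> Z) (x : X) (y : Y) : is_yd X -> is_yd Y -> kbilin F ->
  \tsum_(y', x' <- braid (x ⊗ y)) F y' x' = \tsum_(b, x0 <- yd_coact x) F (b ·> y) x0.
Proof.
move=> hX hY hF; rewrite braid_pure // tsum_tsum //.
by apply: eq_tsum => b x0; rewrite tsumE.
Qed.

Lemma coact_act X Z (F : B -> X -> Z) (b : B) (x : X) : is_yd X -> kbilin F ->
  tsum F (yd_coact (b ·> x)) =
  \tsum_(b', b3 <- hcop B b) \tsum_(b1, b2 <- hcop B b')
    \tsum_(c, y <- yd_coact x) F (b1 * c * hant B b3) (b2 ·> y).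
Proof.
move=> hX hF; rewrite yd_compat // tsum_tsum //; apply: eq_tsum => b' b3.
rewrite tsum_tsum //; apply: eq_tsum => b1 b2.
by rewrite tsum_tsum //; apply: eq_tsum => c y; rewrite tsumE.
Qed.

Lemma hcop_mul Z (F : B -> B -> Z) (a b : B) : kbilin F ->
  tsum F (hcop B (a * b)) =
  \tsum_(a1, a2 <- hcop B a) \tsum_(b1, b2 <- hcop B b) F (a1 * b1) (a2 * b2).
Proof.
move=> hF; rewrite hcopM tsum_tsum //; apply: eq_tsum => a1 a2.
by rewrite tsum_tsum //; apply: eq_tsum => b1 b2; rewrite tsumE.
Qed.

End Braid.

Section TensorObject.
Variables (k : fieldType) (B : hopfAlg k) (X Y : ydObj B).
Hypotheses (hX : is_yd X) (hY : is_yd Y).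

Lemma ydtens_actE (b : B) (x : X) (y : Y) :
  @yd_act k B (ydtens X Y) b (x ⊗ y) = \tsum_(b1, b2 <- hcop B b) ((b1 ·> x) ⊗ (b2 ·> y)).
Proof. by rewrite /yd_act /=; apply: eq_tsum => b1 b2; rewrite tsumE. Qed.

Lemma ydtens_coactE (x : X) (y : Y) :
  @yd_coact k B (ydtens X Y) (x ⊗ y) =
  \tsum_(b, x0 <- yd_coact x) \tsum_(c, y0 <- yd_coact y) ((b * c) ⊗ (x0 ⊗ y0)).
Proof. by rewrite /yd_coact /= tsumE. Qed.

Lemma ydtens_act_bilin : kbilin (@yd_act _ _ (ydtens X Y)).
Proof. by rewrite /yd_act /=. Qed.

Lemma ydtens_coact_lin : klin (@yd_coact _ _ (ydtens X Y)).
Proof. by rewrite /yd_coact /=. Qed.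

Lemma ydtens_coact_tsum (Z : lmodType k) (F : B -> tensor X Y -> Z) (x : X) (y : Y) :
  kbilin F ->
  tsum F (@yd_coact k B (ydtens X Y) (x ⊗ y)) =
  \tsum_(b, x0 <- yd_coact x) \tsum_(c, y0 <- yd_coact y) F (b * c) (x0 ⊗ y0).
Proof.
move=> hF; rewrite ydtens_coactE tsum_tsum //; apply: eq_tsum => b x0.
by rewrite tsum_tsum //; apply: eq_tsum => c y0; rewrite tsumE.
Qed.
End TensorObject.

Section TensorYD.
Variables (k : fieldType) (B : hopfAlg k) (X Y : ydObj B).
Hypotheses (hX : is_yd X) (hY : is_yd Y).

Let act_bilin := ydtens_act_bilin hX hY.
Let coact_lin := ydtens_coact_lin hX hY.

Lemma ydtens_compat (Z : lmodType k) (F : B -> tensor X Y -> Z) b x y : kbilin F ->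
  tsum F (yd_coact (@yd_act _ _ (ydtens X Y) b (x ⊗ y))) =
  \tsum_(b', b3 <- hcop B b) \tsum_(b1, b2 <- hcop B b')
    \tsum_(c, t <- @yd_coact _ _ (ydtens X Y) (x ⊗ y))
       F (b1 * c * hant B b3) (@yd_act _ _ (ydtens X Y) b2 t).
Proof.
have hC := coact_lin; have hA := act_bilin => hF.
rewrite ydtens_actE // (lin_tsum _ _ hC).
rewrite tsum_tsum //.
in1 rewrite ydtens_coact_tsum //.
in1 rewrite coact_act //.
in4 rewrite coact_act //.
rhs in2 rewrite ydtens_coact_tsum //.
rhs in4 rewrite ydtens_actE // (lin_tsum (f := F (_ * (_ * _) * hant B _))) //.
swap5; swap4; swap2; swap1; swap0; swap3; swap2; swap1.
rhs (swap1; swap0; swap2; swap1).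
apply: eq_tsum => c x0; apply: eq_tsum => d y0.
in3 rewrite hcopA3 //.
rewrite hcopA3 //; swap2; in1 rewrite -hcopA3 //; swap2; swap3.
(* The coaction of [b1 ·> x] ends in S of a leg of [b], and that of [b2 ·> y] begins with the next
   leg. Coassociativity has made the two legs adjacent, so they cancel. *)
have antE t u v z m : \tsum_(t1, t2 <- hcop B t)
    F (u * hant B t1 * (t2 * v * z)) m = hcou B t *: F (u * v * z) m.
  rewrite -{2}[v]mul1r -(hantl_lin (K := fun w => F (u * (w * v) * z) m)) //.
  by apply: eq_tsum => t1 t2; rewrite !mulrA.
in4 rewrite antE.
in3 rewrite -tsum_scale.
in2 rewrite -tsum_scale.
in1 rewrite hcoul_lin //.
symmetry; in1 rewrite -hcopA3 //.
rewrite hcopA3 //; swap1.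
apply: eq_tsum => p q; apply: eq_tsum => p1 p2; apply: eq_tsum => q1 q2.
by rewrite !mulrA.
Qed.

Lemma ydtens_yd : is_yd (ydtens X Y).
Proof.
have hA := act_bilin; have hC := coact_lin.
split.
- by apply/kbilinP; exact hA.
- by_pure => x y.
  by rewrite ydtens_actE // hcop1 tsumE // !yd_act1.
- move=> a b; by_pure => x y.
  rewrite !ydtens_actE // hcop_mul //.
  rewrite (lin_tsum (f := fun t : ydtens X Y => a ·> t)) //.
  rewrite tsumC; apply: eq_tsum => b1 b2; rewrite ydtens_actE //.
  by apply: eq_tsum => a1 a2; rewrite !yd_actM.
- exact: hC.
- by_pure => x y.
  rewrite !ydtens_coact_tsum //.
  in2 rewrite hcop_mul //.
  rhs in2 rewrite ydtens_coact_tsum //.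
  swap1.
  rewrite coactA3 //; apply: eq_tsum => b x0.
  rewrite [RHS]tsumC; apply: eq_tsum => c x1.
  by rewrite coactA3.
- by_pure => x y.
  rewrite ydtens_coact_tsum //.
  rewrite -[in RHS](yd_coact_cou hX x) (lin_tsum (f := fun x : X => x ⊗ y)) //.
  apply: eq_tsum => b x0.
  rewrite -[in RHS](yd_coact_cou hY y) (lin_tsum (f := fun y : Y => _ ⊗ y)) //.
  apply: eq_tsum => c y0.
  rewrite (linZ (f := fun x : X => x ⊗ _)) // (linZ (f := fun y : Y => x0 ⊗ y)) //.
  by rewrite hcouM scalerA.
- move=> b; by_pure => x y.
  have := ydtens_compat b x y (F := @ptens _ _ _).
  by rewrite tsum_ptens => ->.
Qed.

End TensorYD.
#[global] Hint Resolve ydtens_yd : yd.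

Section Naturality.
Variables (k : fieldType) (B : hopfAlg k).
Implicit Types (X Y P Q : ydObj B) (Z : lmodType k).

Lemma braid_natl X X' Y Z (f : X -> X') (F : Y -> X' -> Z) (x : X) (y : Y) :
  is_yd X -> is_yd X' -> is_yd Y -> is_ydmorph f -> kbilin F ->
  tsum F (braid (f x ⊗ y)) = \tsum_(y', x' <- braid (x ⊗ y)) F y' (f x').
Proof.
move=> hX hX' hY hf hF; rewrite !braidE // (ydmorph_coact hf) tsum_tsum //.
by apply: eq_tsum => b x0; rewrite tsumE.
Qed.

Lemma braid_natr X Y Y' Z (f : Y -> Y') (F : Y' -> X -> Z) (x : X) (y : Y) :
  is_yd X -> is_yd Y -> is_yd Y' -> is_ydmorph f -> kbilin F ->
  tsum F (braid (x ⊗ f y)) = \tsum_(y', x' <- braid (x ⊗ y)) F (f y') x'.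
Proof.
move=> hX hY hY' hf hF; rewrite !braidE //.
by apply: eq_tsum => b x0; rewrite (ydmorph_act hf).
Qed.

(** One of the two hexagon identities: a strand passes a tensor product by passing its factors in
    turn. *)
Lemma braid_tensl P Q Y Z (F : Y -> ydtens P Q -> Z) (p : P) (q : Q) (y : Y) :
  is_yd P -> is_yd Q -> is_yd Y -> kbilin F ->
  tsum F (@braid _ _ (ydtens P Q) Y ((p ⊗ q) ⊗ y)) =
  \tsum_(y1, q' <- braid (q ⊗ y)) \tsum_(y2, p' <- braid (p ⊗ y1)) F y2 (p' ⊗ q').
Proof.
move=> hP hQ hY hF; rewrite !braidE // ydtens_coact_tsum // tsumC.
apply: eq_tsum => c q0; rewrite !braidE //.
by apply: eq_tsum => b p0; rewrite yd_actM.
Qed.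

Lemma braid_tensr X P Q Z (F : ydtens P Q -> X -> Z) (x : X) (p : P) (q : Q) :
  is_yd X -> is_yd P -> is_yd Q -> kbilin F ->
  tsum F (@braid _ _ X (ydtens P Q) (x ⊗ (p ⊗ q))) =
  \tsum_(p', x1 <- braid (x ⊗ p)) \tsum_(q', x2 <- braid (x1 ⊗ q)) F (p' ⊗ q') x2.
Proof.
move=> hX hP hQ hF; rewrite !braidE //.
in1 rewrite ydtens_actE // (lin_tsum (f := fun t => F t _)) //.
rewrite (coactA3 (F := fun b1 b2 y => F ((b1 ·> p) ⊗ (b2 ·> q)) y)) //.
by apply: eq_tsum => b x0; rewrite braidE.
Qed.

(** Naturality along a morphism into a tensor product, followed by the hexagon. Comultiplications
    and comodule structures move through crossings this way. *)
Lemma braid_splitl X P Q Y Z (f : X -> tensor P Q) (F : Y -> P -> Q -> Z)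
    (x : X) (y : Y) :
  is_yd X -> is_yd P -> is_yd Q -> is_yd Y -> @is_ydmorph _ _ X (ydtens P Q) f ->
  ktrilin F ->
  \tsum_(y', x' <- braid (x ⊗ y)) \tsum_(p, q <- f x') F y' p q =
  \tsum_(p, q <- f x) \tsum_(y1, q' <- braid (q ⊗ y))
    \tsum_(y2, p' <- braid (p ⊗ y1)) F y2 p' q'.
Proof.
move=> hX hP hQ hY hf hF.
rewrite -(braid_natl (F := fun y' (t : ydtens P Q) => tsum (F y') t) _ _ hX _ _ hf) //.
rewrite -{1}[f x]tsum_ptens.
rewrite (lin_tsum (f := fun t : ydtens P Q =>
  tsum (fun y' (t : ydtens P Q) => tsum (F y') t) (braid (t ⊗ y)))) //.
apply: eq_tsum => p q; rewrite braid_tensl //.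
by in2 rewrite tsumE //.
Qed.

Lemma braid_splitr X P Q Y Z (f : Y -> tensor P Q) (F : P -> Q -> X -> Z)
    (x : X) (y : Y) :
  is_yd X -> is_yd P -> is_yd Q -> is_yd Y -> @is_ydmorph _ _ Y (ydtens P Q) f ->
  ktrilin F ->
  \tsum_(y', x' <- braid (x ⊗ y)) \tsum_(p, q <- f y') F p q x' =
  \tsum_(p, q <- f y) \tsum_(p', x1 <- braid (x ⊗ p))
    \tsum_(q', x2 <- braid (x1 ⊗ q)) F p' q' x2.
Proof.
move=> hX hP hQ hY hf hF.
rewrite -(braid_natr (F := fun (t : ydtens P Q) x' => tsum (fun p q => F p q x') t)
  _ _ hX hY _ hf) //.
rewrite -{1}[f y]tsum_ptens.
rewrite (lin_tsum (f := fun t : ydtens P Q =>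
  tsum (fun (t : ydtens P Q) x' => tsum (fun p q => F p q x') t) (braid (x ⊗ t)))) //.
apply: eq_tsum => p q; rewrite braid_tensr //.
by in2 rewrite tsumE //.
Qed.

Lemma braid_joinl P Q X Y Z (f : P -> Q -> X) (F : Y -> X -> Z) (p : P) (q : Q) (y : Y) :
  is_yd X -> is_yd P -> is_yd Q -> is_yd Y -> kbilin f ->
  @is_ydmorph _ _ (ydtens P Q) X (tsum f) -> kbilin F ->
  tsum F (braid (f p q ⊗ y)) =
  \tsum_(y1, q' <- braid (q ⊗ y)) \tsum_(y2, p' <- braid (p ⊗ y1)) F y2 (f p' q').
Proof.
move=> hX hP hQ hY hfl hf hF; rewrite -(tsumE p q hfl).
rewrite (@braid_natl (ydtens P Q)) // braid_tensl //.
by in2 rewrite tsumE //.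
Qed.

Lemma braid_joinr P Q X Y Z (f : P -> Q -> Y) (F : Y -> X -> Z) (p : P) (q : Q) (x : X) :
  is_yd X -> is_yd P -> is_yd Q -> is_yd Y -> kbilin f ->
  @is_ydmorph _ _ (ydtens P Q) Y (tsum f) -> kbilin F ->
  tsum F (braid (x ⊗ f p q)) =
  \tsum_(p', x1 <- braid (x ⊗ p)) \tsum_(q', x2 <- braid (x1 ⊗ q)) F (f p' q') x2.
Proof.
move=> hX hP hQ hY hfl hf hF; rewrite -(tsumE p q hfl).
rewrite (@braid_natr X (ydtens P Q)) // braid_tensr //.
by in2 rewrite tsumE //.
Qed.

Lemma ydunit_yd : is_yd (ydunit B).
Proof.
split.
- split=> [c|b] a x y.
    by rewrite /yd_act /= linearP mulrDl -mulrA.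
  by rewrite /yd_act /= mulrDr; congr (_ + _); rewrite mulrCA.
- by move=> x; rewrite /yd_act /= hcou1 mul1r.
- by move=> a b x; rewrite /yd_act /= hcouM mulrA.
- by move=> a x y; rewrite /yd_coact /= lin_ptensr.
- move=> x; rewrite /yd_coact /= !tsumE // hcop1 ?tsumE //.
- by move=> x; rewrite /yd_coact /= tsumE // hcou1 scale1r.
- move=> b x; rewrite /yd_coact /yd_act /=.
  in2 rewrite tsumE //.
  have hZ (c : k) (u : B) :
    @ptens k B (ydunit B) u (c * x) = c *: @ptens k B (ydunit B) u x.
    exact: (linZ (lin_ptensr (X := B) (Y := ydunit B) u)).
  in2 rewrite mulr1 hZ.
  in1 rewrite (hcour_lin (K := fun b1 => b1 * hant B _ ⊗ (x : ydunit B))) //.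
  by rewrite (hantr_lin (K := fun b1 => b1 ⊗ (x : ydunit B))) // hZ.
Qed.
Hint Resolve ydunit_yd : yd.

Section ScalarMorphism.
Variables (X Y : ydObj B) (Z : lmodType k).

(** Naturality moves the crossing past [q], and crossing the unit object is trivial. *)
Lemma braid_scall (q : X -> k) (G : Y -> Z) (x : X) (y : Y) :
  @is_ydmorph _ _ X (ydunit B) q -> klin G -> is_yd X -> is_yd Y ->
  \tsum_(y', x' <- braid (x ⊗ y)) (q x' *: G y') = q x *: G y.
Proof.
move=> hq hG hX hY.
rewrite -(braid_natl (f := q) (X' := ydunit B) (F := fun y' (c : k^o) => (c : k) *: G y')) //.
rewrite braidE // /yd_coact /= tsumE // yd_act1 //.
Qed.

Lemma braid_scalr (q : Y -> k) (G : X -> Z) (x : X) (y : Y) :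
  @is_ydmorph _ _ Y (ydunit B) q -> klin G -> is_yd X -> is_yd Y ->
  \tsum_(y', x' <- braid (x ⊗ y)) (q y' *: G x') = q y *: G x.
Proof.
move=> hq hG hX hY; rewrite braidE //.
under eq_tsum => b x0 do rewrite (ydmorph_act hq) /yd_act /= mulrC -scalerA.
by rewrite -tsum_scale coact_cou_lin.
Qed.

End ScalarMorphism.

Section Pairing.
Variables (P Q W : ydObj B) (Z : lmodType k) (e : P -> Q -> k) (G : W -> Z).
Hypotheses (hP : is_yd P) (hQ : is_yd Q) (hW : is_yd W).
Hypotheses (he : kbilin (e : P -> Q -> k^o)).
Hypothesis hm : @is_ydmorph _ _ (ydtens P Q) (ydunit B) (tsum e).
Hypothesis hG : klin G.

(** The two legs are closed off by a morphism to the unit object, so a strand crossing both of them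
    slides off. *)
Lemma braid_pairl p q w :
  \tsum_(w1, q' <- braid (q ⊗ w)) \tsum_(w2, p' <- braid (p ⊗ w1)) (e p' q' *: G w2) =
  e p q *: G w.
Proof.
have hE p' q' : e p' q' = tsum e (p' ⊗ q') by rewrite (tsumE (Z := k^o)).
in2 rewrite hE.
rewrite -(braid_tensl (F := fun w (t : ydtens P Q) => (tsum e t) *: G w)) //.
by rewrite (braid_scall (X := ydtens P Q)) // hE.
Qed.

Lemma braid_pairr p q w :
  \tsum_(p', w1 <- braid (w ⊗ p)) \tsum_(q', w2 <- braid (w1 ⊗ q)) (e p' q' *: G w2) =
  e p q *: G w.
Proof.
have hE p' q' : e p' q' = tsum e (p' ⊗ q') by rewrite (tsumE (Z := k^o)).
in2 rewrite hE.
rewrite -(braid_tensr (F := fun (t : ydtens P Q) w => (tsum e t) *: G w)) //.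
by rewrite (braid_scalr (Y := ydtens P Q)) // hE.
Qed.

End Pairing.
End Naturality.
#[global] Hint Resolve ydunit_yd : yd.

Section Crossings.
Variables (k : fieldType) (B : hopfAlg k).
Implicit Types (X Y W : ydObj B) (A : ydAlg B) (K : ydHopf B) (Z : lmodType k).

Lemma braid_mull A Y Z (F : Y -> A -> Z) (a a' : A) (y : Y) :
  is_ydalg A -> is_yd Y -> kbilin F ->
  tsum F (braid ((a ∗ a') ⊗ y)) =
  \tsum_(y1, c' <- braid (a' ⊗ y)) \tsum_(y2, c <- braid (a ⊗ y1)) F y2 (c ∗ c').
Proof. by move=> hA hY hF; apply: braid_joinl (ydalg_mul hA) _. Qed.

Lemma braid_mulr A X Z (F : A -> X -> Z) (a a' : A) (x : X) :
  is_ydalg A -> is_yd X -> kbilin F ->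
  tsum F (braid (x ⊗ (a ∗ a'))) =
  \tsum_(c, x1 <- braid (x ⊗ a)) \tsum_(c', x2 <- braid (x1 ⊗ a')) F (c ∗ c') x2.
Proof. by move=> hA hX hF; apply: braid_joinr (ydalg_mul hA) _. Qed.

Lemma braid_onel A Y Z (F : Y -> A -> Z) (y : Y) : is_ydalg A -> is_yd Y -> kbilin F ->
  tsum F (braid (yd_one A ⊗ y)) = F y (yd_one A).
Proof.
move=> hA hY hF; rewrite -[in LHS](scale1r (yd_one A)).
rewrite (braid_natl (X := ydunit B) (1 : k) y _ _ _ (ydalg_one hA)) //.
by rewrite braidE // /yd_coact /= tsumE // yd_act1 // scale1r.
Qed.

Lemma braid_oner A X Z (F : A -> X -> Z) (x : X) : is_ydalg A -> is_yd X -> kbilin F ->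
  tsum F (braid (x ⊗ yd_one A)) = F (yd_one A) x.
Proof.
move=> hA hX hF; rewrite -[in LHS](scale1r (yd_one A)).
rewrite (braid_natr (Y := ydunit B) x (1 : k) _ _ _ (ydalg_one hA)) //.
rewrite braidE // /yd_act /=.
under eq_tsum => b x0 do rewrite mulr1 (linZ (f := fun a => F a _)) //.
by rewrite coact_cou_lin.
Qed.

Lemma braid_copl K Y Z (F : Y -> K -> K -> Z) (x : K) (y : Y) :
  is_ydhopf K -> is_yd Y -> ktrilin F ->
  \tsum_(y', x' <- braid (x ⊗ y)) \tsum_(x1, x2 <- yd_cop x') F y' x1 x2 =
  \tsum_(x1, x2 <- yd_cop x) \tsum_(y1, x2' <- braid (x2 ⊗ y))
    \tsum_(y2, x1' <- braid (x1 ⊗ y1)) F y2 x1' x2'.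
Proof. by move=> hK hY hF; apply: braid_splitl (ydhopf_cop hK) _. Qed.

Lemma braid_copr K X Z (F : K -> K -> X -> Z) (x : X) (y : K) :
  is_ydhopf K -> is_yd X -> ktrilin F ->
  \tsum_(y', x' <- braid (x ⊗ y)) \tsum_(y1, y2 <- yd_cop y') F y1 y2 x' =
  \tsum_(y1, y2 <- yd_cop y) \tsum_(y1', x1 <- braid (x ⊗ y1))
    \tsum_(y2', x2 <- braid (x1 ⊗ y2)) F y1' y2' x2.
Proof. by move=> hK hX hF; apply: braid_splitr (ydhopf_cop hK) _. Qed.

(** In the coaction of [b1 ·> x] the Yetter-Drinfeld condition produces S of a leg of [b] next to
    the leg acting on [y]; the antipode axiom removes both. *)
Lemma braid_act X Y (b : B) (t : ydtens X Y) : is_yd X -> is_yd Y ->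
  braid (@yd_act _ _ (ydtens X Y) b t) = @yd_act _ _ (ydtens Y X) b (braid t).
Proof.
move=> hX hY; move: b t => b; by_pure => x y.
rewrite ydtens_actE // lin_tsum //.
in1 rewrite braid_pure // coact_act //.
rewrite braid_pure // (lin_tsum (f := fun t : ydtens Y X => b ·> t)) //.
rhs in1 rewrite ydtens_actE //.
swap2; swap1; swap0; apply: eq_tsum => c x0.
have actE b1 b2 b3 b4 : (b1 * c * hant B b2 ·> (b3 ·> y)) ⊗ (b4 ·> x0) =
  (b1 * c * (hant B b2 * b3) ·> y) ⊗ (b4 ·> x0) by rewrite -yd_actM // mulrA.
in3 rewrite actE.
rewrite hcopA3 //; swap1.
in2 rewrite (hantl_lin (K := fun h => (_ * c * h ·> y) ⊗ (_ ·> x0))) // mulr1.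
in1 rewrite -tsum_scale.
rewrite hcour_lin //; apply: eq_tsum => b1 b2.
by rewrite yd_actM.
Qed.

Lemma braid_ydmorph X Y : is_yd X -> is_yd Y ->
  @is_ydmorph _ _ (ydtens X Y) (ydtens Y X) (@braid _ _ X Y).
Proof.
move=> hX hY; split.
- by have : klin (@braid _ _ X Y).
- by move=> b t; exact: braid_act.
suff h (Z : lmodType k) (F : B -> ydtens Y X -> Z) x y : kbilin F ->
    tsum F (@yd_coact _ _ (ydtens Y X) (braid (x ⊗ y))) =
    tsum (fun b t => F b (braid t)) (@yd_coact _ _ (ydtens X Y) (x ⊗ y)).
  by_pure => x y; rewrite -h ?tsum_ptens //; split; lin.
move=> hF.
rewrite braid_pure // (lin_tsum (f := @yd_coact _ _ (ydtens Y X))) // tsum_tsum //.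
in1 rewrite ydtens_coact_tsum //.
rewrite ydtens_coact_tsum //.
in1 rewrite coact_act //.
rhs in2 rewrite braid_pure // (lin_tsum (f := F _)) //.
swap3; swap2; swap1; rewrite -coactA3 //.
in1 rewrite hcopA3 //.
swap2; swap3.
in5 rewrite -mulrA.
in4 rewrite (hantl_lin (K := fun h => F (_ * _ * h) (_ ⊗ _))) // mulr1.
in3 rewrite -tsum_scale.
in2 rewrite -tsum_scale.
in1 rewrite hcour_lin //.
rhs swap1.
by rewrite -coactA3 // ; apply: eq_tsum => b x0; rewrite tsumC.
Qed.

(** Naturality of the crossing of [x] along the morphism C_{Y,W}, with the hexagon on either
    side. *)
Lemma braid_YB X Y W Z (F : W -> Y -> X -> Z) (x : X) (y : Y) (w : W) :
  is_yd X -> is_yd Y -> is_yd W -> ktrilin F ->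
  \tsum_(y1, x1 <- braid (x ⊗ y)) \tsum_(w1, x2 <- braid (x1 ⊗ w))
    \tsum_(w2, y2 <- braid (y1 ⊗ w1)) F w2 y2 x2 =
  \tsum_(w1, y1 <- braid (y ⊗ w)) \tsum_(w2, x1 <- braid (x ⊗ w1))
    \tsum_(y2, x2 <- braid (x1 ⊗ y1)) F w2 y2 x2.
Proof.
move=> hX hY hW hF.
pose G (t : ydtens W Y) (x' : X) := \tsum_(w', y' <- t) F w' y' x'.
have hG : kbilin G by rewrite /G.
have hb := braid_ydmorph hY hW.
transitivity (tsum G (@braid _ _ X (ydtens W Y) (x ⊗ braid (y ⊗ w)))).
  rewrite (@braid_natr _ _ X (ydtens Y W) (ydtens W Y) Z (@braid _ _ Y W) G x (y ⊗ w)) // braid_tensr //.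
rewrite -[X in _ ⊗ X]tsum_ptens.
rewrite (lin_tsum (f := fun t : ydtens W Y => tsum G (braid (x ⊗ t)))) //.
apply: eq_tsum => w1 y1; rewrite braid_tensr //.
by in2 rewrite /G tsumE //.
Qed.

End Crossings.

(** * The antipode of B *)

(** The powers f^0, ..., f^N with N = dim End V are linearly dependent. If m is the least index with
    nonzero coefficient, division by that coefficient gives f^m = f^(m+1) g with g a polynomial in
    f. *)
Lemma fitting_quasi_inverse (k : fieldType) (V : vectType k) (f : 'End(V)) :
  exists m (g : V -> V), [/\ klin g, forall x, g (f x) = f (g x)
    & forall x, iter m f x = iter m.+1 f (g x)].
Proof.
have hf : klin f by move=> a x y; rewrite linearP.
have it_lin n : klin (iter n f).
  by elim: n => //= n IHn a x y; rewrite !iterS (IHn a x y) linearP.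
have itsum n I (r : seq I) (P : pred I) (F : I -> V) :
    iter n f (\sum_(i <- r | P i) F i) = \sum_(i <- r | P i) iter n f (F i).
  by elim: n => //= n ->; rewrite linear_sum.
pose N := \dim (fullv : {vspace 'End(V)}).
pose X := [tuple of mkseq (fun i => iter i (comp_lfun f) \1%VF) N.+1].
have itE i x : iter i (comp_lfun f) \1%VF x = iter i f x.
  by elim: i => [|i IHi] /=; rewrite ?id_lfunE // comp_lfunE IHi.
have /negP nfree : ~~ free X.
  apply/negP => /eqP; rewrite size_tuple => h.
  by have := dimvS (subvf <<X>>%VS); rewrite leqNgt /= h /N ltnSn.
have [c [i0 ci0] csum] : exists2 c : 'I_N.+1 -> k, exists i, c i != 0 &
    \sum_i c i *: X`_i = 0.
  apply: contrapT => hno; apply: nfree; apply/freeP => c hc i.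
  apply: contrapT => /eqP ci; apply: hno; exists c => //; by exists i.
have csumE x : \sum_(i < N.+1) c i *: iter i f x = 0.
  have /(congr1 (fun h : 'End(V) => h x)) := csum.
  rewrite sum_lfunE zero_lfunE => h; rewrite -[RHS]h; apply: eq_bigr => i _.
  by rewrite nth_mkseq // scale_lfunE itE.
pose P i := [exists j : 'I_N.+1, (j == i :> nat) && (c j != 0)].
have exP : exists i, P i by exists i0; apply/existsP; exists i0; rewrite eqxx.
have [_ /existsP[m /andP[/eqP<- cm]] mmin] := ex_minnP exP.
have clt (i : 'I_N.+1) : (i < m)%N -> c i = 0.
  apply: contraTeq => ci; rewrite -leqNgt; apply: mmin; apply/existsP.
  by exists i; rewrite eqxx.
pose h x := \sum_(i < N.+1 | (m < i)%N) c i *: iter (i - m.+1) f x.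
have hC x : h (f x) = f (h x).
  rewrite /h linear_sum; apply: eq_bigr => i _.
  by rewrite linearZ -iterS -iterSr.
pose g x := - (c m)^-1 *: h x.
exists m, g; split.
- move=> a x y; rewrite /g /h scalerA mulrC -scalerA -scalerDr; congr (_ *: _).
  rewrite scaler_sumr -big_split; apply: eq_bigr => i _ /=.
  by rewrite (it_lin _ a x y) scalerDr !scalerA mulrC.
- by move=> x; rewrite /g hC linearZ.
- move=> x; rewrite /g /h (linZ (it_lin _)) itsum.
  have := csumE x; rewrite (bigID (fun i : 'I_N.+1 => (m < i)%N)) /=.
  rewrite [X in _ + X](bigD1 m) ?ltnn //= [X in _ + (_ + X)]big1 => [|i]; last first.
    rewrite -leqNgt => /andP[im /negP nim]; rewrite clt ?scale0r // ltn_neqAle im andbT.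
    by apply/negP => /eqP/val_inj/eqP.
  rewrite addr0 => /eqP; rewrite addr_eq0 => /eqP sumE.
  transitivity (- (c m)^-1 *: - (c m *: iter m f x)).
    by rewrite scaleNr scalerN opprK scalerA mulVf // scale1r.
  rewrite -sumE; congr (_ *: _); apply: eq_bigr => i mi.
  by rewrite -iterS (linZ (it_lin m.+1)) -iterD subnKC.
Qed.

Section Antipode.
Variables (k : fieldType) (B : hopfAlg k).
Notation S := (hant B).
Implicit Type Z : lmodType k.

Lemma hant1 : S 1 = 1.
Proof.
have := hantl (1 : B); rewrite hcop1 tsumE //.
by rewrite mulr1 hcou1 scale1r.
Qed.

(** Uniqueness of convolution inverses: both sides, as functions of [a] and [b], invert the
    multiplication. [E] is the triple convolution product, bracketed in the two possible ways. *)
Lemma hantM a b : S (a * b) = S b * S a.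
Proof.
pose E := \tsum_(a1, s <- hcop B a) \tsum_(b1, r <- hcop B b)
  \tsum_(a2, a3 <- hcop B s) \tsum_(b2, b3 <- hcop B r)
    (S (a1 * b1) * (a2 * b2) * (S b3 * S a3)).
transitivity E.
  rewrite /E.
  under eq_tsum => a1 s do under eq_tsum => b1 r do under eq_tsum => a2 a3 do
    under eq_tsum => b2 b3 do rewrite -!mulrA (mulrA b2).
  in3 rewrite (hantr_lin (K := fun h => _ * (_ * (h * _)))) //.
  in3 rewrite mul1r.
  in2 rewrite -tsum_scale.
  in2 rewrite (hantr_lin (K := fun h => _ * h)) // mulr1.
  in1 rewrite hcour_lin //.
  by rewrite (hcour_lin (K := fun h => S (h * b))).
rewrite /E; swap1; rewrite -hcopA3 //.
in2 rewrite -hcopA3 //.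
swap1.
in2 rewrite -(hcop_mul (F := fun u v => S u * v * (S _ * S _))) //.
in2 rewrite (hantl_lin (K := fun h => h * (S _ * S _))) // mul1r hcouM -scalerA.
in1 rewrite -tsum_scale.
in1 rewrite (hcoul_lin (K := fun h => S h * _)) //.
by rewrite (hcoul_lin (K := fun h => _ * S h)).
Qed.

(** The same argument in Hom(B, B ⊗ B): both sides are convolution inverses of the
    comultiplication. *)
Lemma hcop_hant Z (F : B -> B -> Z) a : kbilin F ->
  tsum F (hcop B (S a)) = \tsum_(a1, a2 <- hcop B a) F (S a2) (S a1).
Proof.
move=> hF.
pose E := \tsum_(a1, s <- hcop B a) \tsum_(u, v <- hcop B (S a1))
  \tsum_(x, y <- hcop B s) \tsum_(x1, x2 <- hcop B x) \tsum_(y1, y2 <- hcop B y)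
    F (u * x1 * S y2) (v * x2 * S y1).
transitivity E.
  symmetry; rewrite /E.
  in2 rewrite hcopA3 //.
  in3 rewrite -hcopA3 //.
  in5 rewrite -[X in F _ X]mulrA.
  in4 rewrite (hantr_lin (K := fun h => F _ (_ * h))) // mulr1.
  in3 rewrite (hcoul_lin (K := fun h => F (_ * _ * S h) _)) //.
  in3 rewrite -mulrA.
  in2 rewrite (hantr_lin (K := fun h => F (_ * h) _)) // mulr1.
  in1 rewrite -tsum_scale.
  by rewrite (hcour_lin (K := fun h => tsum F (hcop B (S h)))).
rewrite /E; swap1; rewrite -hcopA3 //; swap3; swap2.
in3 rewrite -(hcop_mul (F := fun p q => F (p * S _) (q * S _))) //.
swap1.
in2 rewrite (hantl_lin (K := fun h => tsum (fun p q => F (p * S _) (q * S _)) (hcop B h))) //.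
in2 rewrite hcop1 tsumE // !mul1r.
in1 rewrite -tsum_scale.
by rewrite (hcoul_lin (K := fun h => \tsum_(y1, y2 <- hcop B h) F (S y2) (S y1))).
Qed.

Lemma iter_hantM n a b : exists x, iter n S a * iter n S b = iter n S x.
Proof.
elim: n a b => [|n IHn] a b; first by exists (a * b).
have [x hx] := IHn b a; exists x; by rewrite !iterS -hantM hx.
Qed.

(** The image of S^n is a subcoalgebra because S reverses the comultiplication; an identity in the
    two legs need only be checked on that image. *)
Lemma hcop_iter_eq0 n Z (G : B -> B -> Z) a : kbilin G ->
  (forall x y, G (iter n S x) (iter n S y) = 0) -> tsum G (hcop B (iter n S a)) = 0.
Proof.
elim: n Z G => [|n IHn] Z G hG hG0; first by apply: big1 => p _; exact: hG0.
rewrite iterS hcop_hant //.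
by apply: (IHn _ (fun x y => G (S y) (S x))) => // x y; rewrite -!iterS.
Qed.

(** Starting from S^m = S^(m+1) Q, the exponent is lowered to 0. On the subcoalgebra im S^m the map
    T = Q S satisfies T * S = 1 under convolution, while S * id = 1. Hence T = id there, which is
    the relation for the smaller exponent. *)
Lemma hant_bij : exists2 Q : B -> B, klin Q & cancel S Q /\ cancel Q S.
Proof.
have hS : klin S by [].
have [m [Q [hQ QS hm]]] : exists m (g : B -> B), [/\ klin g,
    forall x, g (S x) = S (g x) & forall x, iter m S x = iter m.+1 S (g x)].
  have [m [Q [hQ QS hm]]] := fitting_quasi_inverse (linfun S).
  have itE n x : iter n (linfun S) x = iter n S x.
    by elim: n => //= n ->; rewrite lfunE.
  exists m, Q; split=> // x; first by have := QS x; rewrite !lfunE.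
  by have := hm x; rewrite !itE.
suff h : forall b, b = S (Q b).
  by exists Q => //; split=> b; rewrite ?QS -h.
elim: m hm => [|m IHm] hm; first exact: hm.
apply: IHm => b.
have it_lin n : klin (iter n S) by elim: n => //= n IHn; exact: (lin_comp hS).
have Qit n x : Q (iter n S x) = iter n S (Q x) by elim: n => //= n IHn; rewrite QS IHn.
have QSK x : Q (S (iter m.+1 S x)) = iter m.+1 S x.
  by rewrite -iterS Qit -hm.
have it1 n : iter n S 1 = 1 by elim: n => //= n ->; exact: hant1.
have Q1 : Q 1 = 1 by rewrite -{1}hant1 -(it1 m.+1) QSK.
pose T c := Q (S c).
have hT : klin T by rewrite /T.
have ST x : S (T (iter m S x)) = S (iter m S x).
  by rewrite /T -QS -iterS -iterS !iterS -[S (iter m S x)]iterS QSK.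
have conv x : \tsum_(c1, c2 <- hcop B (iter m S x)) (T c1 * S c2) =
    hcou B (iter m S x) *: 1.
  (* The products [T u * S v] lie in the image of S^(m+1), where Q S is already known to be the
     identity. It therefore suffices to compute the sum after applying S, where [ST] replaces T by
     the identity. *)
  have fixQ : \tsum_(c1, c2 <- hcop B (iter m S x)) (T c1 * S c2) =
      Q (S (\tsum_(c1, c2 <- hcop B (iter m S x)) (T c1 * S c2))).
    apply/eqP; rewrite -subr_eq0 (lin_tsum (f := fun h => Q (S h))) // /tsum -sumrB.
    apply/eqP; apply: (hcop_iter_eq0 (G := fun u v => T u * S v - Q (S (T u * S v)))) => //.
    move=> u v; rewrite {1 2}/T -iterS Qit; have [w ->] := iter_hantM m.+1 (Q u) v.
    by rewrite QSK subrr.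
  rewrite fixQ (lin_tsum (f := S)) //.
  under eq_tsum => c1 c2 do rewrite hantM.
  transitivity (Q (\tsum_(c1, c2 <- hcop B (iter m S x)) S (c1 * S c2))).
    congr Q; apply/eqP; rewrite -subr_eq0 /tsum -sumrB; apply/eqP.
    apply: (hcop_iter_eq0 (G := fun u v => S (S v) * S (T u) - S (u * S v))) => //.
    by move=> u v; rewrite hantM ST subrr.
  by rewrite (hantr_lin (K := S)) // linZ // hant1 Q1.
transitivity (T (iter m S b)); last by rewrite /T -Qit.
set c := iter m S b.
(* This is T * S * id, bracketed to give the identity on one side and T on the other. *)
transitivity (\tsum_(u, v <- hcop B c) ((\tsum_(c1, c2 <- hcop B u) (T c1 * S c2)) * v)).
  rewrite -[LHS]hcoul.
  apply/eqP; rewrite eq_sym -subr_eq0 /tsum -sumrB; apply/eqP.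
  apply: (hcop_iter_eq0 (G := fun u v =>
    (\tsum_(c1, c2 <- hcop B u) (T c1 * S c2)) * v - hcou B u *: v)) => //.
  by move=> u v; rewrite conv -scalerAl mul1r subrr.
under eq_tsum => u v do rewrite (lin_tsum (f := fun h => h * v)) //.
rewrite hcopA3 //.
in2 rewrite -mulrA.
in1 rewrite (hantl_lin (K := fun h => T _ * h)) // mulr1.
by rewrite hcour_lin.
Qed.

Lemma hantVK : cancel (@hantV k B) S.
Proof.
move=> b; rewrite /hantV; have [Q hQ [_ QK]] := hant_bij.
have := @limg_lfunVK k B B (linfun S) b.
rewrite lfunE /= => -> //; rewrite -(QK b) -[S _](lfunE S); exact: memv_img (memvf _).
Qed.

Lemma hantKV : cancel S (@hantV k B).
Proof.
have [Q hQ [SQ QK]] := hant_bij => b.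
by rewrite -[LHS]SQ hantVK SQ.
Qed.

Lemma hantVM a b : hantV (a * b) = hantV b * hantV a :> B.
Proof. by rewrite -[RHS]hantKV hantM !hantVK. Qed.

Lemma hantV1 : hantV (1 : B) = 1.
Proof. by rewrite -{1}hant1 hantKV. Qed.

Lemma hantVl_lin Z (K : B -> Z) (a : B) : klin K ->
  \tsum_(a1, a2 <- hcop B a) K (hantV a2 * a1) = hcou B a *: K 1.
Proof.
move=> hK; rewrite -hantV1 -(hantl_lin (K := fun h => K (hantV h))) //.
by apply: eq_tsum => a1 a2; rewrite hantVM hantKV.
Qed.

Lemma hantVr_lin Z (K : B -> Z) (a : B) : klin K ->
  \tsum_(a1, a2 <- hcop B a) K (a2 * hantV a1) = hcou B a *: K 1.
Proof.
move=> hK; rewrite -hantV1 -(hantr_lin (K := fun h => K (hantV h))) //.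
by apply: eq_tsum => a1 a2; rewrite hantVM hantKV.
Qed.

End Antipode.

(** * Symmetric braidings *)

Section Separation.
Variables (k : fieldType) (X Y : lmodType k) (I : Type) (phi : I -> Y -> k).
Hypothesis hphi : forall i, klin (phi i : Y -> k^o).
Hypothesis sep : forall y, (forall i, phi i y = 0) -> y = 0.

(** Elimination on the length of the formal sum: if phi_i y is nonzero for the leading pair (x, y),
    the equation at i expresses x through the other first entries. Substituting it shortens the sum
    and changes only second entries. *)
Lemma seq_separated (s : seq (X * Y)) :
  (forall i, \sum_(p <- s) phi i p.2 *: p.1 = 0) -> \sum_(p <- s) p.1 ⊗ p.2 = 0.
Proof.
have [n] := ubnP (size s); elim: n s => // n IHn [|[x y] s] /= hs h.
  by rewrite big_nil.
have lin0 (T S : lmodType k) (f : T -> S) : klin f -> f 0 = 0.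
  by move=> /(_ (-1) 0 0); rewrite scaler0 addr0 scaleN1r addNr.
have linN (T S : lmodType k) (f : T -> S) z : klin f -> f (- z) = - f z.
  by move=> hf; rewrite -scaleN1r linZ // scaleN1r.
have linB (T S : lmodType k) (f : T -> S) z u : klin f -> f (z - u) = f z - f u.
  by move=> hf; rewrite -linN // -[f z]scale1r -hf scale1r.
have phi0 i : phi i 0 = 0 by exact: (lin0 _ _ _ (hphi i)).
have [y0 | /existsNP[i /eqP ci]] := pselect (forall i, phi i y = 0).
  rewrite big_cons (sep y0) /= (lin0 _ _ _ (lin_ptensr x)) add0r; apply: IHn => // i.
  by have := h i; rewrite big_cons /= y0 scale0r add0r.
pose s' := [seq (p.1, p.2 - (phi i p.2 / phi i y) *: y) | p <- s].
have hx : x = - \sum_(p <- s) (phi i p.2 / phi i y) *: p.1.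
  have /eqP := h i; rewrite big_cons addr_eq0 => /eqP /= hx.
  rewrite -[LHS](scalerK ci) hx scalerN scaler_sumr; congr (- _).
  by apply: eq_bigr => p _; rewrite scalerA mulrC.
have s'0 : \sum_(p <- s') p.1 ⊗ p.2 = 0.
  apply: IHn => [|j]; first by rewrite size_map.
  rewrite big_map /=.
  under eq_bigr => p _ do rewrite (linB _ _ _ _ _ (hphi j)) (linZ (hphi j)) scalerBl.
  rewrite sumrB.
  transitivity (\sum_(p <- s) phi j p.2 *: p.1 + phi j y *: x).
    congr (_ + _); rewrite hx scalerN scaler_sumr; congr (- _).
    by apply: eq_bigr => p _; rewrite scalerA [in RHS]mulrC.
  by have := h j; rewrite big_cons addrC.
rewrite big_cons -[RHS]s'0 big_map /=.
under [RHS]eq_bigr => p _ do rewrite (linB _ _ _ _ _ (lin_ptensr _)).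
rewrite sumrB addrC; congr (_ + _).
rewrite [in LHS]hx (linN _ _ _ _ (lin_ptensl y)) (lin_sum _ _ (lin_ptensl y)); congr (- _).
by apply: eq_bigr => p _; rewrite (linZ (lin_ptensr _)) (linZ (lin_ptensl _)).
Qed.

Lemma tensor_separated (t : tensor X Y) :
  (forall i, \tsum_(x, y <- t) (phi i y *: x) = 0) -> t = 0.
Proof. by rewrite -[t in t = 0]tsum_ptens => h; exact: seq_separated. Qed.

Lemma tensor_separated_eq (t t' : tensor X Y) :
  (forall i, \tsum_(x, y <- t) (phi i y *: x) = \tsum_(x, y <- t') (phi i y *: x)) ->
  t = t'.
Proof.
move=> h; apply/eqP; rewrite -subr_eq0; apply/eqP/tensor_separated => i.
have hl : klin (tsum (fun x y => phi i y *: x)).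
  by have hi := hphi i.
by rewrite addrC -scaleN1r hl -h scaleN1r addNr.
Qed.

End Separation.

Section Symmetry.
Variables (k : fieldType) (B : hopfAlg k).
Implicit Types (X Y W : ydObj B) (Z : lmodType k).

(** The inverse crossing acts by S^-1 of the coaction. *)
Lemma braid_inj X Y : is_yd X -> is_yd Y -> injective (@braid _ _ X Y).
Proof.
move=> hX hY.
pose unbraid (t : tensor Y X) : tensor X Y :=
  \tsum_(y, x <- t) \tsum_(b, x0 <- yd_coact x) (x0 ⊗ (hantV b ·> y)).
have un_lin : klin unbraid by rewrite /unbraid.
suff unbraidK t : unbraid (braid t) = t by apply: can_inj unbraidK.
move: t; by_pure => x y.
rewrite braid_pure // lin_tsum //.
under eq_tsum => b x0 do rewrite /unbraid tsumE //.
rewrite -coactA3 //.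
in2 rewrite -yd_actM //.
in1 rewrite (hantVl_lin (K := fun h => _ ⊗ (h ·> y))) //.
rewrite (coact_cou_lin (K := fun x => x ⊗ (1 ·> y))) //.
by rewrite yd_act1.
Qed.

Definition bsym X Y := forall t : tensor X Y, braid (braid t) = t.

Lemma bsymC X Y : is_yd X -> is_yd Y -> bsym X Y -> bsym Y X.
Proof. by move=> hX hY h t; apply: braid_inj => //; exact: h. Qed.

Lemma bsymE X Y Z (F : X -> Y -> Z) x y : is_yd X -> is_yd Y -> bsym X Y -> kbilin F ->
  \tsum_(y', x' <- braid (x ⊗ y)) tsum F (braid (y' ⊗ x')) = F x y.
Proof.
move=> hX hY h hF; rewrite -[RHS](tsumE x y hF) -[x ⊗ y in RHS]h.
by rewrite -[braid (x ⊗ y) in RHS]tsum_ptens (lin_tsum (f := fun t => tsum F (braid t))).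
Qed.

Section DualObject.
Variables (P Q W : ydObj B) (e : P -> Q -> k).
Hypotheses (hP : is_yd P) (hQ : is_yd Q) (hW : is_yd W).
Hypotheses (he : kbilin (e : P -> Q -> k^o)).
Hypothesis hm : @is_ydmorph _ _ (ydtens P Q) (ydunit B) (tsum e).
Hypothesis sep : forall p, (forall q, e p q = 0) -> p = 0.

(** The strand [w] is made to cross both legs of the pairing. By symmetry of [W] and [Q] its
    crossing with [q] cancels the given one, and only the crossing with [p] remains. *)
Lemma braid_pair_dual (p : P) (q : Q) (w : W) : bsym W Q ->
  \tsum_(w', p' <- braid (p ⊗ w)) (e p' q *: w') =
  \tsum_(q', w' <- braid (w ⊗ q)) (e p q' *: w').
Proof.
move=> hWQ; symmetry.
in1 rewrite -(braid_pairl (G := fun w => w) hP hQ hW he hm) //.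
by rewrite (bsymE (F := fun (w : W) (q : Q) => \tsum_(w', p' <- braid (p ⊗ w)) (e p' q *: w'))).
Qed.

(** Pairing with [q] trades the second crossing of [w] with [p] for a crossing with [q]. Then [w]
    has crossed both legs of the pairing and slides off; separation finishes the argument. *)
Lemma bsym_dual : bsym W Q -> bsym W P.
Proof.
move=> hWQ; apply: (tensor_ext (f := fun t => braid (braid t)) (g := id)) => // w p.
have he1 q : klin (fun p => e p q : k^o) by [].
apply: (tensor_separated_eq he1) => [p' hp'|q]; first exact: sep.
rewrite -[braid (w ⊗ p)]tsum_ptens.
rewrite (lin_tsum (f := fun t => \tsum_(w', p' <- braid t) (e p' q *: w'))) //.
in1 rewrite braid_pair_dual //.
by rewrite (braid_pairr (G := fun w => w)) // tsumE.
Qed.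

End DualObject.

(** The functionals [e p] pulled back along [j] separate the points of [W ⊗ X], and by naturality
    both crossings can be evaluated on the side of [X']. *)
Lemma bsym_sub (P : lmodType k) X X' W (j : X -> X') (e : P -> X' -> k) :
  is_yd X -> is_yd X' -> is_yd W -> is_ydmorph j -> kbilin (e : P -> X' -> k^o) ->
  (forall x, (forall p, e p (j x) = 0) -> x = 0) -> bsym W X' -> bsym W X.
Proof.
move=> hX hX' hW hj he sep hWX.
apply: (tensor_ext (f := fun t => braid (braid t)) (g := id)) => // w x.
have he1 p : klin (fun x => e p (j x) : k^o) by [].
apply: (tensor_separated_eq he1) => [x' hx'|p]; first exact: sep.
rewrite -[braid (w ⊗ x)]tsum_ptens.
rewrite (lin_tsum (f := fun t => \tsum_(w', p' <- braid t) (e p (j p') *: w'))) //.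
in1 rewrite -(braid_natl (f := j) (F := fun (w : W) (x' : X') => e p x' *: w)) //.
rewrite -(braid_natr (f := j) (F := fun (x' : X') (w : W) =>
  \tsum_(w', x'' <- braid (x' ⊗ w)) (e p x'' *: w'))) //.
by rewrite (bsymE (F := fun (w : W) (x' : X') => e p x' *: w)) // tsumE.
Qed.

End Symmetry.

(** * Braided Hopf algebras *)

Section BraidedAntipode.
Variables (k : fieldType) (B : hopfAlg k) (K : ydHopf B).
Hypotheses (hK : is_ydhopf K) (hs : bsym K K).
Implicit Type Z : lmodType k.
Notation S := (@yd_ant _ _ K).
Notation "'1K'" := (yd_one K).

Let hA : is_ydalg K := ydhopf_alg hK.
Let hKm : is_kalg K := ydhopf_kalg hK.
Let hKy : is_yd K := ydalg_yd hA.

Lemma cop_mul Z (F : K -> K -> Z) (x y : K) : kbilin F ->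
  tsum F (yd_cop (x ∗ y)) =
  \tsum_(x1, x2 <- yd_cop x) \tsum_(y1, y2 <- yd_cop y)
    \tsum_(y1', x2' <- braid (x2 ⊗ y1)) F (x1 ∗ y1') (x2' ∗ y2).
Proof.
move=> hF; rewrite (algmorphM (ydhopf_copM hK)) /yd_mul /=.
rewrite tsum_tsum //; apply: eq_tsum => x1 x2.
rewrite tsum_tsum //; apply: eq_tsum => y1 y2.
rewrite tsum_tsum //; apply: eq_tsum => y1' x2'.
by rewrite tsumE.
Qed.

Lemma cou_mul (x y : K) : yd_cou (x ∗ y) = yd_cou x * yd_cou y.
Proof. exact: (algmorphM (ydhopf_couM hK)). Qed.

Lemma cou_one : yd_cou 1K = 1.
Proof. exact: (algmorph1 (ydhopf_couM hK)). Qed.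

Lemma cop_one : yd_cop 1K = 1K ⊗ 1K.
Proof. exact: (algmorph1 (ydhopf_copM hK)). Qed.

Lemma ant_one : S 1K = 1K.
Proof.
have := ydhopf_antl hK 1K; rewrite cop_one tsumE //.
by rewrite kalg_mul1r // cou_one scale1r.
Qed.

(** As for [hantM], both sides invert the multiplication under convolution, now on K ⊗ K with its
    braided comultiplication. [N] is the right-hand side and [MN] says that it is a right
    inverse. *)
Lemma ant_mul (x y : K) : S (x ∗ y) = \tsum_(y', x' <- braid (x ⊗ y)) (S y' ∗ S x').
Proof.
have hSm := ydhopf_ant hK.
pose N (x y : K) : K := \tsum_(y', x' <- braid (x ⊗ y)) (S y' ∗ S x').
have hN : kbilin N by rewrite /N.
have MN (s r : K) : \tsum_(s1, s2 <- yd_cop s) \tsum_(r1, r2 <- yd_cop r)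
    \tsum_(r1', s2' <- braid (s2 ⊗ r1)) ((s1 ∗ r1') ∗ N s2' r2) =
    (yd_cou s * yd_cou r) *: 1K.
  under eq_tsum => s1 s2 do under eq_tsum => r1 r2 do under eq_tsum => r1' s2' do
    rewrite -(kalg_mulA hKm) /N lin_tsum // lin_tsum //.
  in4 rewrite [X in _ ∗ X]kalg_mulA //.
  in3 rewrite -(braid_natr (f := S) (F := fun q z => _ ∗ ((_ ∗ q) ∗ S z))) //.
  in2 rewrite -(braid_mulr (F := fun q z => _ ∗ (q ∗ S z))) //.
  in1 rewrite (antr_lin (f := fun h => tsum (fun q z => _ ∗ (q ∗ S z)) (braid (_ ⊗ h)))) //.
  in1 rewrite braid_oner // kalg_mul1l //.
  by rewrite -tsum_scale (ydhopf_antr hK) scalerA mulrC.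
pose E := \tsum_(x1, s <- yd_cop x) \tsum_(y1, r <- yd_cop y)
  \tsum_(y1', s' <- braid (s ⊗ y1)) \tsum_(s1, s2 <- yd_cop s')
  \tsum_(r1, r2 <- yd_cop r) \tsum_(r1', s2' <- braid (s2 ⊗ r1))
  (S (x1 ∗ y1') ∗ ((s1 ∗ r1') ∗ N s2' r2)).
transitivity E.
  symmetry; rewrite /E.
  in5 rewrite -(lin_tsum (f := fun z => S _ ∗ z)) //.
  in4 rewrite -(lin_tsum (f := fun z => S _ ∗ z)) //.
  in3 rewrite -(lin_tsum (f := fun z => S _ ∗ z)) //.
  in3 rewrite MN (linZ (f := fun z => S _ ∗ z)) // kalg_mul1r // -scalerA.
  have hc := ydhopf_cou hK.
  in2 rewrite (braid_scall (q := @yd_cou _ _ K) (G := fun a => _ *: S (_ ∗ a))) //.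
  in1 rewrite -tsum_scale.
  in1 rewrite (cour_lin (f := fun a => S (_ ∗ a))) //.
  by rewrite (cour_lin (f := fun a => S (a ∗ y))).
rewrite /E.
in2 rewrite braid_copl //.
swap1; swap4; swap3.
rewrite -copA3 //.
in2 rewrite -copA3 //.
swap5.
in3 rewrite -braid_copr //.
swap1; swap2.
in6 rewrite kalg_mulA //.
in3 rewrite -(cop_mul (F := fun p q => (S p ∗ q) ∗ N _ _)) //.
in3 rewrite (antl_lin (f := fun z => z ∗ N _ _)) // kalg_mul1l // cou_mul -scalerA.
in2 rewrite -tsum_scale.
have hc := ydhopf_cou hK.
in2 rewrite (braid_scalr (q := @yd_cou _ _ K) (G := fun z => N z _)) //.
in1 rewrite -tsum_scale.
in1 rewrite (coul_lin (f := fun z => N _ z)) //.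
by rewrite (coul_lin (f := fun z => N z y)).
Qed.

Variable T : K -> K.
Hypotheses (TK : cancel T S) (KT : cancel S T).

Lemma antV_lin : klin T.
Proof.
have hS : klin S by [].
by move=> a x y; rewrite -[RHS]KT hS !TK.
Qed.

Lemma antV_ydmorph : @is_ydmorph _ _ K K T.
Proof.
have hS := ydhopf_ant hK; have hT := antV_lin.
split.
- exact: antV_lin.
- by move=> b x; rewrite -[RHS]KT (ydmorph_act hS) TK.
- move=> x; rewrite -[in RHS](TK x) (ydmorph_coact hS).
  rewrite tsum_tsum //.
  under eq_tsum => b y do rewrite tsumE // KT.
  by rewrite tsum_ptens.
Qed.

Lemma antV_one : T 1K = 1K.
Proof. by rewrite -{1}ant_one KT. Qed.

(** Apply S to both sides: [ant_mul] introduces a second crossing, which cancels the first by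
    symmetry and leaves [x1 ∗ S x2]. *)
Lemma antV_mulr x :
  \tsum_(x1, x2 <- yd_cop x) \tsum_(x2', x1' <- braid (x1 ⊗ x2)) (x2' ∗ T x1') =
  yd_cou x *: 1K.
Proof.
have hT := antV_lin; have hTm := antV_ydmorph; have hS : klin S by [].
rewrite -[LHS]KT (lin_tsum _ _ hS).
in1 rewrite (lin_tsum _ _ hS).
in2 rewrite ant_mul.
in2 rewrite (braid_natr (f := T) (F := fun y' x' => S y' ∗ S x')) //.
in3 rewrite TK.
in1 rewrite (bsymE (F := fun y x => y ∗ S x)) //.
by rewrite (ydhopf_antr hK) (linZ hT) antV_one.
Qed.

Lemma antV_mull x :
  \tsum_(x1, x2 <- yd_cop x) \tsum_(x2', x1' <- braid (x1 ⊗ x2)) (T x2' ∗ x1') =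
  yd_cou x *: 1K.
Proof.
have hT := antV_lin; have hTm := antV_ydmorph; have hS : klin S by [].
rewrite -[LHS]KT (lin_tsum _ _ hS).
in1 rewrite (lin_tsum _ _ hS).
in2 rewrite ant_mul.
in2 rewrite (braid_natl (f := T) (F := fun y' x' => S y' ∗ S x')) //.
in3 rewrite TK.
in1 rewrite (bsymE (F := fun y x => S y ∗ x)) //.
by rewrite (ydhopf_antl hK) (linZ hT) antV_one.
Qed.

End BraidedAntipode.

(** * Hopf pairings *)

Section FlipPairing.
Variables (k : fieldType) (B : hopfAlg k) (U V : ydHopf B) (e : U -> V -> k^o).
Hypotheses (hU : is_ydhopf U) (hV : is_ydhopf V) (hUV : bsym U V) (hVU : bsym V U).
Hypotheses (he : kbilin e) (hem : @is_ydmorph _ _ (ydtens U V) (ydunit B) (tsum e)).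
Hypothesis e_mulr : forall (u : U) (v w : V), e u (v ∗ w) =
  \tsum_(u1, u2 <- yd_cop u) \tsum_(v', u2' <- braid (u2 ⊗ v)) (e u1 v' *: e u2' w).
Hypothesis e_mull : forall (u w : U) (v : V), e (u ∗ w) v =
  \tsum_(v1, v2 <- yd_cop v) \tsum_(v1', w' <- braid (w ⊗ v1)) (e u v1' *: e w' v2).
Hypothesis e_oner : forall u, e u (yd_one V) = yd_cou u.
Hypothesis e_onel : forall v, e (yd_one U) v = yd_cou v.

Definition fpair (v : V) (u : U) : k^o := \tsum_(u', v' <- braid (v ⊗ u)) e u' v'.
Notation pr := fpair.

Lemma fpair_bilin : kbilin pr.
Proof. by rewrite /fpair. Qed.

Lemma fpair_braid u v : tsum pr (braid (u ⊗ v)) = e u v.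
Proof. exact: (bsymE (F := e)). Qed.

Lemma fpair_morph : @is_ydmorph _ _ (ydtens V U) (ydunit B) (tsum pr).
Proof.
have hb := fpair_bilin.
have -> : tsum pr = (fun t => tsum e (@braid _ _ V U t)).
  by apply/funext => t; move: t; by_pure => v u; rewrite tsumE.
have hm : is_ydmorph _ := @braid_ydmorph _ _ V U ltac:(yd_side) ltac:(yd_side).
split.
- by have hl : klin (fun t : tensor V U => tsum e (braid t)) by [].
- by move=> b t; rewrite (ydmorph_act hm) // (ydmorph_act hem).
- move=> t; rewrite (ydmorph_coact hem) (ydmorph_coact hm) // tsum_tsum //.
  by apply: eq_tsum => b y; rewrite tsumE.
Qed.

(** The crossing in the definition of [fpair] meets the one in [e_mulr], and symmetry cancels them.
    So [pr] obeys the same kind of rule as [e] with the roles of [U] and [V] exchanged. *)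
Lemma fpair_mull f g x : pr (f ∗ g) x =
  \tsum_(x1, x2 <- yd_cop x) \tsum_(x1', g' <- braid (g ⊗ x1)) (pr f x1' *: pr g' x2).
Proof.
have hb := fpair_bilin.
rewrite /fpair braid_mull //.
in2 rewrite e_mulr.
in1 rewrite braid_copr //.
in3 rewrite (bsymE (F := fun v u => e _ v *: e u _)) //.
rewrite braid_copr //.
swap2; apply: eq_tsum => x1 x2; apply: eq_tsum => x1' g'.
rewrite -/(pr _ _) tsumC.
rewrite /fpair (lin_tsum (f := fun a : k^o => (a : k) *: _)) // tsumC.
by apply: eq_tsum => a b; rewrite tsum_scale.
Qed.

Lemma fpair_mulr f x y : pr f (x ∗ y) =
  \tsum_(f1, f2 <- yd_cop f) \tsum_(x', f2' <- braid (f2 ⊗ x)) (pr f1 x' *: pr f2' y).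
Proof.
rewrite /fpair braid_mulr //.
in2 rewrite e_mull.
in1 rewrite braid_copl //.
in3 rewrite (bsymE (F := fun v u => e _ v *: e u _)) //.
rewrite braid_copl //.
apply: eq_tsum => f1 f2; apply: eq_tsum => x' f2'.
rewrite (lin_tsum (f := fun a : k^o => (a : k) *: _)) //.
by apply: eq_tsum => a b; rewrite tsum_scale.
Qed.

Lemma fpair_onel x : pr (yd_one V) x = yd_cou x.
Proof. by rewrite /fpair braid_onel. Qed.

Lemma fpair_oner f : pr f (yd_one U) = yd_cou f.
Proof. by rewrite /fpair braid_oner. Qed.

Lemma fpair_act b v u : \tsum_(b1, b2 <- hcop B b) pr (b1 ·> v) (b2 ·> u) =
  hcou B b *: pr v u.
Proof.
have hb := fpair_bilin; have := ydmorph_act fpair_morph b (v ⊗ u).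
rewrite ydtens_actE // tsum_tsum // tsumE // => h; rewrite -[RHS]h.
by apply: eq_tsum => b1 b2; rewrite tsumE.
Qed.

Lemma fpair_actl b v u : pr (b ·> v) u = pr v (hant B b ·> u).
Proof.
have hb := fpair_bilin.
transitivity (\tsum_(b1, b2 <- hcop B b) \tsum_(b3, b4 <- hcop B b2)
   pr (b1 ·> v) (b3 * hant B b4 ·> u)).
  in1 rewrite (hantr_lin (K := fun h => pr _ (h ·> u))) // yd_act1 //.
  by rewrite (hcour_lin (K := fun h => pr (h ·> v) u)).
rewrite -(hcopA3 (F := fun b1 b3 b4 => pr (b1 ·> v) (b3 * hant B b4 ·> u))) //.
in2 rewrite yd_actM //.
in1 rewrite fpair_act.
by rewrite (hcoul_lin (K := fun h => pr v (hant B h ·> u))).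
Qed.

(** By symmetry [e u v] is a sum of terms [pr (b ·> v) u0], and invariance of the pairing moves the
    action onto [u0]. *)
Lemma fpair_sep : (forall v, (forall u, e u v = 0) -> v = 0) ->
  forall v, (forall u, pr v u = 0) -> v = 0.
Proof.
have hb := fpair_bilin => sep v h; apply: sep => u.
rewrite -fpair_braid braidE //.
rewrite (eq_tsum (G := fun _ _ => 0)) => [|b u0]; first exact: big1.
by rewrite -/(pr _ _) fpair_actl h.
Qed.

End FlipPairing.

(** The multiplicativity fields carry a vector [z] so that they rewrite scalar coefficients inside
    nested Sweedler sums. *)
Record hopf_pairing (k : fieldType) (B : hopfAlg k) (U V : ydHopf B) (pr : V -> U -> k) :
    Prop := HopfPairing {
  pairing_bilin : kbilin (pr : V -> U -> k^o);
  pairing_morph : @is_ydmorph _ _ (ydtens V U) (ydunit B) (tsum pr);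
  pairing_mull : forall (Z : lmodType k) (z : Z) f g x, pr (f ∗ g) x *: z =
    \tsum_(x1, x2 <- yd_cop x) \tsum_(x1', g' <- braid (g ⊗ x1))
      (pr f x1' *: (pr g' x2 *: z));
  pairing_mulr : forall (Z : lmodType k) (z : Z) f x y, pr f (x ∗ y) *: z =
    \tsum_(f1, f2 <- yd_cop f) \tsum_(x', f2' <- braid (f2 ⊗ x))
      (pr f1 x' *: (pr f2' y *: z));
  pairing_onel : forall x, pr (yd_one V) x = yd_cou x;
  pairing_oner : forall f, pr f (yd_one U) = yd_cou f
}.

Section Harpoon.
Variables (k : fieldType) (B : hopfAlg k) (U V : ydHopf B) (pr : V -> U -> k).
Hypotheses (hU : is_ydhopf U) (hV : is_ydhopf V) (hpr : hopf_pairing pr).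
Let hp := pairing_bilin hpr.
Let hpm := pairing_morph hpr.
Let pr_mull := pairing_mull hpr.
Let pr_mulr := pairing_mulr hpr.
Let pr_onel := pairing_onel hpr.
Notation "f ⇀ x" := (harpoon pr f x) (at level 38, right associativity).

Let hUy : is_yd U := ydalg_yd (ydhopf_alg hU).
Let hVy : is_yd V := ydalg_yd (ydhopf_alg hV).

Lemma harp_bilin : kbilin (harpoon pr).
Proof. by rewrite /harpoon. Qed.

Lemma harp_onel u : yd_one V ⇀ u = u.
Proof.
rewrite /harpoon.
in1 rewrite braid_onel // pr_onel.
by rewrite (cour_lin (f := fun u => u)).
Qed.

Lemma harpE (Z : lmodType k) (G : U -> Z) f x : klin G ->
  G (f ⇀ x) =
  \tsum_(x1, x2 <- yd_cop x) \tsum_(x1', f' <- braid (f ⊗ x1)) (pr f' x2 *: G x1').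
Proof.
move=> hG; rewrite /harpoon lin_tsum //.
in1 rewrite lin_tsum //.
by in2 rewrite (linZ hG).
Qed.

(** The pairing consumes the last leg of [x], so by coassociativity the harpoon stays on the second
    factor. *)
Lemma cop_harp (Z : lmodType k) (F : U -> U -> Z) f x : kbilin F ->
  tsum F (yd_cop (f ⇀ x)) =
  \tsum_(x1, x2 <- yd_cop x) \tsum_(x1', f' <- braid (f ⊗ x1)) F x1' (f' ⇀ x2).
Proof.
move=> hF; rewrite (harpE (G := fun t => tsum F (yd_cop t))) //.
in2 rewrite tsum_scale.
in1 rewrite (braid_copr (F := fun a b g => pr g _ *: F a b)) //.
rewrite copA3 //; swap1.
apply: eq_tsum => x1 x2; apply: eq_tsum => x1' f'.
by rewrite (harpE (G := F _)).
Qed.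

Lemma pr_harp (Z : lmodType k) (z : Z) f g x : pr f (g ⇀ x) *: z =
  \tsum_(x1, x2 <- yd_cop x) \tsum_(x1', g' <- braid (g ⊗ x1))
    (pr g' x2 *: (pr f x1' *: z)).
Proof. by rewrite (harpE (G := fun u => pr f u *: z)). Qed.

Lemma harp_mull f g x : (f ∗ g) ⇀ x = f ⇀ (g ⇀ x).
Proof.
have hh := harp_bilin.
rewrite [RHS]/harpoon cop_harp //.
rewrite [LHS]/harpoon.
in1 rewrite (braid_mull (F := fun u v => pr v _ *: u)) //.
in3 rewrite pr_mull.
rhs in3 rewrite pr_harp.
apply: eq_tsum => x1 x2; apply: eq_tsum => x1' g'; apply: eq_tsum => y2 f'.
apply: eq_tsum => a b; apply: eq_tsum => a' g''.
by rewrite !scalerA mulrC.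
Qed.

Section Crossing.
Variables (W : ydObj B) (Z : lmodType k).
Hypothesis hW : is_yd W.

(** The Yang-Baxter equation makes [w] cross the two legs of the pairing inside the harpoon one
    after the other, and there it slides off. *)
Lemma braid_harpr (F : U -> W -> Z) w f x : kbilin F ->
  tsum F (braid (w ⊗ (f ⇀ x))) =
  \tsum_(f', w1 <- braid (w ⊗ f)) \tsum_(x', w2 <- braid (w1 ⊗ x)) F (f' ⇀ x') w2.
Proof.
move=> hF; have hh := harp_bilin.
rewrite (harpE (G := fun t => tsum F (braid (w ⊗ t)))) //.
rhs in2 rewrite (harpE (G := fun t => F t _)) //.
rhs in1 rewrite (braid_copr (F := fun a b w => \tsum_(a', f' <- braid (_ ⊗ a)) (pr f' b *: F a' w))) //.
rhs rewrite tsumC.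
rhs swap3.
apply: eq_tsum => x1 x2; symmetry.
rewrite braid_YB //.
in2 rewrite (braid_pairr (G := F _) hVy hUy hW hp hpm) //.
by in1 rewrite -tsum_scale.
Qed.

Lemma braid_harpl (F : W -> U -> Z) w f x : kbilin F ->
  tsum F (braid ((f ⇀ x) ⊗ w)) =
  \tsum_(w1, x' <- braid (x ⊗ w)) \tsum_(w2, f' <- braid (f ⊗ w1)) F w2 (f' ⇀ x').
Proof.
move=> hF; have hh := harp_bilin.
rewrite (harpE (G := fun t => tsum F (braid (t ⊗ w)))) //.
rhs in2 rewrite (harpE (G := F _)) //.
rhs swap1.
rewrite [RHS](braid_copl (F := fun w1 a b => \tsum_(w2, f' <- braid (f ⊗ w1))
  \tsum_(a', f'' <- braid (f' ⊗ a)) (pr f'' b *: F w2 a'))) //.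
apply: eq_tsum => x1 x2; symmetry.
in1 rewrite -(braid_YB (F := fun w x f => pr f _ *: F w x)) //.
rewrite tsumC.
in3 rewrite -tsum_scale.
by in1 rewrite (braid_pairl (G := fun w => tsum F (braid (_ ⊗ w))) hVy hUy hW hp hpm) //.
Qed.

End Crossing.

Lemma harp_mulr f x y : f ⇀ (x ∗ y) =
  \tsum_(f1, f2 <- yd_cop f) \tsum_(x', f2' <- braid (f2 ⊗ x)) ((f1 ⇀ x') ∗ (f2' ⇀ y)).
Proof.
have hh := harp_bilin.
(* The form to which both sides reduce: all comultiplications come first, then the crossings, then
   the two pairings. *)
pose T (f1 f2 : V) (x1 x2 y1 y2 : U) : U := \tsum_(x1a, q1 <- braid (f2 ⊗ x1))
  \tsum_(x1', p1 <- braid (f1 ⊗ x1a)) \tsum_(x2a, q2 <- braid (q1 ⊗ x2))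
  \tsum_(y1a, q3 <- braid (q2 ⊗ y1)) (pr p1 x2a *: (pr q3 y2 *: (x1' ∗ y1a))).
transitivity (\tsum_(f1, f2 <- yd_cop f) \tsum_(x1, x2 <- yd_cop x)
  \tsum_(y1, y2 <- yd_cop y) T f1 f2 x1 x2 y1 y2).
  rewrite /harpoon cop_mul //.
  in3 rewrite braid_mulr //.
  in5 rewrite pr_mulr.
  in4 rewrite (braid_copl (F := fun b p q => \tsum_(x2', f2' <- braid (q ⊗ _))
    (pr p x2' *: (pr f2' _ *: (_ ∗ b))))) //.
  in3 rewrite braid_copl //.
  swap2; swap1; swap0; swap3; swap4; swap7.
  in5 rewrite -(braid_YB (F := fun b1 x2' q3 => \tsum_(b', p2 <- braid (_ ⊗ b1))
    (pr p2 x2' *: (pr q3 _ *: (_ ∗ b'))))) //.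
  by in7 rewrite (braid_pairl (G := fun b' => pr _ _ *: (_ ∗ b')) hVy hUy hUy hp hpm) //.
rhs in2 rewrite (harpE (G := fun t => t ∗ _)) //.
rhs in4 rewrite (harpE (G := fun t => pr _ _ *: (_ ∗ t))) //.
rhs in1 rewrite (braid_copr (F := fun x1 x2 f2' => \tsum_(x1', f1' <- braid (_ ⊗ x1))
  \tsum_(y1, y2 <- yd_cop y) \tsum_(y1', f2'' <- braid (f2' ⊗ y1))
    (pr f2'' y2 *: (pr f1' x2 *: (x1' ∗ y1'))))) //.
rhs (swap4; swap3; swap2; swap4).
apply: eq_tsum => f1 f2; apply: eq_tsum => x1 x2; apply: eq_tsum => y1 y2.
rewrite /T; in4 rewrite scalerA mulrC.
by rhs in4 rewrite scalerA.
Qed.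

End Harpoon.

(** * Detection of morphisms by crossings *)

Section TestObjects.
Variables (k : fieldType) (B : hopfAlg k).
Notation S := (hant B).

Definition adj_act_obj : ydObj B :=
  @YDObj k B B (fun b w => \tsum_(b1, b2 <- hcop B b) (b1 * w * S b2)) (hcop B).

Definition adj_coact_obj : ydObj B :=
  @YDObj k B B (fun b w => b * w)
    (fun w => \tsum_(w', w3 <- hcop B w) \tsum_(w1, w2 <- hcop B w') ((w1 * S w3) ⊗ w2)).

Lemma hcou_hant a : hcou B (S a) = hcou B a.
Proof.
have hc : klin (hcou B : B -> k^o) by [].
have hc1 : hcou B (hcou B a *: 1) = hcou B a.
  by rewrite (linZ hc) hcou1; exact: mulr1.
rewrite -[RHS]hc1 -hantr (lin_tsum _ _ hc).
rewrite -[in LHS](hcoul a) (lin_tsum (f := fun h => hcou B (S h) : k^o)) //.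
apply: eq_tsum => a1 a2; rewrite hcouM.
by rewrite (linZ (f := fun h => hcou B (S h) : k^o)).
Qed.

Lemma adj_act_yd : is_yd adj_act_obj.
Proof.
have hA : kbilin (fun b w : B => \tsum_(b1, b2 <- hcop B b) (b1 * w * S b2)) by [].
split.
- by apply/kbilinP; exact: hA.
- by move=> w; rewrite /yd_act /= hcop1 tsumE // hant1 mulr1 mul1r.
- move=> a b w; rewrite /yd_act /= hcop_mul //.
  apply: eq_tsum => a1 a2; rewrite (lin_tsum (f := fun h => a1 * h * S a2)) //.
  by apply: eq_tsum => b1 b2; rewrite hantM !mulrA.
- by have : klin (hcop B).
- by move=> w; exact: hcopA.
- by move=> w; exact: hcoul.
suff h (Z : lmodType k) (F : B -> B -> Z) b w : kbilin F ->
    tsum F (hcop B (\tsum_(b1, b2 <- hcop B b) (b1 * w * S b2))) =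
    \tsum_(b', b3 <- hcop B b) \tsum_(b1, b2 <- hcop B b') \tsum_(c, y <- hcop B w)
      F (b1 * c * S b3) (\tsum_(d1, d2 <- hcop B b2) (d1 * y * S d2)).
  move=> b w; rewrite /yd_act /yd_coact /=.
  by have := h _ (@ptens _ _ _) b w; rewrite tsum_ptens => ->.
move=> hF; rewrite (lin_tsum (f := fun t => tsum F (hcop B t))) //.
in1 rewrite hcop_mul // hcop_mul //.
in3 rewrite hcop_hant //.
rhs in3 rewrite (lin_tsum (f := F _)) //.
swap1; swap0; rhs (swap1; swap0); apply: eq_tsum => c y.
rewrite hcopA3 //.
in1 rewrite -hcopA3 //.
by rewrite [RHS]hcopA3.
Qed.

Lemma adj_coactE (Z : lmodType k) (F : B -> B -> Z) w : kbilin F ->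
  tsum F (@yd_coact _ _ adj_coact_obj w) =
  \tsum_(w', w3 <- hcop B w) \tsum_(w1, w2 <- hcop B w') F (w1 * S w3) w2.
Proof.
move=> hF; rewrite /yd_coact /= tsum_tsum //; apply: eq_tsum => w' w3.
by rewrite tsum_tsum //; apply: eq_tsum => w1 w2; rewrite tsumE.
Qed.

Lemma adj_coact_yd : is_yd adj_coact_obj.
Proof.
have hC : klin (fun w : B =>
  \tsum_(w', w3 <- hcop B w) \tsum_(w1, w2 <- hcop B w') ((w1 * S w3) ⊗ w2)) by [].
split.
- have hA : kbilin (fun b w : B => b * w) by [].
  by apply/kbilinP; exact: hA.
- by move=> w; rewrite /yd_act /= mul1r.
- by move=> a b w; rewrite /yd_act /= mulrA.
- exact: hC.
- move=> w; rewrite !adj_coactE //.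
  in2 rewrite hcop_mul //.
  in3 rewrite hcop_hant //.
  rhs in2 rewrite adj_coactE //.
  in1 rewrite hcopA3 //.
  swap2; swap1; rewrite -hcopA3 //.
  by in1 rewrite hcopA3 //.
- move=> w; rewrite adj_coactE //.
  in2 rewrite hcouM hcou_hant mulrC -scalerA.
  in1 rewrite -tsum_scale.
  in1 rewrite hcoul_lin //.
  by rewrite (hcour_lin (K := fun w => w)).
suff h (Z : lmodType k) (F : B -> B -> Z) b w : kbilin F ->
    tsum F (@yd_coact _ _ adj_coact_obj (b * w)) =
    \tsum_(b', b3 <- hcop B b) \tsum_(b1, b2 <- hcop B b')
      \tsum_(c, y <- @yd_coact _ _ adj_coact_obj w) F (b1 * c * S b3) (b2 * y).
  by move=> b w; have := h _ (@ptens _ _ _) b w; rewrite tsum_ptens => ->.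
move=> hF; rewrite adj_coactE // hcop_mul //.
in2 rewrite hcop_mul //.
rhs in2 rewrite adj_coactE //.
swap1; apply: eq_tsum => b' b3; apply: eq_tsum => b1 b2.
apply: eq_tsum => w' w3; apply: eq_tsum => w1 w2.
by rewrite hantM !mulrA.
Qed.

Section Detection.
Variables (P Q X : ydObj B) (f : P -> Q -> X).
Hypotheses (hP : is_yd P) (hQ : is_yd Q) (hX : is_yd X) (hf : kbilin f).
Hypothesis f_crossr : forall (W : ydObj B) (Z : lmodType k) (F : X -> W -> Z) w p q,
  is_yd W -> kbilin F -> tsum F (braid (w ⊗ f p q)) =
  \tsum_(p', w1 <- braid (w ⊗ p)) \tsum_(q', w2 <- braid (w1 ⊗ q)) F (f p' q') w2.
Hypothesis f_crossl : forall (W : ydObj B) (Z : lmodType k) (F : W -> X -> Z) w p q,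
  is_yd W -> kbilin F -> tsum F (braid (f p q ⊗ w)) =
  \tsum_(w1, q' <- braid (q ⊗ w)) \tsum_(w2, p' <- braid (p ⊗ w1)) F w2 (f p' q').

(* Crossing a strand of [adj_act_obj], whose coaction is the comultiplication of B,
   and then applying the counit recovers the action; crossing over the unit of
   [adj_coact_obj] recovers the coaction. *)
Lemma ydmorph_of_crossings : @is_ydmorph _ _ (ydtens P Q) X (tsum f).
Proof.
have hW1 := adj_act_yd; have hW2 := adj_coact_yd.
have actE (b : adj_act_obj) (p : P) (q : Q) :
    \tsum_(b1, b2 <- hcop B b) f (b1 ·> p) (b2 ·> q) = @yd_act _ B X b (f p q).
  have hF : kbilin (fun (x : X) (w : adj_act_obj) => hcou B w *: x) by [].
  have := f_crossr b p q hW1 hF; rewrite !braidE //.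
  have -> : \tsum_(b1, x <- @yd_coact _ _ adj_act_obj b) (hcou B x *: (b1 ·> f p q)) =
      @yd_act _ B X b (f p q) by exact: (hcour_lin (K := fun b => b ·> f p q)).
  move=> ->; symmetry.
  transitivity (\tsum_(b1, b2 <- hcop B b) \tsum_(c1, c2 <- hcop B b2)
      (hcou B c2 *: f (b1 ·> p) (c1 ·> q))).
    by apply: eq_tsum => b1 b2; rewrite braidE.
  by in1 rewrite (hcour_lin (K := fun c => f _ (c ·> q))) //.
(* [e] is the unit of [B] seen as an element of [adj_coact_obj], which carries no multiplication;
   hence the separate equation. *)
have coactE (e : adj_coact_obj) (p : P) (q : Q) : (e : B) = 1 ->
    \tsum_(b, p0 <- yd_coact p) \tsum_(c, q0 <- yd_coact q) ((b * c) ⊗ f p0 q0) =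
    yd_coact (f p q).
  move=> e1; have hF : kbilin (fun (w : adj_coact_obj) (x : X) => @ptens k B X w x) by [].
  have := f_crossl e p q hW2 hF; rewrite !braidE //.
  have -> : \tsum_(b, x <- yd_coact (f p q)) @ptens k B X (@yd_act _ _ adj_coact_obj b e) x =
      yd_coact (f p q).
    rewrite -[RHS]tsum_ptens; apply: eq_tsum => b x.
    by rewrite /yd_act /= e1 mulr1.
  move=> ->; symmetry; in1 rewrite braidE //.
  rewrite tsumC; apply: eq_tsum => b p0; apply: eq_tsum => c q0.
  by rewrite /yd_act /= e1 mulr1.
split; first exact: tsum_lin.
  move=> b; by_pure => p q.
  by rewrite ydtens_actE // tsum_tsum // tsumE // -actE; apply: eq_tsum => b1 b2; rewrite tsumE.
by_pure => p q; rewrite tsumE // ydtens_coact_tsum //.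
in2 rewrite tsumE //.
by rewrite (coactE 1).
Qed.

End Detection.
End TestObjects.

(** * The algebra U # V *)

Section UnitMorphism.
Variables (k : fieldType) (B : hopfAlg k).
Implicit Types (X : ydObj B) (A : ydAlg B).

Lemma act_one A (b : B) : is_ydalg A -> b ·> yd_one A = hcou B b *: yd_one A.
Proof.
move=> hA; rewrite -[X in b ·> X]scale1r.
by rewrite -(ydmorph_act (ydalg_one hA)) /yd_act /= mulr1.
Qed.

Lemma coact_one A : is_ydalg A -> yd_coact (yd_one A) = 1 ⊗ yd_one A.
Proof.
move=> hA; rewrite -[in LHS](scale1r (yd_one A)).
by rewrite (ydmorph_coact (ydalg_one hA)) /yd_coact /= tsumE // scale1r.
Qed.

Lemma invariant_ydmorph X (x : X) : is_yd X -> (forall b, b ·> x = hcou B b *: x) ->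
  yd_coact x = 1 ⊗ x -> @is_ydmorph _ _ (ydunit B) X (fun c => c *: x).
Proof.
move=> hX hx hcx; split.
- by have : klin (fun c : k^o => (c : k) *: x) by [].
- by move=> b c; rewrite {1}/yd_act /= mulrC -scalerA -hx (linZ (f := fun x => b ·> x)).
move=> c; rewrite [in RHS]/yd_coact /= tsumE //.
by rewrite (linZ (f := @yd_coact _ _ X)) // hcx (linZ (lin_ptensr _)).
Qed.

Lemma tens_one_morph A A' : is_ydalg A -> is_ydalg A' ->
  @is_ydmorph _ _ (ydunit B) (ydtens A A') (fun c : k => c *: (yd_one A ⊗ yd_one A')).
Proof.
move=> hA hA'; apply: invariant_ydmorph => // [b|].
  rewrite ydtens_actE //.
  under eq_tsum => b1 b2 do rewrite !act_one // (linZ (lin_ptensr _)) (linZ (lin_ptensl _)).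
  in1 rewrite scalerA mulrC -scalerA.
  by rewrite (hcoul_lin (K := fun h => hcou B h *: (yd_one A ⊗ yd_one A'))).
by rewrite ydtens_coactE // !coact_one // !tsumE // mulr1.
Qed.

End UnitMorphism.

Section SmashProduct.
Variables (k : fieldType) (B : hopfAlg k) (A : ydAlg B) (K : ydHopf B) (al : K -> A -> A).
Hypotheses (hA : is_yd A) (hK : is_ydhopf K) (hm : kbilin (@yd_mul _ _ A)) (hal : kbilin al).

Lemma smash_bilin : kbilin (@yd_mul _ _ (smash al)).
Proof. by rewrite {1}/yd_mul /=. Qed.

Lemma smashE (a c : A) (h g : K) : @yd_mul _ _ (smash al) (a ⊗ h) (c ⊗ g) =
  \tsum_(h1, h2 <- yd_cop h) \tsum_(c', h2' <- braid (h2 ⊗ c))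
    ((a ∗ al h1 c') ⊗ (h2' ∗ g)).
Proof. by rewrite {1}/yd_mul /= !tsumE. Qed.

End SmashProduct.

Section Smash.
Variables (k : fieldType) (B : hopfAlg k) (U V : ydHopf B) (pr : V -> U -> k).
Hypotheses (hU : is_ydhopf U) (hV : is_ydhopf V) (hpr : hopf_pairing pr).
Let hp := pairing_bilin hpr.
Let hpm := pairing_morph hpr.
Let hh := harp_bilin hU hV hpr.
Let hUy : is_yd U := ydalg_yd (ydhopf_alg hU).
Let hVy : is_yd V := ydalg_yd (ydhopf_alg hV).
Notation "f ⇀ x" := (harpoon pr f x) (at level 38, right associativity).
Notation UV := (smash (harpoon pr)).
Notation lam := (RL_lambda pr).

Lemma smash_mulE (h h' : U) (f f' : V) :
  @yd_mul _ _ UV (h ⊗ f) (h' ⊗ f') =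
  \tsum_(f1, f2 <- yd_cop f) \tsum_(h'', f2' <- braid (f2 ⊗ h'))
    ((h ∗ (f1 ⇀ h'')) ⊗ (f2' ∗ f')).
Proof. exact: smashE. Qed.

Let hZy : is_yd UV := ydtens_yd hUy hVy.

Lemma smash_mul_bilin : kbilin (@yd_mul _ _ UV).
Proof. exact: smash_bilin. Qed.

Lemma lam_bilin : kbilin lam.
Proof. by rewrite /RL_lambda. Qed.

Lemma lamE (h : U) (f : V) x : lam (h ⊗ f) x = h ∗ (f ⇀ x).
Proof.
rewrite /RL_lambda tsumE // (harpE _ _ _ (G := fun y => h ∗ y)) //.
Qed.

Lemma lam_one x : lam (yd_one UV) x = x.
Proof. by rewrite /yd_one /= lamE harp_onel // kalg_mul1l. Qed.

Lemma lam_mul z z' x : lam (@yd_mul _ _ UV z z') x = lam z (lam z' x).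
Proof.
have hl := lam_bilin; have hm := smash_mul_bilin.
move: z; by_pure => h f; move: z'; by_pure => h' f'.
rewrite smash_mulE lamE (lin_tsum (f := fun t => lam t x)) // lamE harp_mulr //.
rewrite (lin_tsum (f := fun y => h ∗ y)) //; apply: eq_tsum => f1 f2.
rewrite (lin_tsum (f := fun t => lam t x)) // (lin_tsum (f := fun y => h ∗ y)) //.
by apply: eq_tsum => h'' f2'; rewrite lamE harp_mull // kalg_mulA.
Qed.

Section Injective.
Variable T : U -> U.
Hypotheses (hUU : bsym U U) (TK : cancel T (@yd_ant _ _ U)) (KT : cancel (@yd_ant _ _ U) T).
Hypothesis sep : forall f, (forall x, pr f x = 0) -> f = 0.

(* The inverse antipode cancels the factor x_1 left over in lambda. *)
Lemma pair_lam (t : tensor U V) x :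
  \tsum_(h, f <- t) (pr f x *: h) =
  \tsum_(x1, x2 <- yd_cop x) \tsum_(x2', x1' <- braid (x1 ⊗ x2)) (lam t x2' ∗ T x1').
Proof.
have hl := lam_bilin; have hT := antV_lin hU TK KT.
move: t; by_pure => h f; rewrite tsumE //.
in2 rewrite lamE.
in2 rewrite (harpE _ _ _ (G := fun y => (h ∗ y) ∗ _)) //.
in1 rewrite (braid_copr (F := fun a c x1' => \tsum_(a', f' <- braid (f ⊗ a))
  (pr f' c *: (h ∗ a' ∗ T x1')))) //.
rhs swap3.
have hTm := antV_ydmorph hU TK KT.
(* Symmetry of [U] trades a crossing of [y1] with the paired entry [c] for a crossing of [f'] with
   [y1]. All crossings are then made by the strand of [f], which can be pulled away from the
   antipode. *)
have dual (Z : lmodType k) (G : U -> Z) f' y1 c : klin G ->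
    \tsum_(c', y2 <- braid (y1 ⊗ c)) (pr f' c' *: G y2) =
    \tsum_(y', f'' <- braid (f' ⊗ y1)) (pr f'' c *: G y').
  move=> hG; have := congr1 G (braid_pair_dual hVy hUy hUy hp hpm f' c y1 hUU).
  rewrite !(lin_tsum _ _ hG) => h0; symmetry; transitivity
    (\tsum_(x, y <- braid (f' ⊗ y1)) G (pr y c *: x)).
    by rhs in1 rewrite (linZ hG).
  by rewrite h0; in1 rewrite (linZ hG).
rhs in4 rewrite (dual _ (fun y => h ∗ _ ∗ T y)) //.
rhs in5 rewrite -kalg_mulA //.
rhs in4 rewrite -(braid_natr (f := T) (F := fun y f => pr f _ *: (h ∗ (_ ∗ y)))) //.
rhs in3 rewrite -(braid_mulr (F := fun u f => pr f _ *: (h ∗ u))) //.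
rewrite -copA3 //.
have antipode (Z : lmodType k) (G : U -> Z) s : klin G ->
    \tsum_(x1, a <- yd_cop s) \tsum_(a', y1 <- braid (x1 ⊗ a)) G (a' ∗ T y1) =
    yd_cou s *: G (yd_one U).
  move=> hG; rewrite -linZ // -(antV_mulr hU hUU TK KT) lin_tsum //.
  by apply: eq_tsum => x1 a; rewrite lin_tsum.
rhs in1 rewrite (antipode _ (fun u => tsum (fun u f => pr f _ *: (h ∗ u)) (braid (f ⊗ u)))) //.
rhs in1 rewrite braid_oner // kalg_mul1r //.
by rewrite (coul_lin (f := fun c => pr f c *: h)).
Qed.

Lemma lam_inj (t t' : tensor U V) : (forall x, lam t x = lam t' x) -> t = t'.
Proof.
move=> h; have hp' x : klin (fun f => pr f x : k^o) by [].
apply: (tensor_separated_eq hp') => [f hf|x]; first exact: sep.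
by rewrite !pair_lam; in2 rewrite h.
Qed.

(** Lambda is a faithful representation on [U], so the axioms are those of composition of
    endomorphisms. *)
Lemma smash_kalg : is_kalg UV.
Proof.
have hm := smash_mul_bilin.
split.
- by apply/kbilinP; exact: hm.
- by move=> x y z; apply: lam_inj => u; rewrite !lam_mul.
- by move=> x; apply: lam_inj => u; rewrite lam_mul lam_one.
- by move=> x; apply: lam_inj => u; rewrite lam_mul lam_one.
Qed.

End Injective.
Section Crossing.
Variables (W : ydObj B) (Z : lmodType k).
Hypothesis hW : is_yd W.

Lemma smash_crossr (F : UV -> W -> Z) (w : W) (z z' : UV) : kbilin F ->
  tsum F (braid (w ⊗ (z ∗ z'))) =
  \tsum_(z1, w1 <- braid (w ⊗ z)) \tsum_(z1', w2 <- braid (w1 ⊗ z')) F (z1 ∗ z1') w2.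
Proof.
have hm := smash_mul_bilin => hF.
move: z; by_pure => h f; move: z'; by_pure => h' f'.
rewrite smash_mulE.
rewrite (lin_tsum (f := fun t => tsum F (@braid _ _ W UV (w ⊗ t)))) //.
in1 rewrite (lin_tsum (f := fun t => tsum F (@braid _ _ W UV (w ⊗ t)))) //.
in2 rewrite braid_tensr //.
in2 rewrite braid_mulr //.
in3 rewrite (braid_harpr hU hV hpr hW) //.
in5 rewrite braid_mulr //.
rhs rewrite braid_tensr //.
rhs in2 rewrite braid_tensr //.
rhs in4 rewrite smash_mulE (lin_tsum (f := fun t => F t _)) //.
rhs in5 rewrite (lin_tsum (f := fun t => F t _)) //.
rhs (swap3; swap2).
rhs in1 rewrite (braid_copr (F := fun f1 f2 w2 => \tsum_(h'a, w3 <- braid (w2 ⊗ h'))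
  \tsum_(f'a, w4 <- braid (w3 ⊗ f')) \tsum_(h2, f2b <- braid (f2 ⊗ h'a))
  F ((_ ∗ (f1 ⇀ h2)) ⊗ (f2b ∗ f'a)) w4)) //.
rhs swap5.
rhs in3 rewrite (braid_YB (F := fun h2 f2b w4 => \tsum_(f'a, w5 <- braid (w4 ⊗ f'))
  F ((_ ∗ (_ ⇀ h2)) ⊗ (f2b ∗ f'a)) w5)) //.
by rhs (swap0; swap2; swap1).
Qed.

Lemma smash_crossl (F : W -> UV -> Z) (w : W) (z z' : UV) : kbilin F ->
  tsum F (braid ((z ∗ z') ⊗ w)) =
  \tsum_(w1, z1' <- braid (z' ⊗ w)) \tsum_(w2, z1 <- braid (z ⊗ w1)) F w2 (z1 ∗ z1').
Proof.
have hm := smash_mul_bilin => hF.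
move: z; by_pure => h f; move: z'; by_pure => h' f'.
rewrite smash_mulE.
rewrite (lin_tsum (f := fun t => tsum F (@braid _ _ UV W (t ⊗ w)))) //.
in1 rewrite (lin_tsum (f := fun t => tsum F (@braid _ _ UV W (t ⊗ w)))) //.
in2 rewrite braid_tensl //.
in2 rewrite braid_mull //.
in4 rewrite braid_mull //.
in4 rewrite (braid_harpl hU hV hpr hW) //.
rhs rewrite braid_tensl //.
rhs in2 rewrite braid_tensl //.
rhs in4 rewrite smash_mulE (lin_tsum (f := F _)) //.
rhs in5 rewrite (lin_tsum (f := F _)) //.
rhs swap3.
rhs in2 rewrite (braid_copl (F := fun wc f1 f2 => \tsum_(wd, h1 <- braid (h ⊗ wc))
  \tsum_(h2, f2b <- braid (f2 ⊗ _)) F wd ((h1 ∗ (f1 ⇀ h2)) ⊗ (f2b ∗ _)))) //.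
rhs (swap5; swap4; swap1).
rhs in2 rewrite -(braid_YB (F := fun w1 h2 f2b => \tsum_(w2, f1a <- braid (_ ⊗ w1))
  \tsum_(w3, h1 <- braid (h ⊗ w2)) F w3 ((h1 ∗ (f1a ⇀ h2)) ⊗ (f2b ∗ _)))) //.
by rhs (swap0; swap1).
Qed.

End Crossing.

Lemma smash_mul_morph :
  @is_ydmorph _ _ (ydtens UV UV) UV (tsum (@yd_mul _ _ UV)).
Proof.
have hm := smash_mul_bilin.
apply: ydmorph_of_crossings => // W Z F w p q hW hF.
  exact: smash_crossr.
exact: smash_crossl.
Qed.

Lemma smash_one_morph : @is_ydmorph _ _ (ydunit B) UV (fun c => c *: yd_one UV).
Proof.
exact: tens_one_morph.
Qed.

End Smash.

(** * Lifting V to U # V *)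

Section InternalHom.
Variables (k : fieldType) (B : hopfAlg k) (P X Y : ydObj B) (G : P -> X -> Y).
Hypotheses (hP : is_yd P) (hX : is_yd X) (hY : is_yd Y) (hG : kbilin G).
Hypothesis hGm : @is_ydmorph _ _ (ydtens P X) Y (tsum G).

(** This is the action on the internal Hom from [X] to [Y]. The right-hand side sees [p] only
    through the map [G p], as does that of [hom_coact]; this lets an equality lambda (w f) = rho f
    pass to actions and coactions. *)
Lemma hom_act b p x :
  G (b ·> p) x = \tsum_(b1, b2 <- hcop B b) (b1 ·> G p (hant B b2 ·> x)).
Proof.
have act c q y : c ·> G q y = \tsum_(c1, c2 <- hcop B c) G (c1 ·> q) (c2 ·> y).
  have := ydmorph_act hGm c (q ⊗ y); rewrite tsumE // => <-.
  rewrite ydtens_actE // tsum_tsum //; apply: eq_tsum => c1 c2; by rewrite tsumE.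
in1 rewrite act.
rewrite hcopA3 //.
in2 rewrite -yd_actM //.
in1 rewrite (hantr_lin (K := fun h => G _ (h ·> x))) // yd_act1 //.
by rewrite (hcour_lin (K := fun h => G (h ·> p) x)).
Qed.

Lemma hom_coact (Z : lmodType k) (F : B -> Y -> Z) p x : kbilin F ->
  \tsum_(c, p0 <- yd_coact p) F c (G p0 x) =
  \tsum_(d, x0 <- yd_coact x) \tsum_(c, y <- yd_coact (G p x0)) F (c * hantV d) y.
Proof.
move=> hF.
have coact (F' : B -> Y -> Z) q y : kbilin F' -> tsum F' (yd_coact (G q y)) =
    \tsum_(c, q0 <- yd_coact q) \tsum_(d, y0 <- yd_coact y) F' (c * d) (G q0 y0).
  move=> hF'; have := ydmorph_coact hGm (q ⊗ y); rewrite tsumE // => ->.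
  rewrite ydtens_coact_tsum // tsum_tsum //; apply: eq_tsum => c q0.
  by rewrite tsum_tsum //; apply: eq_tsum => d y0; rewrite tsumE // tsumE.
symmetry; in1 rewrite coact //.
rewrite tsumC; apply: eq_tsum => c p0.
rewrite -(coactA3 (F := fun d d' x0 => F (c * d' * hantV d) (G p0 x0))) //.
in2 rewrite -mulrA.
in1 rewrite (hantVr_lin (K := fun h => F (c * h) (G p0 _))) // mulr1.
by rewrite (coact_cou_lin (K := fun x => F c (G p0 x))).
Qed.

End InternalHom.

Section RightLeft.
Variables (k : fieldType) (B : hopfAlg k) (U V : ydHopf B) (pr : V -> U -> k).
Hypotheses (hU : is_ydhopf U) (hV : is_ydhopf V) (hpr : hopf_pairing pr).
Let hp := pairing_bilin hpr.
Let hpm := pairing_morph hpr.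
Let hh := harp_bilin hU hV hpr.
Let hUy : is_yd U := ydalg_yd (ydhopf_alg hU).
Let hVy : is_yd V := ydalg_yd (ydhopf_alg hV).
Notation "f ⇀ x" := (harpoon pr f x) (at level 38, right associativity).
Notation UV := (smash (harpoon pr)).
Notation lam := (RL_lambda pr).
Let hZy : is_yd UV := ydtens_yd hUy hVy.
Let hl := lam_bilin hU hV hpr.
Let hm := smash_mul_bilin hU hV hpr.

Definition rho (f : V) (x : U) : U := \tsum_(x1, x2 <- yd_cop x) (pr f x1 *: x2).

Lemma rho_bilin : kbilin rho.
Proof. by rewrite /rho. Qed.

Lemma RL_rho_one f x : RL_rho pr (f ⊗ yd_one U) x = rho f x.
Proof.
rewrite /RL_rho tsumE // coact_one // tsumE // hcop1 tsumE //.
by in1 rewrite !yd_act1 // kalg_mul1r //.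
Qed.

Lemma lam_morph : @is_ydmorph _ _ (ydtens UV U) U (tsum lam).
Proof.
apply: ydmorph_of_crossings => // W Z F w z x hW hF; move: z; by_pure => h f.
  rewrite lamE // braid_mulr //.
  in1 rewrite (braid_harpr hU hV hpr hW) //.
  rewrite braid_tensr //.
  by rhs in3 rewrite lamE //.
rewrite lamE // braid_mull //.
rewrite (braid_harpl hU hV hpr hW) //.
rhs in1 rewrite braid_tensl //.
by rhs in3 rewrite lamE //.
Qed.

Lemma rhoE (Z : lmodType k) (G : U -> Z) f x : klin G ->
  G (rho f x) = \tsum_(x1, x2 <- yd_cop x) (pr f x1 *: G x2).
Proof. by move=> hG; rewrite /rho lin_tsum //; in1 rewrite (linZ hG). Qed.

Lemma rho_morph : @is_ydmorph _ _ (ydtens V U) U (tsum rho).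
Proof.
have hr := rho_bilin.
apply: ydmorph_of_crossings => // W Z F w f x hW hF.
  rewrite (rhoE (G := fun y => tsum F (braid (w ⊗ y)))) //.
  rhs in2 rewrite (rhoE (G := fun y => F y _)) //.
  rhs in1 rewrite (braid_copr (F := fun a b w => pr _ a *: F b w)) //.
  rhs swap0.
  rhs in3 rewrite -tsum_scale.
  by rhs in1 rewrite (braid_pairr (G := fun w => tsum F (braid (w ⊗ _))) hVy hUy hW hp hpm) //.
rewrite (rhoE (G := fun y => tsum F (braid (y ⊗ w)))) //.
rhs in2 rewrite (rhoE (G := F _)) //.
rhs swap1.
rewrite [RHS](braid_copl (F := fun w1 a b => \tsum_(w2, f' <- braid (f ⊗ w1))
  (pr f' a *: F w2 b))) //.
rhs in2 rewrite (braid_pairl (G := F^~ _) hVy hUy hW hp hpm) //.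
by in1 rewrite tsum_scale.
Qed.

(** In [rho f (rho g x)] the first leg of [x] meets [g] and the second meets [f], so the product
    appears in reversed order. *)
Lemma rho_mul f g x : rho f (rho g x) = \tsum_(g', f' <- braid (f ⊗ g)) rho (g' ∗ f') x.
Proof.
have hr := rho_bilin.
rewrite (rhoE (G := rho f)) // /rho.
rhs in2 rewrite pairing_mull //.
rhs (swap0; swap1).
rhs in2 rewrite (braid_pairr (G := fun f => pr f _ *: _) hVy hUy hVy hp hpm) //.
by in1 rewrite tsum_scale; rewrite -copA3.
Qed.

Variables (T : U -> U) (I : Type) (phi : I -> U -> k).
Hypotheses (hUU : bsym U U) (hUV : bsym U V).
Hypotheses (TK : cancel T (@yd_ant _ _ U)) (KT : cancel (@yd_ant _ _ U) T).
Hypothesis sep : forall f, (forall x, pr f x = 0) -> f = 0.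
Hypothesis hphi : forall i, klin (phi i : U -> k^o).
Hypothesis sepU : forall u, (forall i, phi i u = 0) -> u = 0.
Hypothesis RL : RL_condition pr.

(** The preimage under lambda is picked by choice; injectivity of lambda makes it unique, and all
    properties of [w] follow from this. *)
Definition RL_lift (f : V) : UV := sval (cid (RL f)).
Notation w := RL_lift.

Let linj := lam_inj hU hV hpr hUU TK KT sep.

Lemma lam_RL_lift f x : lam (w f) x = rho f x.
Proof. by rewrite /w; case: cid => t /= <-; rewrite RL_rho_one. Qed.

Lemma RL_lift_lin : klin w.
Proof.
have hr := rho_bilin => a f g; apply: linj => x.
by rewrite lam_RL_lift hr.1 hl.1 !lam_RL_lift.
Qed.

Lemma RL_lift_one : w (yd_one V) = yd_one UV.
Proof.
apply: linj => x; rewrite lam_RL_lift lam_one // /rho.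
by in1 rewrite pairing_onel //; rewrite (coul_lin (f := fun x => x)).
Qed.

Lemma RL_lift_mul f g : w f ∗ w g = \tsum_(g', f' <- braid (f ⊗ g)) w (g' ∗ f').
Proof.
have hw := RL_lift_lin; apply: linj => x.
rewrite lam_mul // !lam_RL_lift rho_mul (lin_tsum (f := fun z => lam z x)) //.
by rhs in1 rewrite lam_RL_lift.
Qed.

Lemma RL_lift_morph : @is_ydmorph _ _ V UV w.
Proof.
have hw := RL_lift_lin; have hr := rho_bilin; have hT := antV_lin hU TK KT.
split; first exact: hw.
  move=> b f; apply: linj => x.
  rewrite lam_RL_lift (hom_act hVy hUy hr rho_morph) (hom_act hZy hUy hl lam_morph).
  by rhs in1 rewrite lam_RL_lift.
move=> f.
have key (Z : lmodType k) (F : B -> U -> Z) y : kbilin F ->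
    \tsum_(c, z <- yd_coact (w f)) F c (lam z y) =
    \tsum_(c, f0 <- yd_coact f) F c (lam (w f0) y).
  move=> hF; rewrite (hom_coact hZy hUy hl lam_morph) //.
  rhs in1 rewrite lam_RL_lift.
  rewrite (hom_coact hVy hUy hr rho_morph) //.
  by in1 rewrite lam_RL_lift.
(* The two sides lie in B ⊗ (U # V), out of direct reach of injectivity of lambda. The functionals
   [psi] separate the points of U # V, and [pair_lam] computes them from lambda alone, so [key]
   applies. *)
pose psi (ix : I * U) (z : UV) : k := phi ix.1 (\tsum_(h, g <- z) (pr g ix.2 *: h)).
have hpsi ix : klin (psi ix : UV -> k^o) by have hi := hphi ix.1; rewrite /psi.
have hsep (z : UV) : (forall ix, psi ix z = 0) -> z = 0.
  move=> hz; have hp' x : klin (fun f => pr f x : k^o) by [].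
  apply: (tensor_separated hp') => [g hg|x]; first exact: sep.
  by apply: sepU => i; exact: (hz (i, x)).
apply: (tensor_separated_eq hpsi hsep) => -[i x]; have hi := hphi i.
have psiE (c : B) z : psi (i, x) z *: c =
    \tsum_(x1, x2 <- yd_cop x) \tsum_(x2', x1' <- braid (x1 ⊗ x2))
      (phi i (lam z x2' ∗ T x1') *: c).
  rewrite /psi /= (pair_lam hU hV hpr hUU TK KT).
  rewrite (lin_tsum (f := fun u => phi i u *: c)) //; apply: eq_tsum => x1 x2.
  by rewrite (lin_tsum (f := fun u => phi i u *: c)).
have hpi := hpsi (i, x).
rewrite [RHS]tsum_tsum //.
rhs in1 rewrite tsumE // psiE.
in1 rewrite psiE.
rewrite tsumC; swap1; rhs rewrite tsumC; rhs swap1.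
apply: eq_tsum => x1 x2; apply: eq_tsum => x2' x1'.
exact: (key _ (fun c y => phi i (y ∗ T x1') *: c)).
Qed.

(* [u # v] commutes with [w f] up to the braiding, after pairing part of [u] with [f];
   this turns the crossing in [(R # U) # V] into the one in [R ⊗ (U # V)]. *)
Lemma RL_lift_comm (u : U) (v f : V) :
  \tsum_(f1, f2 <- yd_cop f) \tsum_(g, v' <- braid (v ⊗ f1))
    \tsum_(a, u' <- braid (u ⊗ g)) \tsum_(b, u2 <- yd_cop u')
      (pr a b *: @yd_mul _ _ UV (u2 ⊗ v') (w f2)) =
  \tsum_(g, v' <- braid (v ⊗ f)) \tsum_(a, u' <- braid (u ⊗ g))
    @yd_mul _ _ UV (w a) (u' ⊗ v').
Proof.
have hw := RL_lift_lin; have hr := rho_bilin; apply: linj => x.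
rewrite (lin_tsum (f := fun z => lam z x)) //.
in1 rewrite (lin_tsum (f := fun z => lam z x)) //.
in2 rewrite (lin_tsum (f := fun z => lam z x)) //.
in3 rewrite (lin_tsum (f := fun z => lam z x)) //.
in4 rewrite (linZ (f := fun z => lam z x)) // lam_mul // lamE // lam_RL_lift.
in4 rewrite (rhoE (G := fun y => pr _ _ *: (_ ∗ (_ ⇀ y)))) //.
rewrite (lin_tsum (f := fun z => lam z x)) //.
rhs in1 rewrite (lin_tsum (f := fun z => lam z x)) //.
rhs in2 rewrite lam_mul // lamE // lam_RL_lift /rho cop_mul //.
rhs in3 rewrite cop_harp //.
rhs in6 rewrite pairing_mulr //.
rhs (swap5; swap4; swap3; swap2).
rhs in1 rewrite (braid_copr (F := fun p q u' => \tsum_(u1, u2 <- yd_cop u')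
  \tsum_(x1, x2 <- yd_cop x) \tsum_(x1', v'' <- braid (_ ⊗ x1))
  \tsum_(y1', u2' <- braid (u2 ⊗ x1')) \tsum_(u1', q' <- braid (q ⊗ u1))
    (pr p u1' *: (pr q' y1' *: (u2' ∗ (v'' ⇀ x2)))))) //.
rhs rewrite (braid_copr (F := fun p q v' => \tsum_(p2, ua <- braid (u ⊗ p))
  \tsum_(q2, u' <- braid (ua ⊗ q)) \tsum_(u1, u2 <- yd_cop u')
  \tsum_(x1, x2 <- yd_cop x) \tsum_(x1', v'' <- braid (v' ⊗ x1))
  \tsum_(y1', u2' <- braid (u2 ⊗ x1')) \tsum_(u1', q' <- braid (q2 ⊗ u1))
    (pr p2 u1' *: (pr q' y1' *: (u2' ∗ (v'' ⇀ x2)))))) //.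
rhs in4 rewrite (braid_copl (F := fun q2 u1 u2 =>
  \tsum_(x1, x2 <- yd_cop x) \tsum_(x1', v'' <- braid (_ ⊗ x1))
  \tsum_(y1', u2' <- braid (u2 ⊗ x1')) \tsum_(u1', q' <- braid (q2 ⊗ u1))
    (pr _ u1' *: (pr q' y1' *: (u2' ∗ (v'' ⇀ x2)))))) //.
rhs (swap9; swap8; swap7).
(* The first leg of [u] has crossed [q] on the way in and again under the pairing; symmetry of [U]
   and [V] cancels these crossings. *)
rhs in6 rewrite (bsymE (F := fun u1' q' =>
  \tsum_(x1, x2 <- yd_cop x) \tsum_(x1', v'' <- braid (_ ⊗ x1))
  \tsum_(y1', u2' <- braid (_ ⊗ x1'))
    (pr _ u1' *: (pr q' y1' *: (u2' ∗ (v'' ⇀ x2)))))) //.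
rhs in9 rewrite scalerA mulrC -scalerA.
rhs (swap5; swap6).
(* The leg [u2] now crosses both entries of one pairing and slides off; [v''] is freed in the same
   way below. *)
rhs in7 rewrite (braid_pairr (G := fun u2 => pr _ _ *: (u2 ∗ (_ ⇀ _))) hVy hUy hUy hp hpm) //.
rhs (swap2; swap3; swap4).
rhs in5 rewrite (braid_pairr (G := fun v'' => pr _ _ *: (_ ∗ (v'' ⇀ _))) hVy hUy hVy hp hpm) //.
by [].
Qed.

End RightLeft.

(** * Braided tensor products and transport of structure *)

Section BraidedTensorProduct.
Variables (k : fieldType) (B : hopfAlg k) (A A' : ydAlg B).
Hypotheses (hA : is_ydalg A) (hA' : is_ydalg A').
Let hAy : is_yd A := ydalg_yd hA.
Let hAy' : is_yd A' := ydalg_yd hA'.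
Let hAA : is_yd (btens A A') := ydtens_yd hAy hAy'.
Local Notation AA := (btens A A').

Lemma btens_mul_bilin : kbilin (@yd_mul _ _ AA).
Proof. by rewrite /yd_mul /=. Qed.

Lemma btens_mulE (a c : A) (a' c' : A') : @yd_mul _ _ AA (a ⊗ a') (c ⊗ c') =
  \tsum_(c1, a1 <- braid (a' ⊗ c)) ((a ∗ c1) ⊗ (a1 ∗ c')).
Proof. by rewrite {1}/yd_mul /= !tsumE. Qed.

Lemma btens_kalg : is_kalg AA.
Proof.
have hm := btens_mul_bilin; split.
- by apply/kbilinP; exact: hm.
- move=> x y z; move: x; by_pure => x x'; move: y; by_pure => y y'; move: z; by_pure => z z'.
  rewrite !btens_mulE (lin_tsum (f := @yd_mul _ _ AA _)) //.
  rhs rewrite (lin_tsum (f := fun t => @yd_mul _ _ AA t _)) //.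
  in1 rewrite btens_mulE braid_mulr //.
  rhs in1 rewrite btens_mulE braid_mull //.
  rewrite tsumC; apply: eq_tsum => y1 x1; apply: eq_tsum => z1 y1'.
  by apply: eq_tsum => z2 x2; rewrite !kalg_mulA.
- by_pure => x x'; rewrite btens_mulE braid_onel // !kalg_mul1l ?tsum_ptens //.
by_pure => x x'; rewrite btens_mulE braid_oner // !kalg_mul1r ?tsum_ptens //.
Qed.

Lemma btens_mul_morph : @is_ydmorph _ _ (ydtens AA AA) AA (tsum (@yd_mul _ _ AA)).
Proof.
have hm := btens_mul_bilin.
apply: ydmorph_of_crossings => // W Z F w p q hW hF;
  move: p; by_pure => x x'; move: q; by_pure => y y'; rewrite btens_mulE.
  rewrite (lin_tsum (f := fun t => tsum F (@braid _ _ W AA (w ⊗ t)))) //.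
  in1 rewrite braid_tensr //.
  in1 rewrite braid_mulr //.
  in3 rewrite braid_mulr //.
  rhs rewrite braid_tensr //.
  rhs in2 rewrite braid_tensr //.
  rhs in4 rewrite btens_mulE (lin_tsum (f := fun t => F t _)) //.
  rhs swap3.
  rhs in1 rewrite (braid_YB (F := fun y1 x1 w' => \tsum_(y2, w2 <- braid (w' ⊗ y'))
    F ((_ ∗ y1) ⊗ (x1 ∗ y2)) w2)) //.
  by rhs swap0.
rewrite (lin_tsum (f := fun t => tsum F (@braid _ _ AA W (t ⊗ w)))) //.
in1 rewrite braid_tensl //.
in1 rewrite braid_mull //.
in3 rewrite braid_mull //.
rhs rewrite braid_tensl //.
rhs in2 rewrite braid_tensl //.
rhs in4 rewrite btens_mulE (lin_tsum (f := F _)) //.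
rhs swap3.
rhs in1 rewrite -(braid_YB (F := fun w' y1 x1 => \tsum_(w2, x2 <- braid (x ⊗ w'))
  F w2 ((x2 ∗ y1) ⊗ (x1 ∗ _)))) //.
by rhs swap0.
Qed.

Lemma btens_ydalg : is_ydalg AA.
Proof.
split=> //; [exact: btens_kalg | exact: btens_mul_morph | exact: tens_one_morph].
Qed.

End BraidedTensorProduct.

Section Transport.
Variables (k : fieldType) (B : hopfAlg k) (A A' : ydAlg B) (f : A' -> A) (g : A -> A').
Hypotheses (hA : is_yd A) (hA' : is_ydalg A') (fK : cancel f g) (gK : cancel g f).
Hypotheses (hf : is_ydmorph f) (f1 : f (yd_one A') = yd_one A).
Hypothesis fM : forall x y, f (x ∗ y) = f x ∗ f y.
Let hAy' : is_yd A' := ydalg_yd hA'.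

Lemma inv_ydmorph : is_ydmorph g.
Proof.
have hfl : klin f := ydmorph_linear hf.
have hg : klin g by move=> a x y; rewrite -{1}[x]gK -{1}[y]gK -hfl fK.
split=> //.
  by move=> b x; rewrite -{1}[x]gK -(ydmorph_act hf) fK.
move=> x; rewrite -{2}[x]gK (ydmorph_coact hf) tsum_tsum //.
by in1 rewrite tsumE // fK; rewrite tsum_ptens.
Qed.

Lemma inv_mul x y : g (x ∗ y) = g x ∗ g y.
Proof. by rewrite -{1}[x]gK -{1}[y]gK -fM fK. Qed.

Lemma transport_mulE x y : x ∗ y = f (g x ∗ g y).
Proof. by rewrite fM !gK. Qed.

(** Since every product in [A] is the image under [f] of a product in [A'], each axiom is carried
    over. *)
Lemma transport_ydalg : is_ydalg A.
Proof.
have hg := inv_ydmorph; have hk' := ydalg_kalg hA'.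
have hm : kbilin (@yd_mul _ _ A).
  have hm' : kbilin (fun x y => f (g x ∗ g y)) by [].
  by split=> [y|x] a u v; rewrite !transport_mulE; [exact: (hm'.1 y) | exact: (hm'.2 x)].
split=> //.
- split; first by apply/kbilinP; exact: hm.
  + by move=> x y z; rewrite !transport_mulE !fK kalg_mulA.
  + by move=> x; rewrite transport_mulE -f1 fK kalg_mul1l // gK.
  + by move=> x; rewrite transport_mulE -f1 fK kalg_mul1r // gK.
- split; first exact: tsum_lin.
  + move=> b; by_pure => x y; rewrite ydtens_actE // tsum_tsum // tsumE //.
    in1 rewrite tsumE // transport_mulE !(ydmorph_act hg).
    rewrite transport_mulE -(ydmorph_act hf).
    have := ydmorph_act (ydalg_mul hA') b (g x ⊗ g y); rewrite tsumE // => <-.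
    rewrite ydtens_actE // tsum_tsum // (lin_tsum (f := f)) //.
    by apply: eq_tsum => b1 b2; rewrite tsumE.
  by_pure => x y; rewrite tsumE // ydtens_coact_tsum //.
  in2 rewrite tsumE //.
  rewrite transport_mulE (ydmorph_coact hf).
  have := ydmorph_coact (ydalg_mul hA') (g x ⊗ g y); rewrite tsumE // => ->.
  rewrite tsum_tsum //; in1 rewrite tsumE //.
  rewrite ydtens_coact_tsum // (ydmorph_coact hg y) (ydmorph_coact hg x) tsum_tsum //.
  apply: eq_tsum => b x0; rewrite tsumE // tsum_tsum //.
  by apply: eq_tsum => c y0; rewrite !tsumE // -transport_mulE.
have h1 := ydalg_one hA'.
split.
- by have : klin (fun c : k^o => (c : k) *: yd_one A).
- move=> b c; rewrite -f1 -!(linZ (ydmorph_linear hf)) -(ydmorph_act hf).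
  by congr f; exact: (ydmorph_act h1 b c).
move=> c; rewrite -f1 -(linZ (ydmorph_linear hf)) (ydmorph_coact hf).
rewrite (ydmorph_coact h1 c) tsum_tsum //; apply: eq_tsum => b d.
by rewrite tsumE // (linZ (ydmorph_linear hf)).
Qed.

Lemma transport_iso : is_ydalg_iso g.
Proof.
have hA1 := transport_ydalg; have hg := inv_ydmorph.
split=> //; split; [exact: ydalg_kalg | exact: ydalg_kalg | | by exists f].
split; [exact: ydmorph_linear hg | by rewrite -f1 fK | exact: inv_mul].
Qed.

End Transport.

(** * The twist isomorphism *)

Section Associator.
Variables (k : fieldType) (B : hopfAlg k) (X Y W : ydObj B).
Hypotheses (hX : is_yd X) (hY : is_yd Y) (hW : is_yd W).

Definition assocl (t : ydtens X (ydtens Y W)) : ydtens (ydtens X Y) W :=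
  \tsum_(x, s <- t) \tsum_(y, w <- s) ((x ⊗ y) ⊗ w).
Definition assocr (t : ydtens (ydtens X Y) W) : ydtens X (ydtens Y W) :=
  \tsum_(s, w <- t) \tsum_(x, y <- s) (x ⊗ (y ⊗ w)).

Lemma assoclE x y w : assocl (x ⊗ (y ⊗ w)) = (x ⊗ y) ⊗ w.
Proof. by rewrite /assocl !tsumE. Qed.

Lemma assocrE x y w : assocr ((x ⊗ y) ⊗ w) = x ⊗ (y ⊗ w).
Proof. by rewrite /assocr !tsumE. Qed.

Lemma assocl_lin : klin assocl.
Proof. by rewrite /assocl. Qed.

Lemma assocr_lin : klin assocr.
Proof. by rewrite /assocr. Qed.

Lemma assoclK : cancel assocl assocr.
Proof.
have hl := assocl_lin; have hr := assocr_lin.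
by move=> t; move: t; by_pure => x t; move: t; by_pure => y w; rewrite assoclE assocrE.
Qed.

Lemma assocrK : cancel assocr assocl.
Proof.
have hl := assocl_lin; have hr := assocr_lin.
by move=> t; move: t; by_pure => t w; move: t; by_pure => x y; rewrite assocrE assoclE.
Qed.

Lemma assocl_ydmorph : is_ydmorph assocl.
Proof.
have hXY := ydtens_yd hX hY; have hYW := ydtens_yd hY hW; have hYXW := ydtens_yd hXY hW.
apply: (ydmorph_of_crossings (P := X) (Q := ydtens Y W) (X := ydtens (ydtens X Y) W)
  (f := fun x s => \tsum_(y, w <- s) ((x ⊗ y) ⊗ w))) => //.
  move=> N Z F n x t hN hF; move: t; by_pure => y w; rewrite tsumE // braid_tensr //.
  rewrite braid_tensr //.
  rhs in1 rewrite braid_tensr //.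
  by rhs in3 rewrite tsumE //.
move=> N Z F n x t hN hF; move: t; by_pure => y w; rewrite tsumE // braid_tensl //.
in1 rewrite braid_tensl //.
rhs rewrite braid_tensl //.
by rhs in3 rewrite tsumE //.
Qed.

End Associator.

Section Twist.
Variables (k : fieldType) (B : hopfAlg k) (V : ydHopf B) (R Z : ydAlg B).
Variables (psi : R -> tensor R V) (w : V -> Z) (T : V -> V).
Hypotheses (hV : is_ydhopf V) (hR : is_ydalg R) (hZ : is_ydalg Z).
Hypotheses (hpsi : is_comodalg psi) (hVV : bsym V V).
Hypotheses (TK : cancel T (@yd_ant _ _ V)) (KT : cancel (@yd_ant _ _ V) T).
Hypotheses (hw : is_ydmorph w) (w1 : w (yd_one V) = yd_one Z).
Hypothesis wM : forall f g, w f ∗ w g = \tsum_(g', f' <- braid (f ⊗ g)) w (g' ∗ f').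
Local Notation RZ := (btens R Z).
Let hRy : is_yd R := ydalg_yd hR.
Let hVy : is_yd V := ydalg_yd (ydhopf_alg hV).
Let hZy : is_yd Z := ydalg_yd hZ.
Let hpm := comodalg_yd hpsi.

Definition twist (u : V -> Z) (t : RZ) : RZ :=
  \tsum_(r, z <- t) \tsum_(r0, f <- psi r) (r0 ⊗ (u f ∗ z)).

Lemma twist_lin (u : V -> Z) : klin u -> klin (twist u).
Proof. by move=> hu; rewrite /twist. Qed.

Lemma twistE (u : V -> Z) r z : klin u ->
  twist u (r ⊗ z) = \tsum_(r0, f <- psi r) (r0 ⊗ (u f ∗ z)).
Proof. by move=> hu; rewrite /twist tsumE. Qed.

(** By coassociativity of [psi], composing twists convolves [u] with [v]; the twist by the
    convolution unit is the identity. *)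
Lemma twistK_of (u v : V -> Z) : klin u -> klin v ->
  (forall f, \tsum_(f1, f2 <- yd_cop f) (u f1 ∗ v f2) = yd_cou f *: yd_one Z) ->
  cancel (twist v) (twist u).
Proof.
move=> hu hv uv; have hul := twist_lin hu; have hvl := twist_lin hv.
move=> t; move: t; by_pure => r z; rewrite twistE // (lin_tsum (f := twist u)) //.
in1 rewrite twistE //.
rewrite -(comod_coA3 (F := fun r0 f1 f2 => r0 ⊗ (u f1 ∗ (v f2 ∗ z))) _ hpsi) //.
in2 rewrite kalg_mulA //.
in1 rewrite -(lin_tsum (f := fun y => _ ⊗ (y ∗ z))) // uv.
in1 rewrite (linZ (f := fun y => _ ⊗ (y ∗ z))) // kalg_mul1l // -(linZ (f := fun r => r ⊗ z)) //.
by rewrite -(lin_tsum (f := fun r => r ⊗ z)) // (comodalg_cou hpsi).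
Qed.

(** Since [w] reverses products up to a crossing, the product here becomes [w] of the crossed
    antipode identity [antV_mulr] for [T]. *)
Lemma wT_cop f : \tsum_(f1, f2 <- yd_cop f) (w (T f1) ∗ w f2) = yd_cou f *: yd_one Z.
Proof.
have hT := antV_ydmorph hV TK KT.
in1 rewrite wM (braid_natl (F := fun g h => w (g ∗ h)) _ _ _ _ _ hT) //.
rewrite -w1 -(linZ (ydmorph_linear hw)) -(antV_mulr hV hVV TK KT).
rewrite (lin_tsum (f := w)) //.
by rhs in1 rewrite (lin_tsum (f := w)) //.
Qed.

Lemma w_copT f : \tsum_(f1, f2 <- yd_cop f) (w f1 ∗ w (T f2)) = yd_cou f *: yd_one Z.
Proof.
have hT := antV_ydmorph hV TK KT.
in1 rewrite wM (braid_natr (F := fun g h => w (g ∗ h)) _ _ _ _ _ hT) //.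
rewrite -w1 -(linZ (ydmorph_linear hw)) -(antV_mull hV hVV TK KT).
rewrite (lin_tsum (f := w)) //.
by rhs in1 rewrite (lin_tsum (f := w)) //.
Qed.

Lemma twist_bij : cancel (twist w) (twist (w \o T)) /\ cancel (twist (w \o T)) (twist w).
Proof.
have hT := antV_ydmorph hV TK KT.
have hwl : klin w := ydmorph_linear hw; have hwT : klin (w \o T) by rewrite /comp.
split; apply: twistK_of => //; [exact: wT_cop | exact: w_copT].
Qed.

Lemma twist_ydmorph : is_ydmorph (twist w).
Proof.
have hRZ : is_yd RZ := ydtens_yd hRy hZy.
apply: (ydmorph_of_crossings (P := R) (Q := Z) (X := RZ)
  (f := fun r z => \tsum_(r0, f <- psi r) (r0 ⊗ (w f ∗ z)))) => // N X F n r z hN hF.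
  rewrite (lin_tsum (f := fun t => tsum F (@braid _ _ N RZ (n ⊗ t)))) //.
  in1 rewrite braid_tensr //.
  in2 rewrite braid_mulr //.
  in2 rewrite (braid_natr (F := fun y n1 =>
    \tsum_(z', n2 <- braid (n1 ⊗ z)) F (_ ⊗ (y ∗ z')) n2) _ _ _ _ _ hw) //.
  rhs in2 rewrite (lin_tsum (f := fun t => F t _)) //.
  rhs swap1.
  rhs rewrite (braid_splitr (F := fun r0 f n1 =>
    \tsum_(z', n2 <- braid (n1 ⊗ z)) F (r0 ⊗ (w f ∗ z')) n2) _ _ _ _ _ _ hpm) //.
rewrite (lin_tsum (f := fun t => tsum F (@braid _ _ RZ N (t ⊗ n)))) //.
in1 rewrite braid_tensl //.
in1 rewrite braid_mull //.
in2 rewrite (braid_natl (F := fun n1 y => \tsum_(n2, r0 <- braid (_ ⊗ n1)) F n2 (r0 ⊗ (y ∗ _))) _ _ _ _ _ hw) //.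
rhs in2 rewrite (lin_tsum (f := F _)) //.
rhs in1 rewrite (braid_splitl (F := fun n2 r0 f => F n2 (r0 ⊗ (w f ∗ _))) _ _ _ _ _ _ hpm) //.
by rhs swap0.
Qed.

Lemma psi_one : psi (yd_one R) = yd_one R ⊗ yd_one V.
Proof. exact: algmorph1 (comodalg_alg hpsi). Qed.

Lemma twist_one : twist w (yd_one RZ) = yd_one RZ.
Proof. by rewrite twistE // psi_one tsumE // w1 kalg_mul1l. Qed.

Lemma psi_mul (X : lmodType k) (F : R -> V -> X) r s : kbilin F ->
  tsum F (psi (r ∗ s)) = \tsum_(r0, f <- psi r) \tsum_(s0, g <- psi s)
    \tsum_(s1, f' <- braid (f ⊗ s0)) F (r0 ∗ s1) (f' ∗ g).
Proof.
move=> hF; rewrite (algmorphM (comodalg_alg hpsi)) {1}/yd_mul /=.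
rewrite tsum_tsum //; apply: eq_tsum => x1 x2.
rewrite tsum_tsum //; apply: eq_tsum => y1 y2.
by rewrite tsum_tsum //; apply: eq_tsum => y1' x2'; rewrite tsumE.
Qed.

(** [tau] stands for the rule that moves an element of [R] leftwards past one of [Z] in the iterated
    smash product. Keeping it abstract separates multiplicativity of the twist from the details of U
    # V. *)
Variable tau : Z -> R -> tensor R Z.
Hypothesis htau : kbilin tau.
Hypothesis tau_comm : forall (X : lmodType k) (F : R -> Z -> X) z s, kbilin F ->
  \tsum_(s0, f <- psi s) \tsum_(s', z' <- tau z s0) F s' (z' ∗ w f) =
  \tsum_(s', z' <- braid (z ⊗ s)) \tsum_(s0, f <- psi s') F s0 (w f ∗ z').

Definition twisted_mul (x y : RZ) : RZ :=
  \tsum_(r, z <- x) \tsum_(s, z' <- y) \tsum_(s1, z1 <- tau z s) ((r ∗ s1) ⊗ (z1 ∗ z')).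

Lemma twist_mul x y : twist w (x ∗ y) = twisted_mul (twist w x) (twist w y).
Proof.
have hwl : klin w := ydmorph_linear hw; have hl := twist_lin hwl.
have hm := btens_mul_bilin hR hZ.
have hM : kbilin twisted_mul by rewrite /twisted_mul.
move: x; by_pure => r z; move: y; by_pure => s z'.
rewrite btens_mulE // (lin_tsum (f := twist w)) //.
in1 rewrite twistE // psi_mul //.
rhs rewrite !twistE // (lin_tsum (f := fun t => twisted_mul t _)) //.
rhs in1 rewrite (lin_tsum (f := twisted_mul _)) //.
rhs in2 rewrite /twisted_mul !tsumE //.
rhs in3 rewrite kalg_mulA //.
rhs in1 rewrite (tau_comm (F := fun s1 y => (_ ∗ s1) ⊗ (y ∗ z'))) //.
rhs in1 rewrite braid_mull //.
rhs in2 rewrite (braid_natl (F := fun s2 y =>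
  \tsum_(p, h <- psi s2) ((_ ∗ p) ⊗ ((w h ∗ (y ∗ _)) ∗ z'))) _ _ _ _ _ hw) //.
rhs in2 rewrite (braid_splitr (F := fun p h f => (_ ∗ p) ⊗ ((w h ∗ (w f ∗ _)) ∗ z')) _ _ _ _ _ _ hpm) //.
rhs in5 rewrite (kalg_mulA _ (w _)) // -kalg_mulA // wM (lin_tsum (f := fun y => _ ⊗ (y ∗ _))) //.
(* The crossing of [f] with [h] that came from splitting the coaction and the one introduced by [wM]
   cancel by symmetry of [V]. *)
rhs in4 rewrite (bsymE (F := fun f h => _ ⊗ (w (f ∗ h) ∗ _))) //.
by rhs swap0.
Qed.

End Twist.

Lemma ydmorph_id (k : fieldType) (B : hopfAlg k) (X : ydObj B) : @is_ydmorph _ _ X X id.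
Proof. by split=> // x; rewrite tsum_ptens. Qed.

Lemma ydmorph_comp (k : fieldType) (B : hopfAlg k) (X Y W : ydObj B)
    (f : X -> Y) (g : Y -> W) : is_yd Y -> is_yd W ->
  is_ydmorph f -> is_ydmorph g -> is_ydmorph (fun x => g (f x)).
Proof.
move=> hY hW hf hg; split.
- by have : klin (fun x => g (f x)) by [].
- by move=> b x; rewrite (ydmorph_act hf) (ydmorph_act hg).
move=> x; rewrite (ydmorph_coact hg) (ydmorph_coact hf) tsum_tsum //.
by in1 rewrite tsumE //.
Qed.

(** * The iterated smash product *)

Section DoubleSmash.
Variables (k : fieldType) (B : hopfAlg k) (U V : ydHopf B) (pr : V -> U -> k).
Variables (R : ydAlg B) (psi : R -> tensor R V).
Hypotheses (hU : is_ydhopf U) (hV : is_ydhopf V) (hpr : hopf_pairing pr).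
Hypotheses (hR : is_ydalg R) (hpsi : is_comodalg psi).
Let hp := pairing_bilin hpr.
Let hpm := pairing_morph hpr.
Let hh := harp_bilin hU hV hpr.
Let hUy : is_yd U := ydalg_yd (ydhopf_alg hU).
Let hVy : is_yd V := ydalg_yd (ydhopf_alg hV).
Let hRy : is_yd R := ydalg_yd hR.
Let hpsim := comodalg_yd hpsi.
Notation "f ⇀ x" := (harpoon pr f x) (at level 38, right associativity).
Notation UV := (smash (harpoon pr)).
Let hZy : is_yd UV := ydtens_yd hUy hVy.
Let hm := smash_mul_bilin hU hV hpr.
Local Notation α := (comod_act pr psi).
Local Notation RU := (smash α).
Local Notation RU_V := (smash (A := RU) (snd_act pr (R := R))).

Lemma comod_act_bilin : kbilin α.
Proof. by rewrite /comod_act. Qed.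

(** Here [v] only crosses [s], because [V] acts trivially on [R], while one leg of [u] crosses [s]
    and the other acts on it. *)
Definition smash_cross (z : UV) (s : R) : tensor R UV :=
  \tsum_(u, v <- z) \tsum_(s1, v' <- braid (v ⊗ s))
    \tsum_(u1, u2 <- yd_cop u) \tsum_(s2, u2' <- braid (u2 ⊗ s1)) (α u1 s2 ⊗ (u2' ⊗ v')).

Lemma smash_cross_bilin : kbilin smash_cross.
Proof. by have ha := comod_act_bilin; rewrite /smash_cross. Qed.

Lemma smash_smash_mul (x y : tensor R UV) :
  assocl (twisted_mul smash_cross x y) =
  @yd_mul _ _ RU_V (assocl (x : ydtens R (ydtens U V))) (assocl (y : ydtens R (ydtens U V))).
Proof.
have ha := comod_act_bilin; have hx := smash_cross_bilin.
have hal := @assocl_lin _ _ R U V.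
have hRU : is_yd RU := ydtens_yd hRy hUy.
have hsnd : kbilin (snd_act pr (R := R)) by rewrite /snd_act.
have hRUm : kbilin (@yd_mul _ _ RU) by exact: smash_bilin.
have hM : kbilin (@yd_mul _ _ RU_V) by exact: (smash_bilin hRU).
have hT : kbilin (twisted_mul smash_cross) by rewrite /twisted_mul.
move: x; by_pure => r z; move: z; by_pure => u v.
move: y; by_pure => s z; move: z; by_pure => u' v'.
rewrite {1}/twisted_mul !tsumE // (lin_tsum (f := @assocl _ _ R U V)) //.
rewrite /smash_cross tsumE // tsum_tsum //.
in1 rewrite tsum_tsum //.
in2 rewrite tsum_tsum //.
in3 rewrite tsumE // smash_mulE // (lin_tsum (f := fun z => assocl (_ ⊗ z))) //.
in4 rewrite (lin_tsum (f := fun z => assocl (_ ⊗ z))) //.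
in5 rewrite assoclE.
rhs rewrite !assoclE (smashE hRU hV hRUm hsnd).
rhs in1 rewrite braid_tensr //.
rhs in3 rewrite /snd_act tsumE // (lin_tsum (f := fun y => (_ ∗ y) ⊗ _)) //.
rhs in4 rewrite smashE // (lin_tsum (f := fun t => t ⊗ _)) //.
rhs in5 rewrite (lin_tsum (f := fun t => t ⊗ _)) //.
rhs swap2.
(* Both legs of the comultiplication of [v] merely cross [s], so they regroup into a single crossing
   of [v]. *)
rhs rewrite -(braid_copl (F := fun s1 f1 f2 => \tsum_(u1, f2' <- braid (f2 ⊗ u'))
  \tsum_(a1, a2 <- yd_cop u) \tsum_(s2, a2' <- braid (a2 ⊗ s1))
    (((r ∗ α a1 s2) ⊗ (a2' ∗ (f1 ⇀ u1))) ⊗ (f2' ∗ v')))) //.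
by swap2; swap1; swap3; swap2.
Qed.

Variables (T : U -> U) (I : Type) (phi : I -> U -> k).
Hypotheses (hUU : bsym U U) (hUV : bsym U V).
Hypotheses (TK : cancel T (@yd_ant _ _ U)) (KT : cancel (@yd_ant _ _ U) T).
Hypothesis sep : forall f, (forall x, pr f x = 0) -> f = 0.
Hypothesis hphi : forall i, klin (phi i : U -> k^o).
Hypothesis sepU : forall u, (forall i, phi i u = 0) -> u = 0.
Hypothesis RL : RL_condition pr.
Local Notation w := (RL_lift RL).
Let hwm : is_ydmorph w := RL_lift_morph hU hV hpr hUU TK KT sep hphi sepU RL.
Let hw : klin w := ydmorph_linear hwm.

Lemma RL_lift_comm_lin (X : lmodType k) (K : UV -> X) (u : U) (v f : V) : klin K ->
  \tsum_(f1, f2 <- yd_cop f) \tsum_(g, v' <- braid (v ⊗ f1))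
    \tsum_(a, u' <- braid (u ⊗ g)) \tsum_(b, u2 <- yd_cop u')
      (pr a b *: K (@yd_mul _ _ UV (u2 ⊗ v') (w f2))) =
  \tsum_(g, v' <- braid (v ⊗ f)) \tsum_(a, u' <- braid (u ⊗ g))
    K (@yd_mul _ _ UV (w a) (u' ⊗ v')).
Proof.
move=> hK.
apply: etrans (etrans (congr1 K (RL_lift_comm hU hV hpr hUU hUV TK KT sep RL u v f)) _).
  rhs rewrite (lin_tsum (f := K)) //.
  rhs in1 rewrite (lin_tsum (f := K)) //.
  rhs in2 rewrite (lin_tsum (f := K)) //.
  rhs in3 rewrite (lin_tsum (f := K)) //.
  by rhs in4 rewrite (linZ hK) //.
rewrite (lin_tsum (f := K)) //.
by in1 rewrite (lin_tsum (f := K)) //.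
Qed.

Lemma smash_cross_comm (X : lmodType k) (F : R -> UV -> X) (z : UV) (s : R) : kbilin F ->
  \tsum_(s0, f <- psi s) \tsum_(s', z' <- smash_cross z s0) F s' (z' ∗ w f) =
  \tsum_(s', z' <- braid (z ⊗ s)) \tsum_(s0, f <- psi s') F s0 (w f ∗ z').
Proof.
have hx := smash_cross_bilin; have ha := comod_act_bilin => hF.
move: z; by_pure => u v.
in1 rewrite /smash_cross tsumE // tsum_tsum //.
in2 rewrite tsum_tsum //.
in3 rewrite tsum_tsum //.
in4 rewrite tsumE // /comod_act (lin_tsum (f := fun t => F t _)) //.
in5 rewrite (lin_tsum (f := fun t => F t _)) //.
in6 rewrite (lin_tsum (f := fun t => F t _)) //.
in7 rewrite (linZ (f := fun t => F t _)) //.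
in3 rewrite (braid_splitr (F := fun r0 g a2' => \tsum_(r3, u' <- braid (_ ⊗ r0))
  \tsum_(b', u'' <- braid (u' ⊗ g)) (pr b' u'' *: F r3 (@yd_mul _ _ UV (a2' ⊗ _) (w _))))
  _ _ _ _ _ _ hpsim) //.
swap2.
in1 rewrite (braid_splitr (F := fun r0 g v' => \tsum_(a1, a2 <- yd_cop u)
  \tsum_(r1, x <- braid (a2 ⊗ r0)) \tsum_(g1, a2' <- braid (x ⊗ g))
  \tsum_(r3, u' <- braid (a1 ⊗ r1)) \tsum_(b', u'' <- braid (u' ⊗ g1))
    (pr b' u'' *: F r3 (@yd_mul _ _ UV (a2' ⊗ v') (w _)))) _ _ _ _ _ _ hpsim) //.
swap6.
in4 rewrite -(braid_copl (F := fun r3 u' x => \tsum_(g2, a2' <- braid (x ⊗ _))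
  \tsum_(b', u'' <- braid (u' ⊗ g2)) (pr b' u'' *: F r3 (@yd_mul _ _ UV (a2' ⊗ _) (w _))))) //.
in5 rewrite -(braid_copl (F := fun b' u'' a2' => (pr b' u'' *: F _ (@yd_mul _ _ UV (a2' ⊗ _) (w _))))) //.
(* The coaction hidden in [comod_act] is a second one on the same element of [R]. Coassociativity
   turns it into a comultiplication in [V], the shape required by [RL_lift_comm]. *)
rewrite -(comod_coA3 (F := fun r g f => \tsum_(r1, x <- braid (v ⊗ r))
  \tsum_(g1, v' <- braid (x ⊗ g)) \tsum_(r3, u' <- braid (u ⊗ r1))
  \tsum_(b', u'' <- braid (u' ⊗ g1)) \tsum_(b, u2 <- yd_cop u'')
    (pr b' b *: F r3 (@yd_mul _ _ UV (u2 ⊗ v') (w f)))) _ hpsi) //.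
swap1; swap3; swap2.
in3 rewrite (RL_lift_comm_lin (K := F _)) //.
rhs rewrite braid_tensl //.
rhs in1 rewrite (braid_splitr (F := fun r f p' => F r (@yd_mul _ _ UV (w f) (p' ⊗ _)))
  _ _ _ _ _ _ hpsim) //.
rhs rewrite (braid_splitr (F := fun r f q' => \tsum_(r', x <- braid (u ⊗ r))
  \tsum_(f', p' <- braid (x ⊗ f)) F r' (@yd_mul _ _ UV (w f') (p' ⊗ q'))) _ _ _ _ _ _ hpsim) //.
by rhs swap2.
Qed.

Hypotheses (hVV : bsym V V).
Variable TV : V -> V.
Hypotheses (TVK : cancel TV (@yd_ant _ _ V)) (KTV : cancel (@yd_ant _ _ V) TV).

Lemma smash_ydalg : is_ydalg UV.
Proof.
split=> //; [exact: smash_kalg TK KT sep | exact: smash_mul_morph | exact: smash_one_morph].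
Qed.

(** The transported map is [assocl] after [twist w], which starts at the algebra whose axioms are
    known; the isomorphism stated here is its inverse, whence the inverse antipode [TV]. *)
Theorem double_smash_iso :
  is_ydalg_iso (fun x : RU_V => twist psi (w \o TV) (assocr x) : btens R UV).
Proof.
have hZ := smash_ydalg.
have w1 := RL_lift_one hU hV hpr hUU TK KT sep RL.
have wM := RL_lift_mul hU hV hpr hUU TK KT sep RL.
have [wK Kw] := twist_bij hV hZ hpsi hVV TVK KTV hwm w1 wM.
have hRZ := btens_ydalg hR hZ.
have hRU : is_yd RU := ydtens_yd hRy hUy.
apply: (@transport_iso _ _ RU_V (btens R UV)
  (fun x => assocl (twist psi w x : ydtens R (ydtens U V)))) => //.
- exact: ydtens_yd.
- by move=> x; rewrite assoclK wK.
- by move=> x; rewrite Kw assocrK.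
- exact: ydmorph_comp (twist_ydmorph hV hR hZ hpsi hwm) (assocl_ydmorph hRy hUy hVy).
- by rewrite (twist_one hZ hpsi hwm w1) assoclE.
move=> x y.
have hx := smash_cross_bilin.
by rewrite (twist_mul hV hR hZ hpsi hVV hwm wM hx smash_cross_comm) smash_smash_mul.
Qed.

End DoubleSmash.

(** * Evaluation on the finite dual *)

Section RestrictedPairing.
Variables (k : fieldType) (B : hopfAlg k) (P P' Q Q' : ydObj B) (e : P' -> Q' -> k^o).
Variables (i : P -> P') (j : Q -> Q').
Hypotheses (hP : is_yd P) (hP' : is_yd P') (hQ : is_yd Q) (hQ' : is_yd Q').
Hypotheses (he : kbilin e).
Hypothesis hem : @is_ydmorph _ _ (ydtens P' Q') (ydunit B) (tsum e).
Hypotheses (hi : is_ydmorph i) (hj : is_ydmorph j).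

Lemma restrict_pairing_morph :
  @is_ydmorph _ _ (ydtens P Q) (ydunit B) (tsum (fun p q => e (i p) (j q))).
Proof.
split; first exact: tsum_lin.
- move=> b; suff h t : tsum (fun p q => e (i p) (j q)) (@yd_act _ _ (ydtens P Q) b t) =
    hcou B b *: (tsum (fun p q => e (i p) (j q)) t) by [].
  move: t; by_pure => p q; rewrite ydtens_actE // tsum_tsum // tsumE //.
  have := ydmorph_act hem b (i p ⊗ j q); rewrite tsumE // => h; rewrite -[RHS]h.
  rewrite ydtens_actE // tsum_tsum //; apply: eq_tsum => b1 b2.
  by rewrite !tsumE // (ydmorph_act hi) (ydmorph_act hj).
by_pure => p q; rewrite tsumE // ydtens_coact_tsum //.
have := ydmorph_coact hem (i p ⊗ j q); rewrite tsumE // => ->.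
rewrite ydtens_coact_tsum // (ydmorph_coact hi) tsum_tsum //.
apply: eq_tsum => b p0; rewrite tsumE // (ydmorph_coact hj) tsum_tsum //.
by apply: eq_tsum => c q0; rewrite !tsumE.
Qed.

End RestrictedPairing.

Section Evaluation.
Variables (k : fieldType) (B : hopfAlg k) (H D : ydHopf B) (ev : D -> H -> k).
Hypotheses (hH : is_ydhopf H) (hD : is_findual ev).
Let hDh := findual_hopf hD.
Let hHy : is_yd H := ydalg_yd (ydhopf_alg hH).
Let hDy : is_yd D := ydalg_yd (ydhopf_alg hDh).

Lemma ev_bilin : kbilin (ev : D -> H -> k^o).
Proof. by split=> [x|f]; [exact: findual_linear hD x | exact: (findual_in hD f).1]. Qed.

Lemma ev_morph : @is_ydmorph _ _ (ydtens D H) (ydunit B) (tsum ev).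
Proof.
have he := ev_bilin; have hDH : is_yd (ydtens D H) := ydtens_yd hDy hHy.
have hc : klin (@yd_coact _ _ (ydtens D H)) := yd_coact_linear hDH.
split; first exact: tsum_lin.
- move=> b; suff h t : tsum (ev : D -> H -> k^o) (@yd_act _ _ (ydtens D H) b t) =
    hcou B b *: (tsum (ev : D -> H -> k^o) t) by [].
  move: t; by_pure => f x; rewrite ydtens_actE // tsum_tsum // tsumE //.
  in1 rewrite tsumE // (findual_act hD) -yd_actM //.
  rewrite (hantl_lin (K := fun h => ev f (h ·> x) : k^o)) // yd_act1 //.
move=> t; suff: @ptens k B k^o 1 (tsum (ev : D -> H -> k^o) t) =
  \tsum_(b, s <- @yd_coact _ _ (ydtens D H) t) (b ⊗ tsum (ev : D -> H -> k^o) s) by [].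
move: t; by_pure => f x; rewrite tsumE // ydtens_coact_tsum //.
(* Writing a scalar as a multiple of 1 lets it move to the factor in [B], where [findual_coact]
   determines the coaction of [f]. The resulting S^-1 then cancels against the coaction of [x]. *)
have s1 (a : k) : a *: (1 : k^o) = a by exact: mulr1.
rhs in2 rewrite tsumE // -[ev _ _]s1 (linZ (f := fun a : k^o => _ ⊗ a)) //.
rhs rewrite tsumC.
rhs in2 rewrite -(linZ (f := fun b => (b * _) ⊗ (1 : k^o))) //.
rhs in1 rewrite -(lin_tsum (f := fun b => (b * _) ⊗ (1 : k^o))) // (findual_coact hD).
rhs in1 rewrite (lin_tsum (f := fun b => (b * _) ⊗ (1 : k^o))) //.
rhs rewrite -(coactA3 (F := fun c d y => ((ev f y *: hantV d) * c) ⊗ (1 : k^o))) //.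
rhs in2 rewrite -scalerAl.
rhs in1 rewrite (hantVl_lin (K := fun h => (ev f _ *: h) ⊗ (1 : k^o))) //.
rewrite (coact_cou_lin (K := fun y => (ev f y *: (1 : B)) ⊗ (1 : k^o))) //.
by rewrite (linZ (f := fun b : B => b ⊗ (1 : k^o))) //
  -(linZ (f := fun a : k^o => (1 : B) ⊗ a)) // s1.
Qed.

Lemma ev_cop f x y : ev f (x ∗ y) =
  \tsum_(f1, f2 <- yd_cop f) \tsum_(x', f2' <- braid (f2 ⊗ x)) ((ev f1 x' : k) *: (ev f2' y : k^o)).
Proof. by rewrite -(findual_cop hD). Qed.

Lemma ev_mul f g x : ev (f ∗ g) x =
  \tsum_(x1, x2 <- yd_cop x) \tsum_(x1', g' <- braid (g ⊗ x1)) ((ev f x1' : k) *: (ev g' x2 : k^o)).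
Proof. by rewrite (findual_mul hD). Qed.

Variables (U V : ydHopf B) (iU : U -> D) (iV : V -> H).
Hypotheses (hU : is_ydhopf U) (hiU : is_hopf_inclusion iU).
Hypotheses (hV : is_ydhopf V) (hiV : is_hopf_inclusion iV).
Hypotheses (hHH : bsym H H) (hdense : forall x : H, (forall u : U, ev (iU u) x = 0) -> x = 0).
Let hUy : is_yd U := ydalg_yd (ydhopf_alg hU).
Let hVy : is_yd V := ydalg_yd (ydhopf_alg hV).
Let hiUy := hincl_yd hiU.
Let hiVy := hincl_yd hiV.
Let evU (u : U) (x : H) : k^o := ev (iU u) x.
Let e (u : U) (v : V) : k^o := ev (iU u) (iV v).
Local Notation pr := (fpair e).

Lemma evU_bilin : kbilin evU.
Proof. by have he := ev_bilin; rewrite /evU. Qed.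

Lemma evU_morph : @is_ydmorph _ _ (ydtens U H) (ydunit B) (tsum evU).
Proof. exact: restrict_pairing_morph hUy hDy hHy hHy ev_bilin ev_morph hiUy (ydmorph_id H). Qed.

Lemma evU_sep u : (forall x, evU u x = 0) -> u = 0.
Proof.
have he := ev_bilin => h; apply: (hincl_inj hiU); rewrite (lin0 (f := iU)) //.
apply: (findual_inj hD) => x; rewrite [LHS]h; symmetry.
exact: (lin0 (f := fun f => ev f x : k^o)).
Qed.

Lemma e_bilin : kbilin e.
Proof. by have he := ev_bilin; rewrite /e. Qed.

Lemma e_morph : @is_ydmorph _ _ (ydtens U V) (ydunit B) (tsum e).
Proof. exact: restrict_pairing_morph hUy hDy hVy hHy ev_bilin ev_morph hiUy hiVy. Qed.

Lemma e_sep v : (forall u, e u v = 0) -> v = 0.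
Proof. by move=> h; apply: (hincl_inj hiV); rewrite (lin0 (f := iV)) //; exact: hdense. Qed.

(** Evaluation is nondegenerate on the side of [U], so [bsym_dual] carries symmetry from [H] to [U];
    a second application gives symmetry of [U] with itself. *)
Let hHU : bsym H U := bsym_dual hUy hHy hHy evU_bilin evU_morph evU_sep hHH.

Lemma bsym_UU : bsym U U.
Proof. exact: bsym_dual hUy hHy hUy evU_bilin evU_morph evU_sep (bsymC hHy hUy hHU). Qed.

Lemma bsym_UV : bsym U V.
Proof. exact: bsym_sub hVy hHy hUy hiVy evU_bilin e_sep (bsymC hHy hUy hHU). Qed.

Let hVU : bsym V U := bsymC hUy hVy bsym_UV.

Lemma e_mulr (u : U) (v w : V) : e u (v ∗ w) =
  \tsum_(u1, u2 <- yd_cop u) \tsum_(v', u2' <- braid (u2 ⊗ v)) ((e u1 v' : k) *: e u2' w).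
Proof.
have he := ev_bilin.
rewrite /e (algmorphM (hincl_alg hiV)) ev_cop (hincl_cop hiU) tsum_tsum //.
apply: eq_tsum => u1 u2; rewrite tsumE //.
rewrite (braid_natl (F := fun x f => (ev _ x : k) *: (ev f _ : k^o)) _ _ _ _ _ hiUy) //.
by rewrite (braid_natr (F := fun x u => (ev _ x : k) *: (ev (iU u) _ : k^o)) _ _ _ _ _ hiVy).
Qed.

Lemma e_mull (u w : U) (v : V) : e (u ∗ w) v =
  \tsum_(v1, v2 <- yd_cop v) \tsum_(v1', w' <- braid (w ⊗ v1)) ((e u v1' : k) *: e w' v2).
Proof.
have he := ev_bilin.
rewrite /e (algmorphM (hincl_alg hiU)) ev_mul (hincl_cop hiV) tsum_tsum //.
apply: eq_tsum => v1 v2; rewrite tsumE //.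
rewrite (braid_natl (F := fun x f => (ev _ x : k) *: (ev f _ : k^o)) _ _ _ _ _ hiUy) //.
by rewrite (braid_natr (F := fun x u => (ev _ x : k) *: (ev (iU u) _ : k^o)) _ _ _ _ _ hiVy).
Qed.

Lemma e_oner u : e u (yd_one V) = yd_cou u.
Proof. by rewrite /e (algmorph1 (hincl_alg hiV)) -(findual_cou hD) (hincl_cou hiU). Qed.

Lemma e_onel v : e (yd_one U) v = yd_cou v.
Proof. by rewrite /e (algmorph1 (hincl_alg hiU)) (findual_one hD) (hincl_cou hiV). Qed.

Lemma ev_pairing : hopf_pairing pr.
Proof.
have hp := fpair_bilin hU hV e_bilin.
split=> [||X z f g x|X z f x y||].
- exact: hp.
- exact: fpair_morph hU hV e_bilin e_morph.
- rewrite (fpair_mull hU hV hVU e_bilin e_mulr).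
  rewrite (lin_tsum (f := fun a : k^o => (a : k) *: z)) //.
  in1 rewrite (lin_tsum (f := fun a : k^o => (a : k) *: z)) //.
  by in2 rewrite -scalerA.
- rewrite (fpair_mulr hU hV hVU e_bilin e_mull).
  rewrite (lin_tsum (f := fun a : k^o => (a : k) *: z)) //.
  in1 rewrite (lin_tsum (f := fun a : k^o => (a : k) *: z)) //.
  by in2 rewrite -scalerA.
- exact: (fpair_onel hU hV e_bilin e_oner).
exact: (fpair_oner hU hV e_bilin e_onel).
Qed.

Lemma ev_pairing_sep v : (forall u, pr v u = 0) -> v = 0.
Proof. exact: fpair_sep hU hV bsym_UV e_bilin e_morph e_sep v. Qed.

(** The flipped pairing is nondegenerate on the side of [V], so [V] plays the dual of [U] and
    inherits symmetry from the pair [V], [U]. *)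
Lemma bsym_VV : bsym V V.
Proof.
exact: bsym_dual hVy hUy hVy (pairing_bilin ev_pairing) (pairing_morph ev_pairing)
  ev_pairing_sep hVU.
Qed.

End Evaluation.

Theorem corollary2p6 (k : fieldType) (B : hopfAlg k)
    (H : ydHopf B) (hH : is_ydhopf H)
    (hsym : cancel (@braid k B H H) (@braid k B H H))
    (D : ydHopf B) (ev : D -> H -> k) (hD : is_findual ev)
    (U : ydHopf B) (hU : is_ydhopf U)
    (iU : U -> D) (hiU : is_hopf_inclusion iU)
    (V : ydHopf B) (hV : is_ydhopf V)
    (iV : V -> H) (hiV : is_hopf_inclusion iV)
    (hSU : bijective (@yd_ant k B U)) (hSV : bijective (@yd_ant k B V))
    (hdense : forall x : H, (forall u : U, ev (iU u) x = 0) -> x = 0) :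
  let pr := flip_pair (fun (u : U) (v : V) => ev (iU u) (iV v)) in
  RL_condition pr ->
  forall (R : ydAlg B) (hR : is_ydalg R)
    (psi : R -> tensor R V) (hpsi : is_comodalg psi),
  let RU := smash (comod_act pr psi) in
  let RU_V := smash (A := RU) (snd_act pr (R := R)) in
  let R_UV := btens R (smash (harpoon pr)) in
  exists Phi : RU_V -> R_UV,
    is_kalg_iso Phi /\
    (hcommutative B -> hcocommutative B -> is_ydalg_iso Phi).
Proof.
move=> pr RL R hR psi hpsi RU RU_V R_UV.
have hpr : hopf_pairing pr := ev_pairing hH hD hU hiU hV hiV hsym hdense.
have sep := ev_pairing_sep hH hD hU hiU hV hiV hsym hdense.
have hUU := bsym_UU hH hD hU hiU hsym.
have hUV := bsym_UV hH hD hU hiU hV hiV hsym hdense.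
have hVV := bsym_VV hH hD hU hiU hV hiV hsym hdense.
have [TU KTU TUK] := hSU; have [TV KTV TVK] := hSV.
(* The elements of [H], acting by evaluation, serve as the separating family of functionals on
   [U]. *)
have hphi (x : H) : klin (fun u => ev (iU u) x : k^o).
  exact: (evU_bilin hD hiU).1.
have sepU u : (forall x : H, ev (iU u) x = 0) -> u = 0 := @evU_sep _ _ _ _ _ hD _ _ hiU u.
have hPhi := double_smash_iso hU hV hpr hR hpsi hUU hUV TUK KTU sep hphi sepU RL hVV TVK KTV.
exists (fun x => twist psi (RL_lift RL \o TV) (assocr x)); split=> [|_ _]; last exact: hPhi.
exact: ydalg_iso_kalg hPhi.
Qed.
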